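(* Let $T>0$ and let $u_0,u_T\in\mathcal S_2(\mathbb R^n)$ be nonlinear at infinity. The Dirichlet problem $$\ddot{(1/u)}+|\nabla(\dot u/u)|^2_{(\nabla^2u)^{-1}}=0,\qquad u(0,\cdot)=u_0,\quad u(T,\cdot)=u_T,$$ (on $t\in[0,T]$, $x\ne0$) admits a unique nonlinear-at-infinity solution $u(t)\in\mathcal S_2(\mathbb R^n)$, given by $$u(t,x)=\left(\Big(1-\frac tT\Big)u_0^\circ+\frac tT\,u_T^\circ\right)^{\!\circ}(x)=\left(\frac{Tu_0}{T-t}\boxdot\frac{Tu_T}{t}\right)(x).$$
   Context: Dots denote $\partial/\partial t$; $\ddot{(1/u)}=\partial^2(1/u)/\partial t^2$; $\nabla,\nabla^2$ are in the variable $x$; $|X|^2_{(\nabla^2u)^{-1}}=\langle X,(\nabla^2u)^{-1}X\rangle$. $\mathrm{Cvx}_0(\mathbb R^n)$ is the set of convex lower semi-continuous $f:\mathbb R^n\to[0,+\infty]$ with $f(0)=0$. The polar of $f$ is $f^\circ(y)=\inf\{c\ge0:\langle x,y\rangle\le1+cf(x)\ \forall x\in\mathbb R^n\}$. Define $a\boxdot b=(a^\circ+b^\circ)^\circ$ (the last expression in the claim is for $0<t<T$). $\mathcal S_1(\mathbb R^n)$ is the class of $f\in\mathrm{Cvx}_0(\mathbb R^n)$ that are finite everywhere, continuously differentiable on $\mathbb R^n\setminus\{0\}$ and strictly convex (the graph contains no segment). $\mathcal S_2(\mathbb R^n)\subset\mathcal S_1(\mathbb R^n)$ is the subclass of functions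 twice continuously differentiable on $\mathbb R^n\setminus\{0\}$ with $\nabla^2f(x)>0$ for all $x\ne0$. A function $f\in\mathrm{Cvx}_0(\mathbb R^n)$ is nonlinear at infinity if for every ray $\mathbb R^+x$ ($x\ne0$) the function $t\mapsto f(tx)$, $t\in\mathbb R^+$, is finite on all of $\mathbb R^+$ and is not between $h(t)=at$ and $h(t)-b$ for any $a\ge0$, $b>0$ (i.e. there are no such $a,b$ with $at-b\le f(tx)\le at$ for all $t\ge0$). A nonlinear-at-infinity solution $u(t)\in\mathcal S_2$ is a function $u\in C^2([0,T]\times(\mathbb R^n\setminus\{0\}))$ with $u(t)=u(t,\cdot)\in\mathcal S_2(\mathbb R^n)$ nonlinear at infinity for each $t$, satisfying the equation for $x\ne0$ and the boundary conditions. *)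

(* Defs.v *)
From HB Require Import structures.
From mathcomp Require Import all_boot all_order all_algebra.
From mathcomp Require Import all_classical all_reals.
From mathcomp Require Import ereal topology normedtype derive.

Set Implicit Arguments.
Unset Strict Implicit.
Unset Printing Implicit Defensive.

Import Order.TTheory GRing.Theory Num.Theory.
Import numFieldNormedType.Exports.

Local Open Scope classical_set_scope.
Local Open Scope ring_scope.

Section Vectors.
Context {R : realType} {n : nat}.
Implicit Types (x y v : 'rV[R]_n) (M : 'M[R]_n) (f : 'rV[R]_n -> R).

Definition dot x y : R := (x *m y^T) 0 0.

Definition quad M v : R := dot (v *m M) v.

Definition posdef M : Prop := forall v, v != 0 -> 0 < quad M v.

Definition basis_vec (i : 'I_n) : 'rV[R]_n := delta_mx 0 i.

Definition partial (i : 'I_n) f x : R := 'D_(basis_vec i) f x.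

Definition grad f x : 'rV[R]_n := \row_i partial i f x.

Definition hess f x : 'M[R]_n := \matrix_(i, j) partial i (partial j f) x.

Definition C1_off0 f : Prop :=
  forall x, x != 0 -> differentiable f x /\ {for x, continuous (grad f)}.

Definition C2_off0 f : Prop :=
  C1_off0 f /\ forall i, C1_off0 (partial i f).

End Vectors.

Section ConvexFunctions.
Context {R : realType} {n : nat}.
Implicit Types (f g : 'rV[R]_n -> \bar R) (x y : 'rV[R]_n).

Definition convex_efun f : Prop :=
  forall x y (s : R), 0 < s < 1 ->
    (f ((1 - s) *: x + s *: y)%R <= (1 - s)%:E * f x + s%:E * f y)%E.

Definition cvx0 f : Prop :=
  [/\ convex_efun f, lower_semicontinuous f,
      (forall x, (0 <= f x)%E) & f 0 = 0%E].

(* Here [0 * +oo = 0]. The infimum would be the same with [0 * +oo = +oo]: if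
   the inequality holds for c = 0 with the latter convention, it holds for every
   c > 0. *)
Definition polar f : 'rV[R]_n -> \bar R := fun y =>
  ereal_inf [set c%:E | c in [set c : R |
    0 <= c /\ forall x, ((dot x y)%:E <= 1 + c%:E * f x)%E]].

Definition box f g : 'rV[R]_n -> \bar R := polar (polar f \+ polar g)%E.

(* The whole segment from (x, f x) to (y, f y) lies on the graph of f. *)
Definition graph_has_segment f : Prop :=
  exists x y, x != y /\
    forall s : R, 0 <= s <= 1 ->
      f ((1 - s) *: x + s *: y) = ((1 - s)%:E * f x + s%:E * f y)%E.

Definition class_S1 f : Prop :=
  [/\ cvx0 f, (forall x, f x \is a fin_num), C1_off0 (fine \o f)
    & ~ graph_has_segment f].

Definition class_S2 f : Prop :=
  [/\ class_S1 f, C2_off0 (fine \o f)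
    & forall x, x != 0 -> posdef (hess (fine \o f) x)].

Definition nonlinear_at_infinity f : Prop :=
  forall x, x != 0 ->
    (forall t : R, 0 <= t -> f (t *: x) \is a fin_num) /\
    ~ exists a b : R, [/\ 0 <= a, 0 < b &
        forall t : R, 0 <= t ->
          ((a * t - b)%:E <= f (t *: x))%E /\ (f (t *: x) <= (a * t)%:E)%E].

End ConvexFunctions.

(* Derivative of a function of one real variable relative to [D]: the
   difference quotient is only taken at points of [D], so that it is one-sided
   at an end point of an interval. *)
Section DerivativeWithin.
Context {R : realType}.
Implicit Types (D : set R) (g : R -> R) (t : R).

Definition derivable_within D g t : Prop :=
  cvg ((fun s => (g s - g t) / (s - t)) @ within D t^').

Definition derive_within D g t : R :=
  lim ((fun s => (g s - g t) / (s - t)) @ within D t^').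

End DerivativeWithin.

(* Functions of (t, x) on [0, T] x (R^n \ {0}); values elsewhere are
   irrelevant. *)
Section SpaceTime.
Context {R : realType} {n : nat}.
Implicit Types (T t : R) (u : R -> 'rV[R]_n -> R) (x : 'rV[R]_n).

Definition slab T : set (R * 'rV[R]_n) := [set p | 0 <= p.1 <= T /\ p.2 != 0].

Definition dt T u t x : R := derive_within `[0, T] (u ^~ x) t.

Definition C0_slab T u : Prop :=
  {within slab T, continuous (fun p : R * 'rV[R]_n => u p.1 p.2)}.

(* All first order partial derivatives exist on the slab (one-sided in t at
   t = 0 and t = T) and are continuous there. *)
Definition C1_slab T u : Prop :=
  [/\ C0_slab T u,
      (forall t x, slab T (t, x) -> derivable_within `[0, T] (u ^~ x) t),
      C0_slab T (dt T u),
      (forall t x i, slab T (t, x) -> derivable (u t) x (basis_vec i))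
    & forall i, C0_slab T (fun t => partial i (u t))].

Definition C2_slab T u : Prop :=
  [/\ C1_slab T u, C1_slab T (dt T u)
    & forall i, C1_slab T (fun t => partial i (u t))].

Definition pde T u : Prop :=
  forall t x, 0 <= t <= T -> x != 0 ->
    dt T (dt T (fun s y => (u s y)^-1)) t x
    + quad (invmx (hess (u t) x)) (grad (fun y => dt T u t y / u t y) x) = 0.

Definition nonlinear_at_infinity_solution T (u0 uT : 'rV[R]_n -> \bar R) u :
    Prop :=
  [/\ C2_slab T u,
      (forall t, 0 <= t <= T ->
        class_S2 (EFin \o u t) /\ nonlinear_at_infinity (EFin \o u t)),
      pde T u,
      EFin \o u 0 = u0
    & EFin \o u T = uT].

End SpaceTime.

(* Main.v *)
Require Import Defs.
From HB Require Import structures.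
From mathcomp Require Import all_boot all_order all_algebra.
From mathcomp Require Import all_classical all_reals.
From mathcomp Require Import ereal topology normedtype derive.
From mathcomp Require Import landau.
From mathcomp Require Import ring lra.

Set Implicit Arguments.
Unset Strict Implicit.
Unset Printing Implicit Defensive.

Import Order.TTheory GRing.Theory Num.Theory.
Import numFieldNormedType.Exports.

Local Open Scope classical_set_scope.
Local Open Scope ring_scope.

(* Let f be nonlinear at infinity and in the class S_2. For y <> 0 the supremum
   of (<z, y> - 1) / f z, which is the polar f^o y, is attained at a single
   point x <> 0, and it is related to y by y = grad f x / k x, f^o y = 1 / k x,
   where k x = <x, grad f x> - f x. Hence f^oo = f, and f^o is again nonlinear
   at infinity and in S_2, with grad f^o y = x / f x.

   For a family w(t), the inverse function argument applied to (t, x) |-> (t, y)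
   shows that the polars v(t) = w(t)^o form a C^2 family, and differentiating
   v(t, y) = (<x, y> - 1) / w(t, x) at the touching point x = x(t, y) gives
     v_tt (t, y) = v w ((1/w)_tt + |grad (w_t / w)|^2_{(hess w)^-1}) (t, x).
   So w solves the equation iff v is affine in time. *)

(** The obstacle is regularity. The slab is closed in time and omits the origin in space, so an
    inverse function theorem on open sets does not reach the faces t = 0 and t = T. But the inverse
    of (t, x) |-> (t, y) is known globally, since touching points exist and are unique. What remains
    is its continuity, which comes from convexity, and the invertibility of one Jacobian matrix; a
    form of differentiability that makes sense along any set then yields the derivatives. No
    derivative is lost: by the envelope principle the first derivatives of v involve only x, v, w
    and w_t, never second derivatives of w, so C^2 passes from w to v. Nonlinearity at infinity is
    what keeps the maximizer from escaping to infinity. Existence and uniqueness then both come from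
    applying the polar transform twice. Existence also needs the affine path between the two polars
    to be an admissible family itself; the delicate point there is that a convex combination stays
    nonlinear at infinity. The two end functions are treated as families constant in time, so that
    one calculus serves throughout. *)

Lemma cvg_sumr {R : realType} {T : Type} {F : set_system T} {FF : Filter F}
    {I : finType} (f : I -> T -> R) (l : I -> R) :
  (forall i, f i x @[x --> F] --> l i) ->
  \sum_i f i x @[x --> F] --> \sum_i l i.
Proof. by move=> h; apply: cvg_big => //; exact: add_continuous. Qed.

Lemma cvg_prodr {R : realType} {T : Type} {F : set_system T} {FF : Filter F}
    {I : finType} (f : I -> T -> R) (l : I -> R) :
  (forall i, f i x @[x --> F] --> l i) ->
  \prod_i f i x @[x --> F] --> \prod_i l i.
Proof. by move=> h; apply: cvg_big => //; exact: mul_continuous. Qed.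

(** * Differential calculus along an arbitrary set *)

Section Caratheodory.
Context {R : realType} {n : nat}.
Local Notation P := (R * 'rV[R]_n)%type.
Implicit Types (p q : P) (F G : P -> R).

Definition co (j : 'I_n.+1) (p : P) : R :=
  if unlift ord0 j is Some i then p.2 0 i else p.1.

Lemma co0 p : co ord0 p = p.1.
Proof. by rewrite /co unlift_none. Qed.

Lemma coS i p : co (lift ord0 i) p = p.2 0 i.
Proof. by rewrite /co liftK. Qed.

Variable S : set P.
Local Notation nb p := (within S (nbhs p)).

Lemma co_cvg j p : co j q @[q --> nb p] --> co j p.
Proof.
apply: cvg_within_filter; rewrite /co; case: (unlift ord0 j) => [i|].
  apply: (cvg_comp snd (fun v : 'rV[R]_n => v 0 i)); first exact: cvg_snd.
  exact: coord_continuous.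
exact: cvg_fst.
Qed.

(* Caratheodory's form of differentiability along S. As S need not be open, the
   time derivative is one-sided on the faces t = 0 and t = T of the slab; linear
   parts are indexed by 'I_n.+1 with time first (see co). *)
Definition cdiff p F (d : 'I_n.+1 -> R) : Prop :=
  exists2 B : 'I_n.+1 -> P -> R,
    (forall j, B j q @[q --> nb p] --> d j) &
    \forall q \near nb p, F q - F p = \sum_j B j q * (co j q - co j p).

Lemma cdiff_cvg p F d : cdiff p F d -> F q @[q --> nb p] --> F p.
Proof.
move=> [B Bd BF].
have h : F p + \sum_j B j q * (co j q - co j p) @[q --> nb p] -->
    F p + \sum_j d j * (co j p - co j p).
  apply: cvgD; first exact: cvg_cst.
  apply: cvg_sumr => j; apply: cvgM => //.
  by apply: cvgB; [exact: co_cvg|exact: cvg_cst].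
rewrite big1 ?addr0 in h; last by move=> j _; rewrite subrr mulr0.
apply: cvg_trans h; apply: near_eq_cvg; near=> q.
by rewrite -(near BF q)// addrC subrK.
Unshelve. all: by end_near. Qed.

Lemma cdiff_eq p F d d' : cdiff p F d -> d =1 d' -> cdiff p F d'.
Proof. by move=> h /funext <-. Qed.

Lemma cdiff_ext p F G d : S p -> {in S, F =1 G} -> cdiff p F d -> cdiff p G d.
Proof.
move=> Sp FG [B Bd BF]; exists B => //.
have nS : \forall q \near nb p, S q by exact: withinT.
near=> q; rewrite -!FG ?inE//; near: q => //.
Unshelve. all: by end_near. Qed.

Lemma cdiff_cst p a : cdiff p (fun=> a) (fun=> 0).
Proof.
exists (fun _ _ => 0) => [j|]; first exact: cvg_cst.
by near=> q; rewrite subrr big1// => j _; rewrite mul0r.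
Unshelve. all: by end_near. Qed.

Lemma cdiff_co p j : cdiff p (co j) (fun l => (l == j)%:R).
Proof.
exists (fun l _ => (l == j)%:R) => [l|]; first exact: cvg_cst.
near=> q; rewrite (bigD1 j)//= eqxx mul1r big1 ?addr0// => l /negbTE ->.
by rewrite mul0r.
Unshelve. all: by end_near. Qed.

Lemma cdiffD p F G d e : cdiff p F d -> cdiff p G e ->
  cdiff p (fun q => F q + G q) (fun j => d j + e j).
Proof.
move=> [B Bd BF] [C Ce CG]; exists (fun j q => B j q + C j q) => [j|].
  exact: cvgD.
near=> q.
have -> : F q + G q - (F p + G p) = (F q - F p) + (G q - G p) by ring.
rewrite (near BF q)//.
rewrite (near CG q)//.
by rewrite -big_split; apply: eq_bigr => j _; rewrite mulrDl.
Unshelve. all: by end_near. Qed.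

Lemma cdiffM p F G d e : cdiff p F d -> cdiff p G e ->
  cdiff p (fun q => F q * G q) (fun j => F p * e j + d j * G p).
Proof.
move=> cF [C Ce CG]; have Fc := cdiff_cvg cF; have [B Bd BF] := cF.
exists (fun j q => F q * C j q + B j q * G p) => [j|].
  by apply: cvgD; apply: cvgM => //; exact: cvg_cst.
near=> q.
have -> : F q * G q - F p * G p = F q * (G q - G p) + (F q - F p) * G p by ring.
rewrite (near BF q)//.
rewrite (near CG q)//.
rewrite mulr_sumr mulr_suml -big_split; apply: eq_bigr => j _ /=.
ring.
Unshelve. all: by end_near. Qed.

Lemma cdiffN p F d : cdiff p F d -> cdiff p (fun q => - F q) (fun j => - d j).
Proof.
move=> [B Bd BF]; exists (fun j q => - B j q) => [j|]; first exact: cvgN.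
near=> q; rewrite -opprD.
rewrite (near BF q)//.
by rewrite -sumrN; apply: eq_bigr => j _; rewrite mulNr.
Unshelve. all: by end_near. Qed.

Lemma cdiffB p F G d e : cdiff p F d -> cdiff p G e ->
  cdiff p (fun q => F q - G q) (fun j => d j - e j).
Proof. by move=> cF cG; apply: cdiffD => //; exact: cdiffN. Qed.

Lemma cdiffV p F d : F p != 0 -> cdiff p F d ->
  cdiff p (fun q => (F q)^-1) (fun j => - d j / F p ^+ 2).
Proof.
move=> F0 cF; have Fc := cdiff_cvg cF; have [B Bd BF] := cF.
exists (fun j q => - B j q * ((F q)^-1 * (F p)^-1)) => [j|].
  rewrite expr2 invfM; apply: cvgM; first exact: cvgN.
  by apply: cvgM; [exact: cvgV|exact: cvg_cst].
have F0' : \forall q \near nb p, F q != 0 by exact: cvgr_neq0 Fc F0.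
near=> q.
have Fq0 : F q != 0 by near: q.
have -> : (F q)^-1 - (F p)^-1 = (F q - F p) * (- ((F q)^-1 * (F p)^-1)).
  by field; rewrite F0 Fq0.
rewrite (near BF q)//.
by rewrite mulr_suml; apply: eq_bigr => j _; ring.
Unshelve. all: by end_near. Qed.

Lemma cdiff_sum {I : finType} p (F : I -> P -> R) (d : I -> 'I_n.+1 -> R) :
  (forall i, cdiff p (F i) (d i)) ->
  cdiff p (fun q => \sum_i F i q) (fun j => \sum_i d i j).
Proof.
move=> /(_ _)/cid2-/all_sig2[B Bd BF].
exists (fun j q => \sum_i B i j q) => [j|]; first by apply: cvg_sumr.
have h : \forall q \near nb p, forall i,
    F i q - F i p = \sum_j B i j q * (co j q - co j p).
  by apply: filter_forall.
near=> q.
have hq : forall i, F i q - F i p = \sum_j B i j q * (co j q - co j p)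
  by near: q.
rewrite -sumrB; under eq_bigr do rewrite hq.
by rewrite exchange_big; apply: eq_bigr => j _; rewrite mulr_suml.
Unshelve. all: by end_near. Qed.

(** Slopes compose like matrices. [Z] has to converge within [S], because the expansion of [F]
    around [Z p] is only available at points of [S]. *)
Lemma cdiff_comp p (Z : P -> P) F (d : 'I_n.+1 -> R)
    (e : 'I_n.+1 -> 'I_n.+1 -> R) :
  Z q @[q --> nb p] --> nb (Z p) ->
  cdiff (Z p) F d -> (forall l, cdiff p (co l \o Z) (e l)) ->
  cdiff p (F \o Z) (fun j => \sum_l d l * e l j).
Proof.
move=> Zc [B Bd BF] /(_ _)/cid2-/all_sig2[C Ce CZ].
exists (fun j q => \sum_l B l (Z q) * C l j q) => [j|].
  apply: cvg_sumr => l; apply: cvgM => //.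
  exact: (cvg_comp Z (B l) Zc (Bd l)).
have h : \forall q \near nb p, forall l, (co l \o Z) q - (co l \o Z) p
    = \sum_j C l j q * (co j q - co j p) by apply: filter_forall.
have h' := Zc _ BF.
near=> q.
have hq : forall l, (co l \o Z) q - (co l \o Z) p
    = \sum_j C l j q * (co j q - co j p) by near: q.
have -> : (F \o Z) q - (F \o Z) p
    = \sum_l B l (Z q) * (co l (Z q) - co l (Z p)) by near: q.
under eq_bigr do rewrite hq mulr_sumr.
rewrite exchange_big; apply: eq_bigr => j _ /=.
by rewrite mulr_suml; apply: eq_bigr => l _; rewrite mulrA.
Unshelve. all: by end_near. Qed.

End Caratheodory.

(** * Limits of determinants and inverse matrices *)

Section MatrixLimits.
Context {R : realType} {T : Type} {F : set_system T} {FF : Filter F}.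

Lemma cvg_det m (M : T -> 'M[R]_m) (L : 'M[R]_m) :
  (forall i j, M x i j @[x --> F] --> L i j) ->
  \det (M x) @[x --> F] --> \det L.
Proof.
move=> ML; rewrite /determinant.
apply: cvg_sumr => s; apply: cvgM; first exact: cvg_cst.
by apply: cvg_prodr => i; exact: ML.
Qed.

Lemma near_unitmx m (M : T -> 'M[R]_m) (L : 'M[R]_m) :
  (forall i j, M x i j @[x --> F] --> L i j) -> L \in unitmx ->
  \forall x \near F, M x \in unitmx.
Proof.
move=> ML; rewrite unitmxE unitfE => L0.
have : \forall x \near F, \det (M x) != 0 by exact: cvgr_neq0 (cvg_det ML) L0.
by apply: filterS => x; rewrite unitmxE unitfE.
Qed.

(** By Cramer's rule the entries are cofactors over the determinant. [invmx] obeys this rule on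
    invertible matrices only, hence the passage to points where [M x] is invertible. *)
Lemma cvg_invmx m (M : T -> 'M[R]_m) (L : 'M[R]_m) :
  (forall i j, M x i j @[x --> F] --> L i j) -> L \in unitmx ->
  forall i j, invmx (M x) i j @[x --> F] --> invmx L i j.
Proof.
move=> ML Lu i j.
have h : (\det (M x))^-1 * cofactor (M x) j i @[x --> F] -->
    (\det L)^-1 * cofactor L j i.
  apply: cvgM.
    by apply: cvgV; [rewrite unitmxE unitfE in Lu|exact: cvg_det].
  apply: cvgM; first exact: cvg_cst.
  apply: cvg_det => k l; rewrite !mxE; under eq_fun do rewrite !mxE.
  exact: ML.
rewrite /invmx Lu !mxE; apply: cvg_trans h; apply: near_eq_cvg.
have Mu := near_unitmx ML Lu.
near=> x; rewrite (_ : M x \in unitmx = true) ?mxE//.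
by near: x.
Unshelve. all: by end_near. Qed.

End MatrixLimits.

(** * Derivative of an inverse map *)

Section Inverse.
Context {R : realType} {n : nat}.
Local Notation P := (R * 'rV[R]_n)%type.
Variable S : set P.
Local Notation nb p := (within S (nbhs p)).

(** Expanding [e] at [Z p] turns e (Z q) = q into (Z q - Z p) N(q) = q - p, a row vector times a
    matrix, where N(q) consists of the slopes of [e] at [Z q] and tends to [M]. Inverting N(q) gives
    the slopes of [Z]. The inverse and its continuity are given, so [S] may contain boundary
    points. *)
Lemma cdiff_inverse p (Z : P -> P) (e : 'I_n.+1 -> P -> R) (M : 'M[R]_n.+1) :
  S p -> Z q @[q --> nb p] --> nb (Z p) ->
  (forall j, cdiff S (Z p) (e j) (M ^~ j)) -> M \in unitmx ->
  (forall q j, S q -> e j (Z q) = co j q) ->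
  forall l, cdiff S p (co l \o Z) (fun j => invmx M j l).
Proof.
move=> Sp Zc /(_ _)/cid2-/all_sig2[B BM Be] Mu eZ l.
pose N q : 'M[R]_n.+1 := \matrix_(k, j) B j k (Z q).
have NM k j : N q k j @[q --> nb p] --> M k j.
  by under eq_fun do rewrite mxE; exact: (cvg_comp Z (B j k) Zc (BM j k)).
exists (fun j q => invmx (N q) j l) => [j|]; first exact: cvg_invmx.
have Nu : \forall q \near nb p, N q \in unitmx by exact: near_unitmx NM Mu.
have h : \forall q \near nb p, forall j, e j (Z q) - e j (Z p)
    = \sum_k B j k (Z q) * (co k (Z q) - co k (Z p)).
  by apply: filter_forall => j; exact: (Zc _ (Be j)).
have Sq : \forall q \near nb p, S q by exact: withinT.
near=> q.
have Nqu : N q \in unitmx by near: q.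
pose c : 'rV[R]_n.+1 := \row_k (co k (Z q) - co k (Z p)).
have cN : c *m N q = \row_j (co j q - co j p).
  apply/rowP => j; rewrite !mxE -!eZ//; last by near: q.
  have -> : e j (Z q) - e j (Z p)
    = \sum_k B j k (Z q) * (co k (Z q) - co k (Z p)).
    by move: j; near: q.
  by apply: eq_bigr => k _; rewrite !mxE mulrC.
have /rowP/(_ l) : c = (\row_j (co j q - co j p)) *m invmx (N q).
  by rewrite -cN mulmxK.
rewrite !mxE => ->; apply: eq_bigr => j _; rewrite mxE mulrC.
Unshelve. all: by end_near. Qed.

End Inverse.

(** * Relative derivatives in one variable and mean value theorems *)

Section OneVariable.
Context {R : realType}.
Implicit Types (g dg : R -> R) (t s l : R).

Definition slope g t s : R := (g s - g t) / (s - t).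

Lemma slope_cvg_continuous (D : set R) g t l :
  slope g t s @[s --> within D t^'] --> l ->
  g s @[s --> within D (nbhs t)] --> g t.
Proof.
move=> gl.
have h : g t + slope g t s * (s - t) @[s --> within D t^'] -->
  g t + l * (t - t).
  apply: cvgD; first exact: cvg_cst.
  apply: cvgM => //; apply: cvgB; last exact: cvg_cst.
  by apply: cvg_within_filter; apply: cvg_within_filter; exact: cvg_id.
rewrite subrr mulr0 addr0 in h.
move=> A /[dup] /nbhs_singleton Agt /h hA.
have {}hA : \forall s \near t, s != t -> D s -> A (g t + slope g t s * (s - t)).
  exact: hA.
suff : \forall s \near t, D s -> A (g s) by [].
near=> s => Ds; have [->//|st] := eqVneq s t.
have -> : g s = g t + slope g t s * (s - t).
  by rewrite /slope divfK ?subr_eq0// addrC subrK.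
by move: st Ds; near: s.
Unshelve. all: by end_near. Qed.

Lemma slope_cvg_is_derive (D : set R) g t l :
  nbhs t D -> slope g t s @[s --> within D t^'] --> l -> is_derive t 1 g l.
Proof.
move=> Dt gl.
have h : h^-1 *: ((g \o shift t) (h *: 1) - g t) @[h --> 0^'] --> l.
  move=> A /gl hA.
  have {}hA : \forall s \near t, s != t -> D s -> A (slope g t s) by exact: hA.
  suff : \forall h \near 0, h != 0 ->
     A (h^-1 *: ((g \o shift t) (h *: 1) - g t)) by [].
  move: hA Dt; rewrite (near_shift 0 t).
  rewrite [nbhs t D](near_shift 0 t) subr0 => hA Dt.
  near=> h => h0.
  have Dh : D (h + t) by near: h.
  have hAh : h + t != t -> D (h + t) -> A (slope g t (h + t)) by near: h.
  have := hAh _ Dh; rewrite /slope addrK -subr_eq0 addrK => /(_ h0).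
  by rewrite /= [h *: 1]mulr1 mulrC.
split; first exact: cvgP h.
exact: cvg_lim h.
Unshelve. all: by end_near. Qed.

(** Relative derivatives are ordinary ones inside the interval, and at the end points the mean value
    theorem asks for continuity only. The bound on [c] uses norms so that [t] and [s] may come in
    either order. *)
Lemma MVT_within a b g dg t s :
  (forall r, a <= r <= b -> slope g r s @[s --> within `[a, b] r^'] --> dg r) ->
  a <= t <= b -> a <= s <= b ->
  exists c, [/\ a <= c <= b, `|c - t| <= `|s - t| & g s - g t = dg c * (s - t)].
Proof.
move=> gdg tab sab.
have main x y : a <= x <= b -> a <= y <= b -> x <= y ->
    exists2 c, c \in `[x, y] & g y - g x = dg c * (y - x).
  move=> /andP[ax xb] /andP[ay yb] xy.
  apply: MVT_segment => // [r|].
    rewrite in_itv/= => /andP[xr ry]; apply: (@slope_cvg_is_derive `[a, b]).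
      have rab : r \in `]a, b[ by rewrite in_itv/= (le_lt_trans ax xr)
        (lt_le_trans ry yb).
      have := near_in_itvoo rab; apply: filterS => z /=.
      by rewrite !in_itv/= => /andP[/ltW-> /ltW->].
    by apply: gdg; rewrite (le_trans ax (ltW xr)) (le_trans (ltW ry) yb).
  apply/subspace_continuousP => r /=; rewrite in_itv/= => /andP[xr ry].
  have /slope_cvg_continuous h : slope g r s @[s --> within `[a, b] r^'] -->
    dg r.
    by apply: gdg; rewrite (le_trans ax xr) (le_trans ry yb).
  apply: cvg_trans h; apply: cvg_fmap2 => A.
  rewrite /within/=; apply: filterS => z /= h; rewrite in_itv/= => /andP[xz zy].
  by apply: h; rewrite in_itv/= (le_trans ax xz) (le_trans zy yb).
have [ts|/ltW st] := leP t s.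
  have [c] := main _ _ tab sab ts; rewrite in_itv/= => /andP[tc cs] e.
  exists c; split => //; last by rewrite !ger0_norm ?subr_ge0// lerD2r.
  by case/andP: tab sab => [at_ _] /andP[_ sb];
    rewrite (le_trans at_ tc) (le_trans cs sb).
have [c] := main _ _ sab tab st; rewrite in_itv/= => /andP[sc ct] e.
exists c; split => //.
- by case/andP: sab tab => [as_ _] /andP[_ tb];
    rewrite (le_trans as_ sc) (le_trans ct tb).
- by rewrite ![`|_ - t|]distrC !ger0_norm ?subr_ge0// lerD2l lerN2.
- by rewrite -opprB e -mulrN opprB.
Qed.

Lemma MVT_between g dg (d : R) :
  (forall r : R, `|r| <= `|d| -> is_derive r 1 g (dg r)) ->
  exists2 r, `|r| <= `|d| & g d - g 0 = dg r * d.
Proof.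
move=> gdg.
have cont x y : (forall r, x <= r <= y -> `|r| <= `|d|) ->
    {within `[x, y], continuous g}.
  move=> xy; apply: continuous_in_subspaceT => r /set_mem/=.
  rewrite in_itv/= => /xy/gdg [dr _].
  by apply: differentiable_continuous; apply/derivable1_diffP.
have [d0|/ltW d0] := leP 0 d.
  have hd r : 0 <= r <= d -> `|r| <= `|d|.
    by move=> /andP[r0 rd]; rewrite !ger0_norm.
  have [||c] := @MVT_segment _ g dg 0 d d0.
  - by move=> x; rewrite in_itv/= => /andP[/ltW x0 /ltW xd]; apply/gdg/hd/andP.
  - exact: cont.
  rewrite in_itv/= subr0 => h e; exists c => //; exact: hd.
have hd r : d <= r <= 0 -> `|r| <= `|d|.
  by move=> /andP[r0 rd]; rewrite !ler0_norm// lerN2.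
have [||c] := @MVT_segment _ g dg d 0 d0.
- by move=> x; rewrite in_itv/= => /andP[/ltW x0 /ltW xd]; apply/gdg/hd/andP.
- exact: cont.
rewrite in_itv/= => h e; exists c; first exact: hd.
by rewrite -opprB e sub0r mulrN opprK.
Qed.

End OneVariable.

(** * The dot product and coordinates *)

Section DotProduct.
Context {R : realType} {n : nat}.
Implicit Types (x y z : 'rV[R]_n).

Lemma dotE x y : dot x y = \sum_i x 0 i * y 0 i.
Proof. by rewrite /dot mxE; apply: eq_bigr => i _; rewrite mxE. Qed.

Lemma dotC x y : dot x y = dot y x.
Proof. by rewrite !dotE; apply: eq_bigr => i _; rewrite mulrC. Qed.

Lemma dot_is_linear y : linear (fun x => dot x y : R^o).
Proof. by move=> a u v; rewrite /dot mulmxDl -scalemxAl !mxE. Qed.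

(** The codomain is [R^o] so that this is a linear map between normed modules and can serve as a
    differential. *)
Definition dotl y : 'rV[R]_n -> R^o := fun x => dot x y.

HB.instance Definition _ y :=
  GRing.isLinear.Build R 'rV[R]_n R^o *:%R (dotl y) (dot_is_linear y).

Lemma dotDl x y z : dot (x + y) z = dot x z + dot y z.
Proof. exact: (linearD (dotl z)). Qed.

Lemma dotBl x y z : dot (x - y) z = dot x z - dot y z.
Proof. exact: (linearB (dotl z)). Qed.

Lemma dotZl a x y : dot (a *: x) y = a * dot x y.
Proof. exact: (linearZ_LR (dotl y)). Qed.

Lemma dot0l x : dot 0 x = 0.
Proof. exact: (linear0 (dotl x)). Qed.

Lemma dotZr a x y : dot x (a *: y) = a * dot x y.
Proof. by rewrite dotC dotZl dotC. Qed.

Lemma dotDr x y z : dot x (y + z) = dot x y + dot x z.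
Proof. by rewrite ![dot x _]dotC dotDl. Qed.

Lemma dotBr x y z : dot x (y - z) = dot x y - dot x z.
Proof. by rewrite ![dot x _]dotC dotBl. Qed.

Lemma dot0r x : dot x 0 = 0.
Proof. by rewrite dotC dot0l. Qed.

Lemma dot_basis i y : dot (basis_vec i) y = y 0 i.
Proof.
rewrite dotE (bigD1 i)//= big1 ?addr0 => [|j ji]; rewrite mxE eqxx/=.
  by rewrite eqxx mul1r.
by rewrite (negbTE ji) mul0r.
Qed.

Lemma dot_self_gt0 x : x != 0 -> 0 < dot x x.
Proof.
move=> x0; rewrite dotE lt_neqAle sumr_ge0 ?andbT; last by move=> i _;
  rewrite -expr2 sqr_ge0.
apply: contra x0 => /eqP/esym/eqP; rewrite psumr_eq0; last by move=> i _;
  rewrite -expr2 sqr_ge0.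
move=> /allP h; apply/eqP/rowP => i; rewrite mxE; apply/eqP.
by have := h i (mem_index_enum _); rewrite mulf_eq0 orbb.
Qed.

Lemma derive_dot_grad (f : 'rV[R]_n -> R) x v :
  differentiable f x -> 'D_v f x = dot v (grad f x).
Proof.
move=> df; rewrite deriveE// {1}(row_sum_delta v) linear_sum dotE.
by apply: eq_bigr => i _; rewrite linearZ mxE /partial deriveE.
Qed.

Lemma dot_cvg {T} {F : set_system T} {FF : Filter F} (f g : T -> 'rV[R]_n)
    (a b : 'rV[R]_n) :
  (forall i, f t 0 i @[t --> F] --> a 0 i) ->
  (forall i, g t 0 i @[t --> F] --> b 0 i) ->
  dot (f t) (g t) @[t --> F] --> dot a b.
Proof.
move=> fa gb; under eq_fun do rewrite dotE; rewrite dotE.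
by apply: cvg_sumr => i; exact: cvgM.
Qed.

Lemma coord_cvg i x : y 0 i @[y --> x] --> x 0 i.
Proof. exact: coord_continuous. Qed.

Lemma dotl_continuous y : continuous (dotl y).
Proof.
move=> x; apply: (@dot_cvg _ (nbhs x) _ id (fun=> y) x y) => i.
  exact: coord_cvg.
exact: cvg_cst.
Qed.

Lemma normr_coord x i : `|x 0 i| <= `|x|.
Proof.
rewrite [leRHS]/Num.norm/= mx_normrE.
by apply: (le_bigmax _ (fun ij => `|x ij.1 ij.2|) (0, i)).
Qed.

Lemma normr_rowP x (e : R) : 0 <= e -> (forall i, `|x 0 i| <= e) -> `|x| <= e.
Proof.
move=> e0 xe; rewrite [leLHS]/Num.norm/= mx_normrE;
  apply: bigmax_le => // -[i j] _.
by rewrite ord1; exact: xe.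
Qed.

End DotProduct.

(** * C^1 functions on the slab *)

Section GradOn.
Context {R : realType} {n : nat}.
Local Notation P := (R * 'rV[R]_n)%type.

Definition grad_on (S : set P) (F : P -> R) (D : 'I_n.+1 -> P -> R) : Prop :=
  forall p, S p -> cdiff S p F (D ^~ p) /\
    forall j, D j q @[q --> within S (nbhs p)] --> D j p.

End GradOn.

Section Slab.
Context {R : realType} {n : nat} {T : R}.
Hypothesis T0 : 0 < T.
Local Notation P := (R * 'rV[R]_n)%type.
Local Notation S := (slab T : set P).
Local Notation nb p := (within S (nbhs p)).
Implicit Types (t s : R) (x y : 'rV[R]_n) (F : P -> R) (u : R -> 'rV[R]_n -> R).

Lemma near_neq0 x : x != 0 -> \forall y \near x, y != 0.
Proof. by move=> x0; exact: (@cvgr_neq0 _ _ _ (nbhs x) _ id x cvg_id x0). Qed.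

Lemma time_slice_cvg t x :
  x != 0 -> (s, x) @[s --> within `[0, T] t^'] --> nb (t, x).
Proof.
move=> x0 A hA.
have {}hA : \forall q \near (t, x), S q -> A q by exact: hA.
suff : \forall s \near t, s != t -> `[0, T]%classic s -> A (s, x) by [].
have : (s, x) @[s --> t] --> (t, x) by apply:
  (@cvg_pair _ _ _ (nbhs t) (nbhs t) (nbhs x) _ _ _ id (fun=> x));
    [exact: cvg_id|exact: cvg_cst].
move=> /(_ _ hA) h; have {}h : \forall s \near t, S (s, x) ->
  A (s, x) by exact: h.
near=> s => _; rewrite /= in_itv/= => sT.
have hs : S (s, x) -> A (s, x) by near: s.
by apply: hs; split.
Unshelve. all: by end_near.
Qed.

Lemma space_slice_cvg t x :
  0 <= t <= T -> x != 0 -> (t, y) @[y --> x] --> nb (t, x).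
Proof.
move=> tT x0 A hA.
have {}hA : \forall q \near (t, x), S q -> A q by exact: hA.
suff : \forall y \near x, A (t, y) by [].
have : (t, y) @[y --> x] --> (t, x) by apply:
  (@cvg_pair _ _ _ (nbhs x) (nbhs t) (nbhs x) _ _ _ (fun=> t) id);
    [exact: cvg_cst|exact: cvg_id].
move=> /(_ _ hA) h; near=> y.
have : S (t, y) -> A (t, y) by near: y.
by apply; split => //=; near: y; exact: near_neq0.
Unshelve. all: by end_near. Qed.

(** Properness makes limits along the interval unique, so that a computed limit identifies
    [derive_within]. A nearby point is found to the right of t when t < T, and to the left when t =
    T > 0. *)
Lemma time_dnbhs_proper t : 0 <= t <= T -> ProperFilter (within `[0, T] t^').
Proof.
move=> /andP[t0 tT]; split; last exact: within_filter.
move=> h.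
have {}h : \forall s \near t, s != t -> `[0, T]%classic s -> False by exact: h.
have [/= e e0 he] := (nbhs_ballP _ _).1 h.
have [tT'|Tt] := ltP t T.
  pose d := Num.min (e / 2) (T - t).
  have d0 : 0 < d by rewrite lt_min divr_gt0//= subr_gt0.
  apply: (he (t + d)).
  - rewrite /ball/= opprD addNKr normrN gtr0_norm//.
    by rewrite /d gt_min ltr_pdivrMr// ltr_pMr// ltr1n.
  - by rewrite -subr_eq0 addrAC subrr add0r gt_eqF.
  - rewrite /= in_itv/= addr_ge0 ?(ltW d0)//=.
    by rewrite addrC -lerBrDr ge_min lexx orbT.
pose d := Num.min (e / 2) t.
have t0' : 0 < t by exact: lt_le_trans Tt.
have d0 : 0 < d by rewrite lt_min divr_gt0//=.
apply: (he (t - d)).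
- rewrite /ball/= opprB addrC subrK gtr0_norm//.
  by rewrite /d gt_min ltr_pdivrMr// ltr_pMr// ltr1n.
- by rewrite -subr_eq0 addrAC subrr add0r oppr_eq0 gt_eqF.
- rewrite /= in_itv/= subr_ge0 ge_min lexx orbT/=.
  by rewrite (le_trans _ tT)// gerBl ltW.
Qed.

Lemma cdiff_slope u t x d : 0 <= t <= T -> x != 0 ->
  cdiff S (t, x) (fun p => u p.1 p.2) d ->
  slope (u ^~ x) t s @[s --> within `[0, T] t^'] --> d ord0.
Proof.
move=> tT x0 [B Bd BF].
have h := cvg_comp _ _ (time_slice_cvg (t := t) x0) (Bd ord0).
apply: cvg_trans h; apply: near_eq_cvg.
have hB := time_slice_cvg (t := t) x0 BF.
have nt : \forall s \near within `[0, T] t^', s != t.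
  suff : \forall s \near t, s != t -> `[0, T]%classic s -> s != t by [].
  by near=> s.
near=> s.
have E : u s x - u t x = \sum_j B j (s, x) * (co j (s, x) - co j (t, x)).
  by near: s.
rewrite /slope/= E big_ord_recl !co0 big1 ?addr0 => [|j _]; last first.
  by rewrite !coS subrr mulr0.
by rewrite /= mulfK// subr_eq0; near: s.
Unshelve. all: by end_near. Qed.

Lemma cdiff_differentiable u t x d : 0 <= t <= T -> x != 0 ->
  cdiff S (t, x) (fun p => u p.1 p.2) d ->
  differentiable (u t) x /\ grad (u t) x = \row_i d (lift ord0 i).
Proof.
move=> tT x0 [B Bd BF].
pose c : 'rV[R]_n := \row_i d (lift ord0 i).
pose f : 'rV[R]_n -> R^o := u t.
have e : f \o shift x = cst (f x) + dotl c +o_ (0 : 'rV[R]_n) id.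
  apply/eqaddoP => _/posnumP[eps].
  have Bx i : B (lift ord0 i) (t, y) @[y --> x] --> d (lift ord0 i).
    exact: cvg_comp (space_slice_cvg tT x0) (Bd _).
  have hB : \forall y \near x, u t y - u t x =
      \sum_j B j (t, y) * (co j (t, y) - co j (t, x)).
    exact: space_slice_cvg tT x0 _ BF.
  (* Each of the n coordinates may contribute eps / n.+1; the successor keeps this bound positive
     when n = 0. *)
  have h1 : \forall y \near x, forall i,
      `|B (lift ord0 i) (t, y) - d (lift ord0 i)| <= eps%:num / n.+1%:R.
    apply: (@filter_forall _ _ _ (nbhs x)) => i.
    have : \forall y \near x,
        `|d (lift ord0 i) - B (lift ord0 i) (t, y)| <= eps%:num / n.+1%:R.
      by move/cvgrPdist_le : (Bx i); apply; rewrite divr_gt0.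
    move=> hy; near=> y; rewrite distrC; near: y; exact: hy.
  suff h0 : \forall h \near (0 : 'rV[R]_n),
    `|(f \o shift x - (cst (f x) + dotl c)) h| <= eps%:num * `|h| by exact: h0.
  move: h1 hB; rewrite !(near_shift 0 x) subr0 => h1 hB.
  near=> h.
  have h1h : forall i, `|B (lift ord0 i) (t, h + x) - d (lift ord0 i)|
    <= eps%:num / n.+1%:R by near: h; exact: h1.
  have E : u t (h + x) - u t x = \sum_j B j (t, h + x) * (co j (t, h + x) -
    co j (t, x)).
    by near: h; exact: hB.
  suff -> : (f \o shift x - (cst (f x) + dotl c)) h
      = \sum_i (B (lift ord0 i) (t, h + x) - d (lift ord0 i)) * h 0 i.
    apply: le_trans (ler_norm_sum _ _ _) _.
  apply: (@le_trans _ _ (\sum_(i < n) eps%:num / n.+1%:R * `|h|)).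
    by apply: ler_sum => i _; rewrite normrM ler_pM//; exact: normr_coord.
  rewrite -mulr_suml ler_wpM2r// sumr_const card_ord -[leLHS]mulr_natr.
  by rewrite mulrAC ler_pdivrMr// ler_wpM2l// ler_nat.
  have -> : (f \o shift x - (cst (f x) + dotl c)) h
      = (u t (h + x) - u t x) - dot h c by rewrite /= -[LHS]/(_ -
        (_ + _)) opprD addrA.
  rewrite E big_ord_recl !co0 subrr mulr0 add0r dotE -sumrB.
  by apply: eq_bigr => i _; rewrite !coS !mxE addrK; ring.
have dlc := @dotl_continuous _ _ c.
have D : differentiable f x.
  by apply/diff_locallyP; rewrite (diff_unique dlc e).
have Dx := diff_unique dlc e.
split => //; apply/rowP => i; rewrite !mxE /partial.
rewrite deriveE//.
rewrite [LHS](_ : _ = dotl c (basis_vec i)); last by rewrite -Dx.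
by rewrite /dotl dot_basis mxE.
Unshelve. all: by end_near. Qed.

Lemma C0_slabP u : C0_slab T u <->
  forall p, S p -> u q.1 q.2 @[q --> nb p] --> u p.1 p.2.
Proof. exact: subspace_continuousP. Qed.

Lemma C0_slab_ext u v : (forall t x, S (t, x) -> u t x = v t x) ->
  C0_slab T u -> C0_slab T v.
Proof.
move=> uv /C0_slabP uc; apply/C0_slabP => -[t x] Sp.
rewrite -uv//; apply: cvg_trans (uc _ Sp); apply: near_eq_cvg.
have h : \forall q \near nb (t, x), S q by exact: withinT.
by near=> q; rewrite uv// -surjective_pairing; near: q.
Unshelve. all: by end_near. Qed.

Definition slab_partial u (j : 'I_n.+1) (p : P) : R :=
  if unlift ord0 j is Some i then partial i (u p.1) p.2 else dt T u p.1 p.2.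

Lemma slab_partial0 u p : slab_partial u ord0 p = dt T u p.1 p.2.
Proof. by rewrite /slab_partial unlift_none. Qed.

Lemma slab_partialS u i p :
  slab_partial u (lift ord0 i) p = partial i (u p.1) p.2.
Proof. by rewrite /slab_partial liftK. Qed.

(** The coefficients are limits of slopes along coordinate slices, so they are forced. The
    uniqueness of derivatives used below rests on this. *)
Lemma cdiff_slab_partial u p d : S p -> cdiff S p (fun q => u q.1 q.2) d ->
  forall j, d j = slab_partial u j p.
Proof.
case: p => t x [/= tT x0] cu j.
case: (unliftP ord0 j) => [i ->|->].
  rewrite slab_partialS/=; have [_ /rowP/(_ i)] :=
    cdiff_differentiable tT x0 cu.
  by rewrite !mxE.
rewrite slab_partial0/=; apply/esym.
have h := cdiff_slope tT x0 cu; have PF := time_dnbhs_proper tT.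
exact: cvg_lim h.
Qed.

Lemma grad_on_slab_partial u D : grad_on S (fun p => u p.1 p.2) D ->
  forall p j, S p -> D j p = slab_partial u j p.
Proof. by move=> uD p j Sp; exact: (cdiff_slab_partial Sp (uD _ Sp).1). Qed.

Lemma grad_on_C1_slab u D : grad_on S (fun p => u p.1 p.2) D -> C1_slab T u.
Proof.
move=> uD; have DE := grad_on_slab_partial uD; split.
- apply/C0_slabP => p Sp; have [h _] := uD _ Sp.
  exact: cdiff_cvg h.
- move=> t x Sp; have [h _] := uD _ Sp; case: Sp => /= tT x0.
  exact: cvgP (cdiff_slope tT x0 h).
- apply: (@C0_slab_ext (fun t x => D ord0 (t, x))).
    by move=> t x Sp; rewrite DE// slab_partial0.
  apply/C0_slabP => p Sp; have [_ /(_ ord0)] := uD _ Sp.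
  by rewrite -surjective_pairing; under [in X in _ -> X]eq_fun do
    rewrite -surjective_pairing.
- move=> t x i Sp; have [h _] := uD _ Sp; case: Sp => /= tT x0.
  have [+ _] := cdiff_differentiable tT x0 h.
  exact: diff_derivable.
- move=> i; apply: (@C0_slab_ext (fun t x => D (lift ord0 i) (t, x))).
    by move=> t x Sp; rewrite DE// slab_partialS.
  apply/C0_slabP => p Sp; have [_ /(_ (lift ord0 i))] := uD _ Sp.
  by rewrite -surjective_pairing; under [in X in _ -> X]eq_fun do
    rewrite -surjective_pairing.
Qed.

Lemma is_derive_line (f : 'rV[R]_n -> R) x v (r l : R) :
  is_derive (x + r *: v) v f l -> is_derive r 1 (fun r => f (x + r *: v)) l.
Proof.
move=> [df Df]; set g := fun r => f (x + r *: v); set z := x + r *: v in df Df.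
have gz h : h^-1 *: ((g \o shift r) (h *: 1) - g r) =
    h^-1 *: ((f \o shift z) (h *: v) - f z).
  rewrite /g /z /= [h *: 1]mulr1; congr (_ *: (f _ - _)).
  by rewrite scalerDl addrCA.
split; first by rewrite /derivable; under eq_fun do rewrite gz; exact: df.
by rewrite /derive; under eq_fun do rewrite gz.
Qed.

(** Coordinates are switched from those of [x] to those of [y] one at a time, with the mean value
    theorem at each switch. Since the norm is the maximum norm, no intermediate point is farther
    from [x] than [y] is. *)
Lemma partial_telescope (f : 'rV[R]_n -> R) x y :
  (forall z i, `|z - x| <= `|y - x| -> derivable f z (basis_vec i)) ->
  exists c : 'I_n -> 'rV[R]_n, (forall i, `|c i - x| <= `|y - x|) /\
    f y - f x = \sum_i partial i f (c i) * (y 0 i - x 0 i).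
Proof.
move=> df.
pose m k : 'rV[R]_n := \row_i (if (i < k)%N then y 0 i else x 0 i).
have step (i : 'I_n) : exists c : 'rV[R]_n, `|c - x| <= `|y - x| /\
    f (m i.+1) - f (m i) = partial i f c * (y 0 i - x 0 i).
  pose z r := m i + r *: basis_vec i.
  have mr r : `|r| <= `|y 0 i - x 0 i| -> `|z r - x| <= `|y - x|.
    move=> rd; apply: normr_rowP => // k; rewrite !mxE eqxx/=.
    have [->|ki] := eqVneq k i.
      rewrite ltnn mulr1 addrAC subrr add0r (le_trans rd)//.
      by have := normr_coord (y - x) i; rewrite !mxE.
    rewrite mulr0 addr0; case: ifP => _; last by rewrite subrr normr0.
    by have := normr_coord (y - x) k; rewrite !mxE.
  have [r rd|r rd e] := @MVT_between _ (fun r => f (z r))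
      (fun r => partial i f (z r)) (y 0 i - x 0 i).
    by apply: is_derive_line; apply/derivableP/df/mr.
  exists (z r); split; first exact: mr.
  rewrite -e /z scale0r addr0; congr (f _ - _).
  apply/rowP => k; rewrite !mxE eqxx/= ltnS leq_eqVlt.
  have [->|ki] := eqVneq k i; first by rewrite eqxx ltnn mulr1 addrC subrK.
  by rewrite val_eqE (negbTE ki) mulr0 addr0.
have /choice[c hc] := step.
exists c; split; first by move=> i; have [] := hc i.
have -> : y = m n by apply/rowP => i; rewrite mxE ltn_ord.
have -> : x = m 0%N by apply/rowP => i; rewrite mxE.
rewrite -(telescope_sumr (fun k => f (m k)))// big_mkord.
apply: eq_bigr => i _; have [_ ->] := hc i.
by rewrite /m !mxE ltn_ord.
Qed.

(** The increment is split into one in time at the fixed point x, controlled by the one-sided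
    derivative at (t, x) alone, and one in space at the new time, telescoped over coordinates and
    controlled by continuity of the partial derivatives. *)
Lemma C1_slab_grad_on u : C1_slab T u ->
  grad_on S (fun p => u p.1 p.2) (slab_partial u).
Proof.
move=> [uc ud dtc up pc] p Sp; split; last first.
  move=> j; case: (unliftP ord0 j) => [i ->|->].
    rewrite slab_partialS; under eq_fun do rewrite slab_partialS.
    by have /C0_slabP := pc i; apply.
  rewrite slab_partial0; under eq_fun do rewrite slab_partial0.
  by move/C0_slabP : dtc; apply.
have [t [x pE]] : exists t x, p = (t, x) by exists p.1, p.2; case: (p).
rewrite pE in Sp *; clear p pE; have [/= tT x0] := Sp.
(* The radius [|x|] keeps the intermediate points off the origin, where nothing is known about
   [u]. *)
have hc (q : P) : exists c : 'I_n -> 'rV[R]_n,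
    S q -> `|q.2 - x| < `|x| ->
    (forall i, `|c i - x| <= `|q.2 - x|) /\
    u q.1 q.2 - u q.1 x = \sum_i partial i (u q.1) (c i) * (q.2 0 i - x 0 i).
  have [[Sq qx]|h] := pselect (S q /\ `|q.2 - x| < `|x|); last first.
    by exists (fun=> 0) => Sq qx; case: h.
  have [|c hc] := @partial_telescope (u q.1) x q.2; last by exists c.
  move=> z i zx; apply: up; split => /=; first by case: Sq.
  apply: contraTneq (le_lt_trans zx qx) => ->.
  by rewrite sub0r normrN ltxx.
have {hc}/choice[c hc] := hc.
(* At q.1 = t the time slope would be 0 / 0, so its limit is inserted there. *)
pose B j (q : P) := if unlift ord0 j is Some i then partial i (u q.1) (c q i)
  else if q.1 == t then dt T u t x else slope (u ^~ x) t q.1.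
have B0 q : B ord0 q = if q.1 == t then dt T u t x else slope (u ^~ x) t q.1.
  by rewrite /B unlift_none.
have BS i q : B (lift ord0 i) q = partial i (u q.1) (c q i).
  by rewrite /B liftK.
have near_x : \forall q \near nb (t, x), `|q.2 - x| < `|x|.
  apply: (@cvg_within _ (nbhs (t, x))).
  have : snd q @[q --> (t, x)] --> x by exact: cvg_snd.
  by move/cvgrPdist_lt => /(_ `|x|); rewrite normr_gt0 => /(_ x0);
    under eq_near do rewrite distrC.
have near_S : \forall q \near nb (t, x), S q by exact: withinT.
exists B => [j|]; last first.
  near=> q.
  have Sq : S q by near: q.
  have qx : `|q.2 - x| < `|x| by near: q.
  have [_ e] := hc q Sq qx.
  rewrite big_ord_recl !co0/= B0.
  have -> : u q.1 q.2 - u t x = (u q.1 x - u t x) + (u q.1 q.2 - u q.1 x)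
    by ring.
  congr (_ + _); last by rewrite e; apply: eq_bigr => i _; rewrite BS !coS.
  have [->|qt] := eqVneq q.1 t; first by rewrite !subrr mulr0.
  by rewrite /slope divfK ?subr_eq0.
case: (unliftP ord0 j) => [i ->|->].
  rewrite slab_partialS; under eq_fun do rewrite BS.
  move=> A hA.
  have /C0_slabP/(_ _ Sp _ hA) h := pc i.
  have {}h : \forall q \near (t, x), S q ->
    A (partial i (u q.1) q.2) by exact: h.
  have [/= e e0 he] := (nbhs_ballP _ _).1 h.
  have hb : \forall q \near nb (t, x), ball (t, x) e q.
    by apply: (@cvg_within _ (nbhs (t, x))); exact: nbhsx_ballx.
  suff : \forall q \near nb (t, x), A (partial i (u q.1) (c q i)) by [].
  near=> q.
  have Sq : S q by near: q.
  have qx : `|q.2 - x| < `|x| by near: q.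
  have [/(_ i) ci _] := hc q Sq qx.
  have [bt bx] : ball (t, x) e q by near: q.
  apply: (he (q.1, c q i)).
    split => //=; move: bx; rewrite -!ball_normE/= => bx.
    by rewrite distrC (le_lt_trans ci)// distrC.
  split => /=; first by case: Sq.
  apply: contraTneq (le_lt_trans ci qx) => ->.
  by rewrite sub0r normrN ltxx.
rewrite slab_partial0; under eq_fun do rewrite B0.
move=> A /[dup] /nbhs_singleton At hA.
have /(_ _ hA) h : slope (u ^~ x) t s @[s --> within `[0, T] t^'] -->
  dt T u t x.
  exact: (ud _ _ Sp).
have {}h : \forall s \near t, s != t -> `[0, T]%classic s ->
  A (slope (u ^~ x) t s).
  exact: h.
have hq : \forall q \near nb (t, x), q.1 != t -> `[0, T]%classic q.1 ->
  A (slope (u ^~ x) t q.1).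
  apply: (@cvg_within _ (nbhs (t, x))).
  have hf : fst q @[q --> (t, x)] --> t by exact: cvg_fst.
  exact: hf _ h.
suff : \forall q \near nb (t, x), A (if q.1 == t then dt T u t x else slope
  (u ^~ x) t q.1) by [].
near=> q.
have [//|qt] := eqVneq q.1 t.
have [qT _] : S q by near: q.
by move: (qt) (qT : `[0, T]%classic q.1); near: q.
Unshelve. all: by end_near. Qed.

End Slab.

(** * Equality of mixed time and space derivatives *)

Section MixedPartials.
Context {R : realType} {n : nat} {T : R}.
Hypothesis T0 : 0 < T.
Local Notation P := (R * 'rV[R]_n)%type.
Local Notation S := (slab T : set P).
Local Notation nb p := (within S (nbhs p)).
Implicit Types (t s : R) (x y : 'rV[R]_n) (F : P -> R) (u : R -> 'rV[R]_n -> R).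

Lemma cdiff_ball p F d (e : R) : cdiff S p F d -> 0 < e ->
  exists2 r : R, 0 < r & forall q, S q -> `|q.1 - p.1| < r ->
    `|q.2 - p.2| < r ->
    exists2 b : 'I_n.+1 -> R, (forall j, `|b j - d j| <= e) &
      F q - F p = \sum_j b j * (co j q - co j p).
Proof.
move=> [B Bd BF] e0.
have h1 : \forall q \near nb p, forall j, `|B j q - d j| <= e.
  apply: filter_forall => j; move/cvgrPdist_le : (Bd j) => /(_ e e0).
  by move=> hj; near=> q; rewrite distrC; near: q.
have h : \forall q \near nb p, (forall j, `|B j q - d j| <= e) /\
    F q - F p = \sum_j B j q * (co j q - co j p).
  by near=> q; split; near: q.
have {}h : \forall q \near p, S q -> (forall j, `|B j q - d j| <= e) /\
    F q - F p = \sum_j B j q * (co j q - co j p) by exact: h.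
have [/= r r0 hr] := (nbhs_ballP _ _).1 h.
exists r => // q Sq q1 q2.
have [] := hr q _ Sq; first by split; rewrite -ball_normE/= distrC.
by move=> hB ->; exists (B ^~ q).
Unshelve. all: by end_near. Qed.

(* Both derivatives are limits of the same second difference quotient, with time
   and space increments both equal to h = s - t. *)
Lemma mixed_partials u (Dt Dx : P -> R) (i : 'I_n) p d e : S p ->
  (forall t x, S (t, x) ->
    slope (u ^~ x) t s @[s --> within `[0, T] t^'] --> Dt (t, x)) ->
  (forall t x, S (t, x) -> is_derive x (basis_vec i) (u t) (Dx (t, x))) ->
  cdiff S p Dt d -> cdiff S p Dx e -> d (lift ord0 i) = e ord0.
Proof.
case: p => t x Sp ut ux cd ce; have [/= tT x0] := Sp.
apply/eqP; rewrite -subr_eq0 -normr_le0; apply/ler_addgt0Pr => eps eps0.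
rewrite add0r.
(* Six errors of eps / 6 add up to eps: two each in the coefficients [b1] and [b3], one each in [b2]
   and [b4]. *)
have e0 : 0 < eps / 6 by rewrite divr_gt0.
have [r1 r10 h1] := cdiff_ball cd e0.
have [r2 r20 h2] := cdiff_ball ce e0.
have PF := time_dnbhs_proper T0 tT.
have nx : 0 < `|x| by rewrite normr_gt0.
have [s [/= st sT sr1 sr2 sx]] : exists s, [/\ s != t, 0 <= s <= T,
    `|s - t| < r1, `|s - t| < r2 & `|s - t| < `|x|].
  apply: (@filter_ex _ (within `[0, T] t^')).
  suff : \forall s \near t, s != t -> `[0, T]%classic s ->
    [/\ s != t, 0 <= s <= T,
    `|s - t| < r1, `|s - t| < r2 & `|s - t| < `|x|] by [].
  have hb (r : R) : 0 < r -> \forall s \near t, `|s - t| < r.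
    by move=> r0; near=> s; rewrite distrC; near: s; exact: (nbhsx_ballx t r).
  near=> s => st; rewrite /= in_itv/= => sT.
  by split => //; near: s; exact: hb.
set h := s - t in sr1 sr2 sx.
have h0 : h != 0 by rewrite subr_eq0.
set v : 'rV[R]_n := basis_vec i.
have nv (r : R) : `|r *: v| <= `|r|.
  apply: normr_rowP => // k; rewrite !mxE eqxx/=.
  by case: (k == i); rewrite ?mulr1// mulr0 normr0.
have xr (r : R) : `|r| <= `|h| -> x + r *: v != 0.
  move=> rh; apply/eqP => /eqP; rewrite addr_eq0 => /eqP xE.
  have : `|x| <= `|h| by rewrite xE normrN (le_trans (nv _)).
  by rewrite leNgt sx.
pose Delta := u s (x + h *: v) - u s x - (u t (x + h *: v) - u t x).
(* The mean value theorem in time leaves a difference of [Dt] at two points with equal time. Its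
   time terms cancel up to the error [b1], and the slope [b2] in space remains. *)
have [b1 [b2 [c1 [E1 b1d b2d c1h]]]] : exists b1 b2 c : R,
   [/\ Delta = h * (b1 * c + b2 * h), `|b1| <= eps / 3,
       `|b2 - d (lift ord0 i)| <= eps / 6 & `|c| <= `|h|].
  have [|c [cT ch E]] := @MVT_within _ 0 T (fun r => u r (x + h *: v) - u r x)
    (fun r => Dt (r, x + h *: v) - Dt (r, x)) t s _ tT sT.
    move=> r rT.
    have -> : slope (fun r => u r (x + h *: v) - u r x) r =
       (fun s => slope (u ^~ (x + h *: v)) r s - slope (u ^~ x) r s).
      by apply/funext => z; rewrite /slope -mulrBl; congr (_ * _); ring.
    by apply: cvgB; apply: ut; split => //=; exact: xr.
  have [||//|b bd bE] := h1 (c, x + h *: v).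
  - by split => //=; exact: xr.
  - exact: le_lt_trans ch _.
  - by rewrite /= addrAC subrr add0r (le_lt_trans (nv _)).
  have [||//|b' b'd b'E] := h1 (c, x).
  - by split.
  - exact: le_lt_trans ch _.
  - by rewrite /= subrr normr0.
  exists (b ord0 - b' ord0), (b (lift ord0 i)), (c - t); split => //.
  - rewrite /Delta E mulrC.
    have -> : Dt (c, x + h *: v) - Dt (c, x) =
      (Dt (c, x + h *: v) - Dt (t, x)) -
       (Dt (c, x) - Dt (t, x)) by ring.
    rewrite bE b'E !big_ord_recl !co0/= [X in _ - (_ + X)]big1 ?addr0;
      last first.
      by move=> k _; rewrite !coS subrr mulr0.
    rewrite (bigD1 i)//= big1 ?addr0; last first.
      by move=> k ki; rewrite !coS !mxE eqxx (negbTE ki) mulr0 addr0 subrr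
        mulr0.
    rewrite !coS !mxE !eqxx mulr1.
    rewrite /h; ring.
  - have -> : b ord0 - b' ord0 = (b ord0 - d ord0) - (b' ord0 - d ord0) by ring.
    rewrite (le_trans (ler_normB _ _))// (le_trans (lerD (bd _) (b'd _)))//.
    lra.
(* The same in the other order: the mean value theorem in space leaves a difference of [Dx] at two
   points with equal position. *)
have [b3 [b4 [c2 [E2 b3d b4d c2h]]]] : exists b1 b2 c : R,
   [/\ Delta = h * (b1 * c + b2 * h), `|b1| <= eps / 3,
       `|b2 - e ord0| <= eps / 6 & `|c| <= `|h|].
  have [|c ch E] := @MVT_between _ (fun r => u s (x + r *: v) -
    u t (x + r *: v))
    (fun r => Dx (s, x + r *: v) - Dx (t, x + r *: v)) h.
    move=> r rh; apply: is_deriveB.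
      by apply: is_derive_line; apply: ux; split => //=; exact: xr.
    by apply: is_derive_line; apply: ux; split => //=; exact: xr.
  have [||//|b bd bE] := h2 (s, x + c *: v).
  - by split => //=; exact: xr.
  - by [].
  - by rewrite /= addrAC subrr add0r (le_lt_trans (nv _))// (le_lt_trans ch).
  have [||//|b' b'd b'E] := h2 (t, x + c *: v).
  - by split => //=; exact: xr.
  - by rewrite /= subrr normr0.
  - by rewrite /= addrAC subrr add0r (le_lt_trans (nv _))// (le_lt_trans ch).
  exists (b (lift ord0 i) - b' (lift ord0 i)), (b ord0), c; split => //.
  - have -> : Delta = (u s (x + h *: v) - u t (x + h *: v)) -
       (u s (x + 0 *: v) - u t (x + 0 *: v)).
      by rewrite /Delta scale0r addr0; ring.
    rewrite E mulrC.
    have -> : Dx (s, x + c *: v) - Dx (t, x + c *: v) =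
       (Dx (s, x + c *: v) - Dx (t, x)) - (Dx (t, x + c *: v) - Dx (t, x))
         by ring.
    rewrite bE b'E !big_ord_recl !co0/= subrr mulr0 add0r.
    rewrite (bigD1 i)//= big1 ?addr0; last first.
      by move=> k ki; rewrite !coS !mxE eqxx (negbTE ki) mulr0 addr0 subrr
        mulr0.
    rewrite (bigD1 i)//= big1 ?addr0; last first.
      by move=> k ki; rewrite !coS !mxE eqxx (negbTE ki) mulr0 addr0 subrr
        mulr0.
    rewrite !coS !mxE !eqxx mulr1.
    rewrite /h; ring.
  - have -> : b (lift ord0 i) - b' (lift ord0 i) =
      (b (lift ord0 i) - e (lift ord0 i)) -
        (b' (lift ord0 i) - e (lift ord0 i)) by ring.
    rewrite (le_trans (ler_normB _ _))// (le_trans (lerD (bd _) (b'd _)))//.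
    lra.
have hh : (b2 - b4) * h = b3 * c2 - b1 * c1.
  by apply: (mulfI h0); have := E1; rewrite E2 => ?; lra.
have : `|b2 - b4| * `|h| <= (eps / 3 + eps / 3) * `|h|.
  rewrite -normrM hh (le_trans (ler_normB _ _))// !normrM mulrDl.
  by apply: lerD; apply: ler_pM.
rewrite ler_pM2r ?normr_gt0// => b24.
have -> : d (lift ord0 i) - e ord0 =
  - (b2 - d (lift ord0 i)) + (b2 - b4) + (b4 - e ord0) by ring.
rewrite (le_trans (ler_normD _ _))// (le_trans
  (lerD (ler_normD _ _) (lexx _)))//.
by rewrite normrN; lra.
Unshelve. all: by end_near. Qed.

End MixedPartials.

(** * Compact spheres and balls *)

Section Compactness.
Context {R : realType} {n : nat}.
Implicit Types (x y z : 'rV[R]_n).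

Lemma compact_sphere y (r : R) : compact [set x | `|x - y| = r].
Proof.
apply: bounded_closed_compact.
  exists (`|y| + `|r|); split; first exact: num_real.
  move=> M hM x /= xr; rewrite (le_trans _ (ltW hM))//.
  by rewrite -[x](subrK y) (le_trans (ler_normD _ _))// xr addrC lerD2l
    ler_norm.
apply: (@closed_comp _ _ (fun x => `|x - y|) [set r]); last exact: closed_eq.
move=> x _; apply: (@cvg_norm _ _ _ (nbhs x)).
by apply: (@cvgB _ _ _ (nbhs x) _ id (fun=> y)); [exact: cvg_id|exact: cvg_cst].
Qed.

Lemma compact_cball y (r : R) : compact [set x | `|x - y| <= r].
Proof.
apply: bounded_closed_compact.
  exists (`|y| + `|r|); split; first exact: num_real.
  move=> M hM x /= xr; rewrite (le_trans _ (ltW hM))//.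
  rewrite -[x](subrK y) (le_trans (ler_normD _ _))// addrC lerD2l.
  by rewrite (le_trans xr)// ler_norm.
apply: (@closed_comp _ _ (fun x => `|x - y|) [set z | z <= r]);
  last exact: closed_le.
move=> x _; apply: (@cvg_norm _ _ _ (nbhs x)).
by apply: (@cvgB _ _ _ (nbhs x) _ id (fun=> y)); [exact: cvg_id|exact: cvg_cst].
Qed.

(** The tube lemma for filters; it makes estimates uniform over spheres and balls. *)
Lemma near_forall_compact {I : Type} (F : set_system I) {FF : Filter F}
    (K : set 'rV[R]_n) (Q : I -> 'rV[R]_n -> Prop) : compact K ->
  (forall x, K x -> \forall x' \near x & i \near F, Q i x') ->
  \forall i \near F, forall x, K x -> Q i x.
Proof. by move=> /compact_near_coveringP cK; exact: cK. Qed.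

End Compactness.

(** * Touching points of one convex function *)

Section Gauge.
Context {R : realType} {n : nat}.
Local Notation V := 'rV[R]_n.
Implicit Types (f g : V -> R) (x y z : V) (a b c s t : R).

(** Not a Minkowski gauge, as no homogeneity is asked. These are the members of S_1 that are
    nonlinear at infinity, written with real values; see [gauge_class]. *)
Record gauge f : Prop := Gauge {
  gauge_convex : forall x y s, 0 <= s <= 1 ->
    f ((1 - s) *: x + s *: y) <= (1 - s) * f x + s * f y;
  gauge_ge0 : forall x, 0 <= f x;
  gauge0 : f 0 = 0;
  gauge_strict : forall x y, x != y -> ~ (forall s, 0 <= s <= 1 ->
    f ((1 - s) *: x + s *: y) = (1 - s) * f x + s * f y);
  gauge_C1 : C1_off0 f;
  gauge_nonlinear : forall x a b, x != 0 -> 0 <= a -> 0 < b ->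
    ~ (forall t, 0 <= t -> a * t - b <= f (t *: x) /\ f (t *: x) <= a * t) }.

Variable f : V -> R.
Hypothesis fG : gauge f.

Lemma gauge_scale x s : 0 <= s <= 1 -> f (s *: x) <= s * f x.
Proof.
by move=> /(gauge_convex fG 0 x); rewrite scaler0 add0r gauge0// mulr0 add0r.
Qed.

(** If f x = 0, convexity makes f vanish from 0 to x, and this segment lies on the graph. *)
Lemma gauge_gt0 x : x != 0 -> 0 < f x.
Proof.
move=> x0; rewrite lt_neqAle gauge_ge0// andbT; apply/negP => /eqP fx.
apply: (gauge_strict fG (x := 0) (y := x)); first by rewrite eq_sym.
move=> s sI; rewrite scaler0 add0r gauge0// -fx !mulr0 addr0.
by apply/eqP; rewrite eq_le gauge_ge0// andbT (le_trans (gauge_scale x sI))//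
  -fx mulr0.
Qed.

Lemma gauge_continuous x : x != 0 -> {for x, continuous f}.
Proof. by move=> /(gauge_C1 fG)[/differentiable_continuous]. Qed.

Lemma derive_at_right g x v : derivable g x v ->
  h^-1 *: ((g \o shift x) (h *: v) - g x) @[h --> 0^'+] --> 'D_v g x.
Proof.
move=> dg; apply: cvg_trans dg => /=; apply: cvg_fmap2 => A.
rewrite /at_right /dnbhs /within/=; apply: filterS => r + r0; apply.
by rewrite gt_eqF.
Qed.

Lemma gauge_gradient_le x z : x != 0 -> f x + dot (z - x) (grad f x) <= f z.
Proof.
move=> x0; have [df _] := gauge_C1 fG x0.
rewrite -derive_dot_grad// -lerBrDl.
have dv : derivable f x (z - x) by exact: diff_derivable.
have h := derive_at_right dv.
rewrite -(cvg_lim _ h)//; apply: limr_le; first exact: cvgP h.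
near=> r.
have r0 : 0 < r by near: r; exact: nbhs_right_gt.
have r1 : r < 1 by near: r; exact: nbhs_right_lt.
rewrite -[_ *: _]/(_ * _) mulrC ler_pdivrMr//= .
have := gauge_convex fG x z (s := r); rewrite (ltW r0) (ltW r1) => /(_ isT).
have -> : r *: (z - x) + x = (1 - r) *: x + r *: z.
  by apply/rowP => i; rewrite !mxE; ring.
by move=> h1; lra.
Unshelve. all: by end_near. Qed.

(* f* (grad f x), with f* the Legendre transform of f. *)
Definition legendre x : R := dot x (grad f x) - f x.

(** The tangent inequality at x, read at 0, gives a nonnegative value. If the value were 0, tangent
    and chord would agree, and f would be linear from 0 to x. *)
Lemma legendre_gt0 x : x != 0 -> 0 < legendre x.
Proof.
move=> x0; have h z := gauge_gradient_le z x0.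
rewrite lt_neqAle; apply/andP; split; last first.
  by have := h 0; rewrite gauge0// sub0r -scaleN1r dotZl /legendre; lra.
apply/negP => /eqP k0.
apply: (gauge_strict fG (x := 0) (y := x)); first by rewrite eq_sym.
move=> s sI; rewrite scaler0 add0r gauge0// mulr0 add0r.
apply/eqP; rewrite eq_le gauge_scale//=.
have := h (s *: x); rewrite dotBl dotZl; apply: le_trans.
have -> : dot x (grad f x) = f x by move: k0; rewrite /legendre; lra.
lra.
Qed.

(* The polar of f is 1 / legendre x at dual_point x: the affine function
   supporting c * f at x equals -1 at 0 exactly for c = 1 / legendre x. *)
Definition dual_point x : V := (legendre x)^-1 *: grad f x.

(** For a gauge, c is then the maximum of (<z, y> - 1) / f z over z != 0, and it is attained at x.
    Clearing the denominator admits z = 0. *)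
Definition touches y c x : Prop :=
  [/\ 0 < c, forall z, dot z y <= 1 + c * f z & dot x y = 1 + c * f x].

Lemma touches_neq0 y c x : touches y c x -> x != 0.
Proof. by move=> [_ _]; apply: contra_eq_neq => ->;
  rewrite dot0l gauge0// mulr0 addr0 eq_sym oner_neq0. Qed.

Lemma dual_point_touches x : x != 0 -> touches (dual_point x) (legendre x)^-1 x.
Proof.
move=> x0; have k0 := legendre_gt0 x0; split; first by rewrite invr_gt0.
  move=> z; rewrite dotZr -(ler_pM2l k0) mulrA divff ?gt_eqF// mul1r.
  rewrite mulrDr mulrA divff ?gt_eqF// mul1r mulr1.
  by have := gauge_gradient_le z x0; rewrite dotBl /legendre; lra.
rewrite dotZr; have -> : dot x (grad f x) = legendre x + f x by
  rewrite /legendre subrK.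
by rewrite mulrDr mulVf ?gt_eqF.
Qed.

(** Each inequality, tested at the other touching point, gives c = c'. The bound is then an equality
    at both points, hence along the segment between them by convexity, which strictness forbids
    unless they coincide. *)
Lemma touches_unique y c c' x x' :
  touches y c x -> touches y c' x' -> c = c' /\ x = x'.
Proof.
move=> tx tx'; have fx := gauge_gt0 (touches_neq0 tx).
have fx' := gauge_gt0 (touches_neq0 tx').
case: tx tx' => c0 h e [c'0 h' e'].
have cc : c = c'.
  apply/eqP; rewrite eq_le -(ler_pM2r fx) -[in X in _ && X](ler_pM2r fx').
  by apply/andP; split; [have := h' x; rewrite e|have := h x'; rewrite e'];
    rewrite lerD2l.
split => //; apply: contrapT => /eqP xx'; apply: (gauge_strict fG xx') => s sI.
 apply/eqP; rewrite eq_le gauge_convex//=.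
rewrite -(ler_pM2l c0).
have := h ((1 - s) *: x + s *: x'); rewrite dotDl !dotZl e e' -cc; lra.
Qed.

(** First-order condition: 1 + c f z - <z, y> is minimal at z = x, with value 0. Stationarity gives
    y = c grad f x, and the value 0 then fixes c. *)
Lemma touches_dual_point y c x : touches y c x ->
  y = dual_point x /\ c = (legendre x)^-1.
Proof.
move=> tx; have x0 := touches_neq0 tx; case: tx => c0 h e.
have [df _] := gauge_C1 fG x0.
(* The defect in stationarity serves as its own test direction: the one-sided derivative along [d]
   gives <d, d> <= 0. *)
pose d := c^-1 *: y - grad f x.
have yE : y = c *: grad f x.
  suff d0 : d = 0.
    by rewrite -[grad f x]add0r -d0 /d subrK scalerA divff ?gt_eqF// scale1r.
  apply/eqP/negPn/negP => /dot_self_gt0; apply/negP; rewrite -leNgt.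
  have dv : derivable f x d by exact: diff_derivable.
  have hl := derive_at_right dv.
  suff : dot d (c^-1 *: y) <= 'D_d f x.
    rewrite derive_dot_grad// => hd.
    have -> : dot d d = dot d (c^-1 *: y) - dot d (grad f x) by rewrite -dotBr.
    by rewrite subr_le0.
  rewrite -(cvg_lim _ hl)//; apply: limr_ge; first exact: cvgP hl.
  near=> r.
  have r0 : 0 < r by near: r; exact: nbhs_right_gt.
  rewrite -[X in _ <= X]/(_ * _) mulrC ler_pdivlMr//=.
  have := h (r *: d + x); rewrite dotDl !dotZl e dotZr => hr.
  rewrite -(ler_pM2l c0) mulrBr.
  have -> : c * (c^-1 * dot d y * r) = r * dot d y by field; rewrite gt_eqF.
  lra.
have ck : c * legendre x = 1.
  by have := e; rewrite yE dotZr /legendre; lra.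
have cE : c = (legendre x)^-1.
  by rewrite -[c]mulr1 -(@divff _ (legendre x)) ?gt_eqF ?legendre_gt0// mulrA
    ck mul1r.
by rewrite /dual_point -cE.
Unshelve. all: by end_near. Qed.

(* On the unit sphere the bound is obtained for all large multiples of a
   direction, hence outside a ball; inside the ball it is a second compactness
   argument. *)
Lemma polar_bound_near (F : set_system R) {FF : Filter F} y :
  (\forall k \near F, 0 <= k) ->
  (forall x, `|x| = 1 -> exists2 r, 0 < r &
     \forall x' \near x & k \near F, dot (r *: x') y <= k * f (r *: x')) ->
  (forall x, \forall x' \near x & k \near F, dot x' y <= 1 + k * f x') ->
  \forall k \near F, forall x, dot x y <= 1 + k * f x.
Proof.
move=> F0 Fs Fb.
pose G : set_system (R * R) := filter_prod +oo F.
have FG : Filter G by exact: filter_prod_filter.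
have hs : \forall p \near G, forall x, `|x - 0| = 1 ->
    dot (p.1 *: x) y <= 1 + p.2 * f (p.1 *: x).
  apply: (@near_forall_compact _ _ _ G _ _ (fun p x => dot (p.1 *: x) y <= 1 +
    p.2 * f (p.1 *: x)) (@compact_sphere R n 0 1)) => x /=.
  rewrite subr0 => x1; have [r r0 [[A B]/= [hA hB] hAB]] := Fs x x1.
  exists (A, [set p | r <= p.1 /\ (0 <= p.2 /\ B p.2)]) => /=.
    split => //.
    exists ([set s | r <= s], [set k | 0 <= k /\ B k]) => /=.
      by split; [exact: (nbhs_pinfty_ge (num_real _))|apply: filterI].
    by move=> [s k] /= [? []].
  move=> [x' [s k]]/= [Ax' [rs [k0 Bk]]].
  have s0 : 0 < s by exact: lt_le_trans rs.
  have := hAB (x', k) (conj Ax' Bk) => /= h.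
  have : f (r *: x') <= r / s * f (s *: x').
    have -> : r *: x' = (r / s) *: (s *: x') by rewrite scalerA divfK// gt_eqF.
    by apply: gauge_scale; rewrite divr_ge0 ?(ltW r0) ?(ltW s0)//=
      ler_pdivrMr// mul1r.
  move=> /(ler_wpM2l k0) /(le_trans h).
  have -> : dot (r *: x') y = r / s * dot (s *: x') y.
    by rewrite -dotZl scalerA divfK// gt_eqF.
  rewrite mulrCA ler_pM2l ?divr_gt0// => /le_trans; apply.
  by rewrite lerDr.
have [[A B]/= [[M [_ hM]] hB] hAB] := hs.
pose r := Num.max M 0 + 1.
have r0 : 0 < r by rewrite ltr_wpDl// le_max lexx orbT.
have Mr : M < r by rewrite ltr_pwDr// le_max lexx.
have hb : \forall k \near F, forall x, `|x - 0| <= r -> dot x y <= 1 + k * f x.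
  by apply: (near_forall_compact (@compact_cball R n 0 r)) => x _; exact: Fb.
near=> k => x.
have Bk : B k by near: k.
have [xr|rx] := leP `|x| r.
  have hk : forall x, `|x - 0| <= r -> dot x y <= 1 + k * f x by near: k.
  by apply: hk; rewrite subr0.
have x0 : 0 < `|x| by exact: lt_trans rx.
have := hAB (`|x|, k) (conj (hM _ (lt_trans Mr rx)) Bk) (`|x|^-1 *: x).
rewrite /= scalerA divff ?gt_eqF// scale1r; apply.
by rewrite subr0 normrZ normfV normr_id mulVf// gt_eqF.
Unshelve. all: by end_near. Qed.

Definition polar_set y : set R :=
  [set c | 0 <= c /\ forall x, dot x y <= 1 + c * f x].

Lemma gauge_affine_cvg y x c r : x != 0 -> 0 < r ->
  p.2 * f (r *: p.1) - dot (r *: p.1) y @[p --> (x, c)] -->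
    c * f (r *: x) - dot (r *: x) y.
Proof.
move=> x0 r0.
have rx : r *: p.1 @[p --> (x, c)] --> r *: x.
  by apply: (@cvgZl_tmp _ _ _ (nbhs (x, c)) _ r fst x); exact: cvg_fst.
apply: cvgB; last first.
  exact: (cvg_comp _ (dotl y) rx (@dotl_continuous _ _ y (r *: x))).
apply: cvgM; first exact: cvg_snd.
apply: (cvg_comp _ f rx); apply: gauge_continuous.
by rewrite scaler_eq0 negb_or x0 gt_eqF.
Qed.

Lemma gauge_affine_near y x c r a : x != 0 -> 0 < r ->
  a < c * f (r *: x) - dot (r *: x) y ->
  \forall x' \near x & k \near c, a < k * f (r *: x') - dot (r *: x') y.
Proof.
move=> x0 r0 h.
exact: (@cvgr_gt _ _ _ _ _ _ (gauge_affine_cvg (y := y) (c := c) x0 r0) a h).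
Qed.

Lemma near0_dot_le1 y : \forall x \near (0 : V), dot x y <= 1.
Proof.
have h : dotl y x @[x --> (0 : V)] --> dotl y 0 by exact: dotl_continuous.
have := @cvgr_le _ _ _ _ _ _ h 1; rewrite /dotl dot0l; apply.
exact: ltr01.
Qed.

(** Near each point of the unit sphere f is bounded below by a positive number, so a large k gives k
    f >= <., y>. Near 0, where f vanishes, the summand 1 suffices. *)
Lemma polar_set_nonempty y : polar_set y !=set0.
Proof.
have h x : x != 0 -> \forall x' \near x & k \near +oo, dot x' y <= k * f x'.
  move=> x0; have fx := gauge_gt0 x0.
  have h1 : \forall x' \near x, f x / 2 <= f x'.
    have fc := gauge_continuous x0.
    by apply: (@cvgr_ge _ _ _ _ _ _ fc); rewrite ltr_pdivrMr// ltr_pMr// ltr1n.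
  have h2 : \forall x' \near x, dot x' y <= `|dot x y| + 1.
    have h2 : dotl y x' @[x' --> x] --> dotl y x by exact: dotl_continuous.
    have := @cvgr_le _ _ _ _ _ _ h2 (`|dot x y| + 1); apply.
    by rewrite /dotl (le_lt_trans (ler_norm _))// ltrDl.
  near=> x' k.
  have fx' : f x / 2 <= f x' by near: x'.
  have dx' : dot x' y <= `|dot x y| + 1 by near: x'.
  apply: (le_trans dx').
  have k0 : 0 <= k by near: k; exact: (nbhs_pinfty_ge (num_real _)).
  have hk : (`|dot x y| + 1) / (f x / 2) <= k.
    by near: k; exact: (nbhs_pinfty_ge (num_real _)).
  move: hk; rewrite ler_pdivrMr ?divr_gt0// => /le_trans; apply.
  by rewrite ler_wpM2l.
have : \forall k \near +oo, forall x, dot x y <= 1 + k * f x.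
  apply: polar_bound_near.
  - exact: (nbhs_pinfty_ge (num_real _)).
  - move=> x x1; have x0 : x != 0 by rewrite -normr_gt0 x1.
    exists 1 => //; apply: filterS (h x x0) => -[x' k]/=.
    by rewrite !scale1r.
  - move=> x; have [->|x0] := eqVneq x 0; last first.
      apply: filterS (h x x0) => -[x' k]/= /le_trans; apply.
      by rewrite lerDr.
    near=> x' k.
    have k0 : 0 <= k by near: k; exact: (nbhs_pinfty_ge (num_real _)).
    have x'1 : dot x' y <= 1 by near: x'; exact: near0_dot_le1.
    by rewrite (le_trans x'1)// lerDl mulr_ge0// gauge_ge0.
move=> hk; near (pinfty_nbhs R) => k.
have k0 : 0 <= k by near: k; exact: (nbhs_pinfty_ge (num_real _)).
by exists k; split => //; near: k.
Unshelve. all: by end_near. Qed.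

(* For the least admissible c, a direction along which c f never exceeds
   <., y> would contradict nonlinearity at infinity. Hence, if c f never met
   <., y> - 1, compactness would make a smaller c admissible. *)
Lemma touches_exists y : y != 0 -> exists c x, touches y c x.
Proof.
move=> y0; pose A := polar_set y; pose c := inf A.
have hA : has_inf A.
  by split; [exact: polar_set_nonempty|exists 0 => a []].
have c0 : 0 <= c by apply: lb_le_inf; [exact: polar_set_nonempty|move=> a []].
have hc x : dot x y <= 1 + c * f x.
  apply/ler_addgt0Pr => e e0.
  (* Chosen so that the excess of [a] over [c], multiplied by f x, stays below e. *)
  have e1 : 0 < e / (1 + f x) by rewrite divr_gt0// ltr_pwDl// gauge_ge0.
  have [a [a0 /(_ x) ha] ac] := inf_adherent e1 hA.
  rewrite (le_trans ha)// -addrA lerD2l.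
  have : a * f x <= (c + e / (1 + f x)) * f x by
    rewrite ler_wpM2r ?gauge_ge0// ltW.
  move=> /le_trans; apply; rewrite mulrDl lerD2l -mulrA.
  rewrite ler_piMr ?(ltW e0)// mulrC ler_pdivrMr ?mul1r ?lerDr//.
  by rewrite ltr_pwDl// gauge_ge0.
have {}c0 : 0 < c.
  rewrite lt_neqAle c0 andbT; apply/negP => /eqP c00.
  (* This multiple of y pairs with y to 2, while c = 0 would allow at most 1. *)
  have yy := dot_self_gt0 y0; have := hc ((2 / dot y y) *: y).
  by rewrite -c00 mul0r addr0 dotZl divfK ?gt_eqF// leNgt ltr1n.
apply: contrapT => /forallNP ht.
have {}ht x : dot x y < 1 + c * f x.
  rewrite lt_neqAle hc andbT; apply/eqP => e.
  by apply: (ht c); exists x.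
have nc0 : \forall k \near c, 0 <= k.
  by apply: (@cvgr_ge _ _ (nbhs c) _ id c) => //; exact: cvg_id.
have : \forall k \near c, forall x, dot x y <= 1 + k * f x.
  apply: (@polar_bound_near (nbhs c) _ y) => //.
  - move=> x x1; have x0 : x != 0 by rewrite -normr_gt0 x1.
    have [r r0 hr] : exists2 r, 0 < r & dot (r *: x) y < c * f (r *: x).
      apply: contrapT => /forall2NP nr.
      have {}nr r : 0 < r -> c * f (r *: x) <= r * dot x y.
        by move=> r0; case: (nr r) => [//|/negP]; rewrite -leNgt dotZl.
      (* If c f never exceeds <., y> on the ray, admissibility of c puts c f between <., y> - 1 and
         <., y>; division by c gives these two constants. *)
      apply: (gauge_nonlinear fG (a := dot x y / c) (b := c^-1) x0).
      + rewrite divr_ge0 ?(ltW c0)//; have := nr 1 ltr01.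
        by rewrite scale1r mul1r; apply: le_trans;
          rewrite mulr_ge0 ?gauge_ge0 ?(ltW c0).
      + by rewrite invr_gt0.
      + move=> t; rewrite le_eqVlt => /predU1P[<-|t0].
          rewrite scale0r gauge0// mulr0; split => //.
          by rewrite sub0r oppr_le0 invr_ge0 ltW.
        split.
          rewrite -(ler_pM2l c0) mulrBr divff ?gt_eqF//.
          have := hc (t *: x); rewrite dotZl.
          have -> : c * (dot x y / c * t) = t * dot x y by field;
            rewrite gt_eqF.
          lra.
        by rewrite mulrAC ler_pdivlMr// mulrC [_ * t]mulrC nr.
    exists r => //.
    move: hr; rewrite -subr_gt0 => /(gauge_affine_near x0 r0).
    by apply: filterS => p /=; rewrite subr_gt0 => /ltW.
  - move=> x; have [->|x0] := eqVneq x 0.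
      near=> x' k.
      have k0 : 0 <= k by near: k.
      have x'1 : dot x' y <= 1 by near: x'; exact: near0_dot_le1.
      by rewrite (le_trans x'1)// lerDl mulr_ge0// gauge_ge0.
    have : -1 < c * f (1 *: x) - dot (1 *: x) y.
      by have := ht x; rewrite !scale1r; lra.
    move=> /(gauge_affine_near x0 ltr01).
    by apply: filterS => p /=; rewrite !scale1r => ?; lra.
move=> hk.
have [k [k0 kc kx]] : exists k, [/\ 0 <= k, k < c & forall x, dot x y <= 1 +
  k * f x].
  have h : \forall k \near c, 0 <= k /\ forall x, dot x y <= 1 + k * f x.
    by near=> k; split; near: k.
  have [/= r r0 hr] := (nbhs_ballP _ _).1 h.
  have [|? ?] := hr (c - r / 2).
    rewrite /ball/= opprB addrC subrK gtr0_norm ?divr_gt0//.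
    by rewrite ltr_pdivrMr// ltr_pMr// ltr1n.
  by exists (c - r / 2); split => //; rewrite ltrBlDr ltrDl divr_gt0.
have : c <= k by apply: ge_inf => //; exists 0 => a [].
by rewrite leNgt kc.
Unshelve. all: by end_near. Qed.

End Gauge.

(** * The polar transform of one function *)

Section RealPolar.
Context {R : realType} {n : nat}.
Local Notation V := 'rV[R]_n.
Implicit Types (f g : V -> R) (x y z : V) (a b c s t : R).

Definition rpolar f y : R := fine (polar (EFin \o f) y).

Lemma polar_setE f y : polar (EFin \o f) y = ereal_inf (EFin @` polar_set f y).
Proof.
rewrite /polar; set A := [set c : R | _]; suff -> : A = polar_set f y by [].
apply/funext => c; apply/propext.
by split=> -[c0 h]; split => // x; have := h x;
  rewrite /= -EFinM -EFinD lee_fin.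
Qed.

Lemma polar_ge f y c : (exists2 x, 0 < f x & dot x y = 1 + c * f x) ->
  (c%:E <= polar (EFin \o f) y)%E.
Proof.
move=> [x fx e]; rewrite polar_setE; apply: le_ereal_inf_tmp
  => _ [a [a0 /(_ x) ha] <-].
by move: ha; rewrite e lerD2l ler_pM2r// lee_fin.
Qed.

Lemma polar_le f y c : 0 <= c -> (forall x, dot x y <= 1 + c * f x) ->
  (polar (EFin \o f) y <= c%:E)%E.
Proof.
by move=> c0 h; rewrite polar_setE; apply: ereal_inf_lbound; exists c.
Qed.

Lemma polar_eq f y c : 0 <= c -> (forall x, dot x y <= 1 + c * f x) ->
  (exists2 x, 0 < f x & dot x y = 1 + c * f x) -> polar (EFin \o f) y = c%:E.
Proof. by move=> c0 h e; apply/eqP; rewrite eq_le polar_le// polar_ge. Qed.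

Lemma polar_0 f : polar (EFin \o f) 0 = 0%E.
Proof.
apply/eqP; rewrite eq_le polar_le//=; last by move=> x;
  rewrite dot0r mul0r addr0.
by rewrite polar_setE; apply: le_ereal_inf_tmp => _ [a [a0 _] <-];
  rewrite lee_fin.
Qed.

Variable f : V -> R.
Hypothesis fG : gauge f.

Lemma touches_polar y c x : touches f y c x -> polar (EFin \o f) y = c%:E.
Proof.
move=> tx; have fx := gauge_gt0 fG (touches_neq0 fG tx); case: tx => c0 h e.
by apply: polar_eq => //; [exact: ltW|exists x].
Qed.

Lemma touches_rpolar y c x : touches f y c x -> rpolar f y = c.
Proof. by move=> /touches_polar; rewrite /rpolar => ->. Qed.

Lemma rpolar0 : rpolar f 0 = 0.
Proof. by rewrite /rpolar polar_0. Qed.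

Lemma rpolarE y : polar (EFin \o f) y = (rpolar f y)%:E.
Proof.
have [->|/(touches_exists fG)[c [x tx]]] := eqVneq y 0;
  first by rewrite polar_0 rpolar0.
by rewrite (touches_rpolar tx) (touches_polar tx).
Qed.

(** For y = 0 the polar value is 0, which [touches] excludes, so the default 0 is returned. *)
Definition polar_point y : V := xget 0 [set x | touches f y (rpolar f y) x].

Lemma polar_point_touches y :
  y != 0 -> touches f y (rpolar f y) (polar_point y).
Proof.
move=> /(touches_exists fG)[c [x tx]].
rewrite /polar_point; case: xgetP => [z -> //|/(_ x)].
by rewrite /= (touches_rpolar tx).
Qed.

Lemma rpolar_gt0 y : y != 0 -> 0 < rpolar f y.
Proof. by move=> /polar_point_touches[]. Qed.

Lemma rpolar_ge0 y : 0 <= rpolar f y.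
Proof.
by have [->|/rpolar_gt0/ltW//] := eqVneq y 0; rewrite rpolar0.
Qed.

Lemma rpolar_bound x y : dot x y <= 1 + rpolar f y * f x.
Proof.
have [->|/polar_point_touches[]//] := eqVneq y 0.
by rewrite dot0r rpolar0 mul0r addr0.
Qed.

Lemma rpolar_le y c :
  0 <= c -> (forall x, dot x y <= 1 + c * f x) -> rpolar f y <= c.
Proof. by move=> c0 h; have := polar_le c0 h; rewrite rpolarE lee_fin. Qed.

Lemma polar_point_neq0 y : y != 0 -> polar_point y != 0.
Proof. by move=> /polar_point_touches/(touches_neq0 fG). Qed.

Lemma dual_point_neq0 x : x != 0 -> dual_point f x != 0.
Proof.
move=> x0; have [c0 _ e] := dual_point_touches fG x0.
apply: contraTneq isT => y0; have := gauge_ge0 fG x; rewrite leNgt => /negP[].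
rewrite -(pmulr_rlt0 _ c0); move: e; rewrite y0 dot0r.
lra.
Qed.

Lemma polar_pointK x : x != 0 -> polar_point (dual_point f x) = x.
Proof.
move=> x0; have tx := dual_point_touches fG x0.
by have [] := touches_unique fG (polar_point_touches (dual_point_neq0 x0)) tx.
Qed.

Lemma dual_pointK y : y != 0 -> dual_point f (polar_point y) = y.
Proof. by move=> /polar_point_touches/(touches_dual_point fG)[]. Qed.

Lemma rpolar_legendre y :
  y != 0 -> rpolar f y = (legendre f (polar_point y))^-1.
Proof. by move=> /polar_point_touches/(touches_dual_point fG)[]. Qed.

Lemma rpolar_eq y :
  y != 0 -> rpolar f y * f (polar_point y) = dot (polar_point y) y - 1.
Proof. by move=> /polar_point_touches[_ _ ->]; rewrite addrC addKr. Qed.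

(** The relation <x, y> = 1 + f^o(y) f(x) is symmetric in the two sides, so the point dual to x
    attains the polar of f^o at x. *)
Lemma polar_rpolar x : polar (EFin \o rpolar f) x = (f x)%:E.
Proof.
have [->|x0] := eqVneq x 0; first by rewrite polar_0 gauge0.
apply: polar_eq => [|y|].
- exact: gauge_ge0.
- by rewrite dotC mulrC rpolar_bound.
exists (dual_point f x); first by rewrite rpolar_gt0// dual_point_neq0.
have tx := dual_point_touches fG x0.
by rewrite dotC (touches_rpolar tx) mulrC; case: tx.
Qed.

Lemma rpolarK : rpolar (rpolar f) = f.
Proof. by apply/funext => x; rewrite /rpolar polar_rpolar. Qed.

Lemma gauge_rpolar : C1_off0 (rpolar f) -> gauge (rpolar f).
Proof.
move=> dv; split => //.
- move=> x y s /andP[s0 s1]; apply: rpolar_le.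
    by rewrite addr_ge0// mulr_ge0 ?subr_ge0 ?rpolar_ge0.
  move=> z; rewrite dotDr !dotZr.
  have s1' : 0 <= 1 - s by rewrite subr_ge0.
  have := ler_wpM2l s0 (rpolar_bound z y);
    have := ler_wpM2l s1' (rpolar_bound z x).
  lra.
- exact: rpolar_ge0.
- exact: rpolar0.
(* Only the midpoint [m] of the segment matters. At its touching point [w] the bounds for x and y
   average to an equality, so both are equalities, and x and y both equal the dual point of [w]. *)
- move=> x y xy h.
  have v0 : rpolar f 0 = 0 := rpolar0.
  have pos z z' s : z != z' -> 0 < s < 1 ->
    0 < (1 - s) * rpolar f z + s * rpolar f z'.
    move=> zz' /andP[s0 s1].
    have [z0|z0] := eqVneq z 0.
      rewrite z0 v0 mulr0 add0r mulr_gt0// rpolar_gt0//.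
      by rewrite -z0 eq_sym.
    by rewrite ltr_pwDl// ?mulr_gt0 ?subr_gt0 ?rpolar_gt0// mulr_ge0
      ?rpolar_ge0 ?ltW.
  have hs : (2^-1 : R) = 1 - 2^-1 by lra.
  have := h 2^-1; rewrite -hs -[X in rpolar f X]scalerDr => /(_ _)/wrap[|hv];
    first lra.
  have hp := pos x y 2^-1 xy; rewrite -hs in hp.
  set m := 2^-1 *: (x + y) in hv.
  have m0 : m != 0.
    apply/eqP => m0; move: hv; rewrite m0 v0.
    have : 0 < (2^-1 : R) < 1 by lra.
    by move=> /hp /[swap] <-; rewrite ltxx.
  have e := rpolar_eq m0; set w := polar_point m in e.
  have hx := rpolar_bound w x; have hy := rpolar_bound w y.
  have fw : 0 < f w by rewrite gauge_gt0// polar_point_neq0.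
  have dm : dot w m = 2^-1 * dot w x + 2^-1 * dot w y by
    rewrite /m dotZr dotDr mulrDr.
  have key : 2^-1 * (rpolar f x * f w) + 2^-1 * (rpolar f y * f w) = dot w m -
    1.
    by rewrite -e hv; ring.
  have ex : dot w x = 1 + rpolar f x * f w by lra.
  have ey : dot w y = 1 + rpolar f y * f w by lra.
  have gen z : dot w z = 1 + rpolar f z * f w -> z = dual_point f w.
    move=> ez; have z0 : z != 0.
      apply: contra_eq_neq ez => ->; rewrite dot0r v0 mul0r addr0.
      by rewrite eq_sym oner_neq0.
    have tz : touches f z (rpolar f z) w.
      by split => //; [exact: rpolar_gt0|move=> u; exact: rpolar_bound].
    by have [] := touches_dual_point fG tz.
  by move/eqP : xy; apply; rewrite (gen _ ex) (gen _ ey).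
(* If f^o were asymptotically linear along y with slope a, then <x, y> < a f x for x != 0. By
   compactness a can be lowered to a - e on a small sphere, hence outside it, while 2 b f <= 1
   inside. So f^o(t y) <= a t - 2 b for some t, against the lower bound a t - b. *)
- move=> y a b y0 a0 b0 h.
  have {}a0 : 0 < a.
    rewrite lt_neqAle a0 andbT; apply/negP => /eqP a00.
    have [_] := h 1 ler01; rewrite scale1r -a00 mul0r leNgt.
    by rewrite rpolar_gt0.
  (* The polar bound at y / e, multiplied by e, reads <x, y> <= e + a f x. *)
  have fle x : dot x y <= a * f x.
    apply/ler_addgt0Pr => e e0.
    have t0 : 0 < e^-1 by rewrite invr_gt0.
    have [_ h2] := h e^-1 (ltW t0).
    have := rpolar_bound x (e^-1 *: y).
    have := ler_wpM2r (gauge_ge0 fG x) h2.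
    rewrite dotZr => h3 h4.
    rewrite -(ler_pM2l t0) mulrDr mulVf ?gt_eqF//; lra.
  have flt x : x != 0 -> dot x y < a * f x.
    move=> x0; rewrite lt_neqAle fle andbT; apply/eqP => e.
    apply: (gauge_strict fG (x := 0) (y := x)); first by rewrite eq_sym.
    move=> s sI; rewrite scaler0 add0r gauge0// mulr0 add0r.
    apply/eqP; rewrite eq_le gauge_scale//= -(ler_pM2l a0).
    by have := fle (s *: x); rewrite dotZl e; lra.
  have [r r0 fr] : exists2 r, 0 < r & forall x : V, `|x| < r ->
    2 * b * f x <= 1.
    have h1 : \forall k \near +oo, forall x : V, `|x - 0| = 1 -> f x <= k.
      apply: (@near_forall_compact _ _ _ (pinfty_nbhs R) _ _ (fun k x => f x <=
        k) (@compact_sphere R n 0 1)).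
      move=> x; rewrite /= subr0 => x1.
      have x0 : x != 0 by rewrite -normr_gt0 x1.
      have h1 : \forall x' \near x, f x' <= f x + 1.
        by apply: (@cvgr_le _ _ _ _ _ _ (gauge_continuous fG x0));
          rewrite ltrDl.
      near=> x' k; have fx' : f x' <= f x + 1 by near: x'.
      have hk : f x + 1 <= k by near: k; exact: (nbhs_pinfty_ge (num_real _)).
      exact: le_trans hk.
    have [M [M0 hM]] : exists M, 0 < M /\ forall x : V, `|x - 0| = 1 ->
      f x <= M.
      near (pinfty_nbhs R) => M; exists M; split; last by near: M.
      by near: M; exact: (nbhs_pinfty_gt (num_real _)).
    exists (Num.min 1 (2 * b * M)^-1).
      by rewrite lt_min ltr01/= invr_gt0 !mulr_gt0.
    move=> x; rewrite lt_min => /andP[x1 xM].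
    have [->|x0] := eqVneq x 0; first by rewrite gauge0// mulr0.
    have nx : 0 < `|x| by rewrite normr_gt0.
    have : f x <= `|x| * M.
      have := hM (`|x|^-1 *: x); rewrite subr0 normrZ normfV normr_id mulVf
        ?gt_eqF//.
      move=> /(_ erefl) /(ler_wpM2l (ltW nx)); apply: le_trans.
      have := @gauge_scale _ _ _ fG (`|x|^-1 *: x) `|x|;
        rewrite scalerA divff ?gt_eqF// scale1r.
      by apply; rewrite (ltW nx) ltW.
    move=> fx; have b2 : 0 < 2 * b by rewrite mulr_gt0.
    rewrite (le_trans (ler_wpM2l (ltW b2) fx))// mulrCA -ler_pdivlMr
      ?mulr_gt0// div1r.
    exact: ltW.
  have [e [e0 ea he]] : exists e, [/\ 0 < e, e <= a &
      forall x : V, `|x| = r -> dot x y <= (a - e) * f x].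
    have h1 : \forall k \near a, forall x : V, `|x - 0| = r ->
      dot x y <= k * f x.
      apply: (@near_forall_compact _ _ _ (nbhs a) _ _ (fun k x => dot x y <=
        k * f x) (@compact_sphere R n 0 r)).
      move=> x; rewrite /= subr0 => xr.
      have x0 : x != 0 by rewrite -normr_gt0 xr.
      have : 0 < a * f (1 *: x) - dot (1 *: x) y by
        rewrite scale1r subr_gt0 flt.
      move=> /(gauge_affine_near fG x0 ltr01).
      by apply: filterS => p /=; rewrite !scale1r subr_gt0 => /ltW.
    have [/= d d0 hd] := (nbhs_ballP _ _).1 h1.
    exists (Num.min (d / 2) a); split.
    - by rewrite lt_min divr_gt0.
    - by rewrite ge_min lexx orbT.
    - move=> x xr; apply: hd; last by rewrite subr0.
      rewrite /ball/= opprB addrC subrK gtr0_norm ?lt_min ?divr_gt0//.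
      by rewrite gt_min ltr_pdivrMr// ltr_pMr// ltr1n.
  (* The first quotient makes the gain t e at least 2 b; the second keeps a t - 2 b nonnegative, as
     an admissible constant must be. *)
  pose t := Num.max ((2 * b) / e) ((2 * b) / a).
  have te : 2 * b <= t * e by rewrite -ler_pdivrMr// /t le_max lexx.
  have ta : 2 * b <= a * t by rewrite [a * t]mulrC -ler_pdivrMr// /t le_max
    lexx orbT.
  have t0 : 0 <= t by rewrite /t le_max divr_ge0 ?(ltW e0)// mulr_ge0// ltW.
  have [h1 _] := h t t0.
  suff : rpolar f (t *: y) <= a * t - 2 * b by lra.
  apply: rpolar_le; first by rewrite subr_ge0.
  move=> x; rewrite dotZr.
  have [xr|rx] := ltP `|x| r.
    by have := ler_wpM2l t0 (fle x); have := fr x xr; lra.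
  have nx : 0 < `|x| by exact: lt_le_trans rx.
  pose k := r / `|x|.
  have k0 : 0 < k by rewrite divr_gt0.
  have k1 : k <= 1 by rewrite ler_pdivrMr// mul1r.
  have := he (k *: x); rewrite normrZ gtr0_norm// divfK ?gt_eqF// => /(_ erefl).
  have kfx : f (k *: x) <= k * f x by rewrite gauge_scale// (ltW k0).
  have ae : 0 <= a - e by rewrite subr_ge0.
  rewrite dotZl => /le_trans /(_ (ler_wpM2l ae kfx)).
  rewrite mulrCA ler_pM2l// => /(ler_wpM2l t0).
  have := ler_wpM2r (gauge_ge0 fG x) te; lra.
Unshelve. all: by end_near. Qed.

End RealPolar.

(** * Agreement with the classes of the statement *)

Section Classes.
Context {R : realType} {n : nat}.
Local Notation V := 'rV[R]_n.
Implicit Types (f : V -> R).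

Lemma gauge_class f :
  gauge f <-> class_S1 (EFin \o f) /\ nonlinear_at_infinity (EFin \o f).
Proof.
split=> [fG|[[[fc flsc f0 f00] ffin fC1 fs] fnl]].
  split; last first.
    move=> x x0; split => // -[a [b [a0 b0 h]]].
    apply: (gauge_nonlinear fG x0 a0 b0) => t t0.
    by have [] := h t t0; rewrite !lee_fin.
  split => //.
  - split => //.
    + move=> x y s /andP[s0 s1]; rewrite /= -!EFinM -EFinD lee_fin.
      by apply: (gauge_convex fG); rewrite !ltW.
    (* At 0, where differentiability is not assumed, lower semicontinuity holds because 0 is the
       least value. *)
    + move=> x a /=; rewrite lte_fin => ax.
      have [x0|x0] := eqVneq x 0.
        exists setT; first exact: filterT.
        move=> y _; rewrite lte_fin; apply: lt_le_trans (gauge_ge0 fG y).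
        by move: ax; rewrite x0 gauge0.
      exists [set y | a < f y]; last by move=> y; rewrite /= lte_fin.
      exact: (@cvgr_gt _ _ _ _ _ _ (gauge_continuous fG x0) a ax).
    + by move=> x; rewrite lee_fin (gauge_ge0 fG).
    + by rewrite /= gauge0.
  - exact: (gauge_C1 fG).
  - move=> [x [y [xy h]]]; apply: (gauge_strict fG xy) => s sI.
    by have := h s sI; rewrite /= -!EFinM -EFinD => -[].
split => //.
- move=> x y s /andP[]; rewrite le_eqVlt => /predU1P[<-|s0].
    by rewrite subr0 !scale1r !scale0r mul1r mul0r !addr0.
  rewrite le_eqVlt => /predU1P[->|s1].
    by rewrite subrr !scale0r !scale1r mul0r mul1r !add0r.
  have := fc x y s; rewrite s0 s1 => /(_ isT).
  by rewrite /= -!EFinM -EFinD lee_fin.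
- exact: EFin_inj f00.
- move=> x y xy h; apply: fs; exists x, y; split => // s sI.
  by rewrite /= h.
- move=> x a b x0 a0 b0 h; have [_] := fnl x x0; apply.
  by exists a, b; split => // t t0; rewrite !lee_fin; exact: h.
Qed.

End Classes.

(** * Continuity of polar values and touching points in a family *)

Section PolarFamily.
Context {R : realType} {n : nat} {T : R}.
Hypothesis T0 : 0 < T.
Local Notation V := 'rV[R]_n.
Local Notation P := (R * V)%type.
Local Notation S := (slab T : set P).
Local Notation nb p := (within S (nbhs p)).
Implicit Types (t s : R) (x y : V) (p q : P).

Variable w : R -> V -> R.
Hypothesis wG : forall t, 0 <= t <= T -> gauge (w t).
Hypothesis wc : C0_slab T w.

Definition polar_map p : P := (p.1, polar_point (w p.1) p.2).

Lemma polar_map_slab p : S p -> S (polar_map p).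
Proof. by move=> [/= pT p0]; split => //=; apply: polar_point_neq0 => //;
  exact: wG. Qed.

(** The nesting of the product filters matches the compactness lemma, where x runs over a compact
    set and (q, k) over a filter. *)
Lemma slab_prod_cvg p x (c : R) : S p -> x != 0 ->
  (r.2.1.1, r.1) @[r --> filter_prod (nbhs x) (filter_prod (nb p) (nbhs c))]
  --> nb (p.1, x).
Proof.
move=> Sp x0 A hA.
have {}hA : \forall q \near (p.1, x), S q -> A q by exact: hA.
pose F := filter_prod (nbhs x) (filter_prod (nb p) (nbhs c)).
have FF : Filter F by exact: filter_prod_filter.
have h : (r.2.1.1, r.1) @[r --> F] --> (p.1, x).
  apply: (@cvg_pair _ _ _ F (nbhs p.1) (nbhs x) _ _ _ (fun r => r.2.1.1) fst).
    apply: (@cvg_comp _ _ _ (fun r : V * (P * R) => r.2.1) fst F (nb p)).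
      by apply: (@cvg_comp _ _ _ snd fst F (filter_prod (nb p) (nbhs c)));
        [exact: cvg_snd|exact: cvg_fst].
    apply: cvg_within_filter; exact: cvg_fst.
  exact: cvg_fst.
have {}h : \forall r \near F, S (r.2.1.1, r.1) ->
  A (r.2.1.1, r.1) by exact: h _ hA.
have hx : \forall r \near F, r.1 != 0.
  exists ([set x | x != 0], setT); last by move=> r [].
  by split; [exact: near_neq0|exact: filterT].
have hS : \forall r \near F, S r.2.1.
  exists (setT, [set q | S q.1]); last by move=> r [].
  split; first exact: filterT.
  exists (S, setT); last by move=> r [].
  by split; [exact: withinT|exact: filterT].
suff : \forall r \near F, A (r.2.1.1, r.1) by [].
near=> r.
have hr : S (r.2.1.1, r.1) -> A (r.2.1.1, r.1) by near: r.
apply: hr; have r10 : r.1 != 0 by near: r.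
have [r21 _] : S r.2.1 by near: r.
by split.
Unshelve. all: by end_near. Qed.

(** For k >= 0 this is nonnegative in all x exactly when k is admissible for the polar at q; at the
    polar value it vanishes at the touching point. *)
Definition gap (q : P) (k : R) x : R := k * w q.1 x - dot x q.2 + 1.

Lemma gap_cvg p x c : S p -> x != 0 ->
  gap r.2.1 r.2.2 r.1 @[r --> filter_prod (nbhs x)
    (filter_prod (nb p) (nbhs c))]
  --> gap p c x.
Proof.
move=> Sp x0; pose F := filter_prod (nbhs x) (filter_prod (nb p) (nbhs c)).
have FF : Filter F by exact: filter_prod_filter.
have h2 : r.2 @[r --> F] --> filter_prod (nb p) (nbhs c) by exact: cvg_snd.
apply: (@cvgD _ _ _ F); last exact: cvg_cst.
apply: (@cvgB _ _ _ F).
  apply: (@cvgM _ _ F).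
    by apply: (@cvg_comp _ _ _ snd snd F _ _ h2); exact: cvg_snd.
  have Spx : S (p.1, x) by case: Sp => ? _; split.
  have h := (C0_slabP w).1 wc _ Spx.
  exact: (cvg_comp _ (fun q : P => w q.1 q.2) (slab_prod_cvg c Sp x0) h).
apply: (@dot_cvg _ _ _ F) => i.
  apply: (@cvg_comp _ _ _ fst (fun x : V => x 0 i) F (nbhs x));
    first exact: cvg_fst.
  exact: coord_cvg.
apply: (@cvg_comp _ _ _ (fun r : V * (P * R) => r.2.1) (fun q : P
  => q.2 0 i) F (nb p)).
  by apply: (@cvg_comp _ _ _ snd fst F _ _ h2); exact: cvg_fst.
have := @co_cvg _ _ S (lift ord0 i) p.
by rewrite coS; under eq_fun do rewrite coS.
Qed.

Lemma gap_cvg_base p x0 c : S p -> x0 != 0 -> forall x,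
  gap r.2.1 r.2.2 x0 @[r --> filter_prod (nbhs x) (filter_prod (nb p) (nbhs c))]
  --> gap p c x0.
Proof.
move=> Sp x00 x; pose F := filter_prod (nbhs x) (filter_prod (nb p) (nbhs c)).
have FF : Filter F by exact: filter_prod_filter.
have h : (x0, r.2) @[r --> F] --> filter_prod (nbhs x0)
  (filter_prod (nb p) (nbhs c)).
  have F2 : Filter (filter_prod (nb p) (nbhs c)) by exact: filter_prod_filter.
  by apply: (@cvg_pair _ _ _ F (nbhs x0) (filter_prod (nb p) (nbhs c)) _ _ _
    (fun=> x0) snd); [exact: cvg_cst|exact: cvg_snd].
exact: (cvg_comp _ (fun r : V * (P * R)
  => gap r.2.1 r.2.2 r.1) h (gap_cvg Sp x00)).
Qed.

Lemma gap_cvg_fixed p x (k : R) : S p -> x != 0 ->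
  gap r.2 k r.1 @[r --> filter_prod (nbhs x) (nb p)] --> gap p k x.
Proof.
move=> Sp x0; pose F := filter_prod (nbhs x) (nb p).
have FF : Filter F by exact: filter_prod_filter.
have h : (r.1, (r.2, k)) @[r --> F] -->
  filter_prod (nbhs x) (filter_prod (nb p) (nbhs k)).
  have F2 : Filter (filter_prod (nb p) (nbhs k)) by exact: filter_prod_filter.
  apply: (@cvg_pair _ _ _ F (nbhs x) (filter_prod (nb p) (nbhs k)) _ _ _ fst
    (fun r => (r.2, k))); first exact: cvg_fst.
  by apply: (@cvg_pair _ _ _ F (nb p) (nbhs k) _ _ _ snd (fun=> k));
    [exact: cvg_snd|exact: cvg_cst].
exact: (cvg_comp _ (fun r : V * (P * R)
  => gap r.2.1 r.2.2 r.1) h (gap_cvg Sp x0)).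
Qed.

Lemma gap_cvg_slice p x (k : R) : S p -> x != 0 ->
  gap q k x @[q --> nb p] --> gap p k x.
Proof.
move=> Sp x0.
have h : (x, q) @[q --> nb p] --> filter_prod (nbhs x) (nb p).
  by apply: (@cvg_pair _ _ _ (nb p) (nbhs x) (nb p) _ _ _ (fun=> x) id);
    [exact: cvg_cst|exact: cvg_id].
exact: (cvg_comp _ (fun r : V * P => gap r.2 k r.1) h (gap_cvg_fixed (k :=
  k) Sp x0)).
Qed.

Lemma gap_bound q x : S q -> 0 <= gap q (rpolar (w q.1) q.2) x.
Proof.
by move=> [qT _]; have := rpolar_bound (wG qT) x q.2; rewrite /gap; lra.
Qed.

(* Convexity propagates positivity from a sphere to its exterior. *)
Lemma gap_outside q (k e : R) x0 x : S q -> 0 <= k -> 0 < e ->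
  (forall x, `|x - x0| = e -> gap q k x0 < gap q k x /\ 0 < gap q k x) ->
  e <= `|x - x0| -> 0 < gap q k x.
Proof.
move=> [qT _] k0 e0 h ex; have d0 : 0 < `|x - x0| by exact: lt_le_trans ex.
pose l := e / `|x - x0|.
have l0 : 0 < l by rewrite divr_gt0.
have l1 : l <= 1 by rewrite ler_pdivrMr// mul1r.
pose z := (1 - l) *: x0 + l *: x.
have zx0 : z - x0 = l *: (x - x0) by apply/rowP => i; rewrite !mxE; ring.
have [h1 h2] : gap q k x0 < gap q k z /\ 0 < gap q k z.
  by apply: h; rewrite zx0 normrZ gtr0_norm// divfK// gt_eqF.
have hz : gap q k z <= (1 - l) * gap q k x0 + l * gap q k x.
  have := gauge_convex (wG qT) x0 x (s := l); rewrite (ltW l0) l1 => /(_ isT).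
  move=> /(ler_wpM2l k0); rewrite -/z /gap {2}/z dotDl !dotZl; lra.
have l1' : 0 <= 1 - l by rewrite subr_ge0.
rewrite -(pmulr_rgt0 _ l0).
have [g0|g0] := leP (gap q k x0) 0.
  have := mulr_ge0_le0 l1' g0; lra.
have : (1 - l) * gap q k x0 <= (1 - l) * gap q k z by rewrite ler_wpM2l// ltW.
have := mulr_gt0 l0 h2; lra.
Qed.

(* For (q, k) close to (p, polar value at p), the gap is positive on a sphere
   around the touching point, hence outside it by convexity; so the touching
   point of q stays inside. *)
Lemma polar_map_cvg p : S p ->
  polar_map q @[q --> nb p] --> nb (polar_map p) /\
  rpolar (w q.1) q.2 @[q --> nb p] --> rpolar (w p.1) p.2.
Proof.
move=> Sp; have [pT p0] := Sp.
set x0 := polar_point (w p.1) p.2; set c := rpolar (w p.1) p.2.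
have t0 := polar_point_touches (wG pT) p0; have [c0 _ e0] := t0.
have x00 : x0 != 0 by apply: polar_point_neq0 => //; exact: wG.
have wx0 : 0 < w p.1 x0 by apply: gauge_gt0 => //; exact: wG.
have nx0 : 0 < `|x0| by rewrite normr_gt0.
have gx0 : gap p c x0 = 0 by rewrite /gap e0 -/x0 -/c; ring.
have gx x : x != 0 -> x != x0 -> 0 < gap p c x.
  move=> xn0 xx0; rewrite lt_neqAle gap_bound// andbT; apply/eqP => g0.
  have [_ xE] : c = c /\ x = x0.
    apply: (touches_unique (wG pT) _ t0); split => //.
      by move=> z; exact: rpolar_bound (wG pT) _ _.
    by move: g0; rewrite /gap -/c; lra.
  by rewrite xE eqxx in xx0.
(* The condition e < |x0| keeps the sphere around x0 off the origin, where [w] is not assumed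
   continuous. *)
have main (e : R) : 0 < e -> e < `|x0| ->
    exists2 d, 0 < d & \forall q \near nb p, forall (k : R) x, 0 <= k ->
      `|k - c| < d ->
      e <= `|x - x0| -> 0 < gap q k x.
  move=> e_gt0 ex0.
  have h : \forall r \near filter_prod (nb p) (nbhs c), forall x, `|x - x0| =
    e ->
      gap r.1 r.2 x0 < gap r.1 r.2 x /\ 0 < gap r.1 r.2 x.
    apply: (@near_forall_compact _ _ _ (filter_prod (nb p) (nbhs c)) _ _
      (fun r x => gap r.1 r.2 x0 < gap r.1 r.2 x /\ 0 < gap r.1 r.2 x)
      (@compact_sphere R n x0 e)) => x /= xe.
    have xn0 : x != 0.
      by apply: contraTneq ex0 => x0'; rewrite -xe x0' sub0r normrN ltxx.
    have xx0 : x != x0.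
      by apply: contraTneq e_gt0 => x0'; rewrite -xe x0' subrr normr0 ltxx.
    pose F := filter_prod (nbhs x) (filter_prod (nb p) (nbhs c)).
    have FF : Filter F by exact: filter_prod_filter.
    have g1 : gap r.2.1 r.2.2 r.1 @[r --> F] --> gap p c x by exact: gap_cvg.
    have g2 : gap r.2.1 r.2.2 x0 @[r --> F] --> gap p c x0.
      exact: gap_cvg_base.
    have h1 : \forall r \near F, 0 < gap r.2.1 r.2.2 r.1.
      by apply: (@cvgr_gt _ _ _ _ _ _ g1); exact: gx.
    have h2 : \forall r \near F, 0 < gap r.2.1 r.2.2 r.1 - gap r.2.1 r.2.2 x0.
      apply: (@cvgr_gt _ _ _ _ _ _ (cvgB g1 g2)).
      by rewrite gx0 subr0; exact: gx.
    suff : \forall r \near F, gap r.2.1 r.2.2 x0 < gap r.2.1 r.2.2 r.1 /\ 0 <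
      gap r.2.1 r.2.2 r.1 by [].
    near=> r; split; last by near: r.
    by rewrite -subr_gt0; near: r.
  have [[A B]/= [hA hB] hAB] := h.
  have [/= d d0 hd] := (nbhs_ballP _ _).1 hB.
  exists d => //; near=> q => k x k0 kc ex.
  have Aq : A q by near: q; exact: hA.
  have Sq : S q by near: q; exact: withinT.
  apply: (gap_outside Sq k0 e_gt0 _ ex).
  apply: (hAB (q, k)); split => //=; apply: hd.
  by rewrite /ball/= distrC.
(* Lower bound: for k = c - eta the gap at x0 is negative, also for nearby q, so k is not
   admissible. Upper bound: for k = c + eta the gap is positive on a compact ball around x0, and
   outside it by [main], so k is admissible. *)
have vcvg : rpolar (w q.1) q.2 @[q --> nb p] --> c.
  apply/cvgrPdist_lt => eps eps0.
  have hx0 : `|x0| / 2 < `|x0| by rewrite ltr_pdivrMr// ltr_pMr// ltr1n.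
  have e0' : 0 < `|x0| / 2 by rewrite divr_gt0.
  have [d d0 hd] := main _ e0' hx0.
  pose eta := Num.min eps (Num.min d c) / 2.
  have eta0 : 0 < eta by rewrite divr_gt0// !lt_min eps0 d0.
  have [etae etad etac] : [/\ eta < eps, eta < d & eta < c].
    have m0 : 0 < Num.min eps (Num.min d c) by rewrite !lt_min eps0 d0.
    have h : eta < Num.min eps (Num.min d c) by
      rewrite ltr_pdivrMr// ltr_pMr// ltr1n.
    by move: h; rewrite !lt_min => /and3P[].
  have lower : \forall q \near nb p, gap q (c - eta) x0 < 0.
    have := @cvgr_lt _ _ (nb p) _ (fun q => gap q (c -
      eta) x0) _ (gap_cvg_slice (k := c - eta) Sp x00) 0; apply.
    have := mulr_gt0 eta0 wx0; move: gx0; rewrite /gap; lra.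
  have upper : \forall q \near nb p, forall x, `|x - x0| <= `|x0| / 2 ->
    0 < gap q (c + eta) x.
    apply: (@near_forall_compact _ _ _ (nb p) _ _
      (fun q x => 0 < gap q (c + eta) x) (@compact_cball R n x0 (`|x0| / 2)))
        => x /= xe.
    have xn0 : x != 0.
      by apply: contraTneq hx0 => x0'; move: xe; rewrite x0' sub0r normrN leNgt.
    apply: (@cvgr_gt _ _ _ _ _ _ (gap_cvg_fixed (k := c + eta) Sp xn0)).
    have := gap_bound x Sp; have wx : 0 < w p.1 x by rewrite gauge_gt0//;
      exact: wG.
    have := mulr_gt0 eta0 wx; rewrite /gap -/c; lra.
  near=> q.
  have Sq : S q by near: q; exact: withinT.
  have lq : gap q (c - eta) x0 < 0 by near: q.
  have uq : forall x, `|x - x0| <= `|x0| / 2 ->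
    0 < gap q (c + eta) x by near: q.
  have oq : forall (k : R) x, 0 <= k -> `|k - c| < d ->
      `|x0| / 2 <= `|x - x0| -> 0 < gap q k x by near: q.
  have qT := Sq.1.
  have v1 : c - eta < rpolar (w q.1) q.2.
    rewrite ltNge; apply/negP => h.
    have := gap_bound x0 Sq; have := ler_wpM2r (gauge_ge0 (wG qT) x0) h.
    move: lq; rewrite /gap; lra.
  have ce0 : 0 <= c + eta by lra.
  have v2 : rpolar (w q.1) q.2 <= c + eta.
    apply: rpolar_le => //; first exact: wG.
    move=> x; have [xe|/ltW xe] := leP `|x - x0| (`|x0| / 2).
      by have := uq x xe; rewrite /gap; lra.
    have := oq (c + eta) x ce0 _ xe; rewrite addrAC subrr add0r gtr0_norm//
      etad.
    by move=> /(_ isT); rewrite /gap; lra.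
  rewrite ltr_distl; apply/andP; split; lra.
split => //.
have Xcvg : polar_point (w q.1) q.2 @[q --> nb p] --> x0.
  apply/cvgrPdist_lt => eps eps0.
  pose e := Num.min eps `|x0| / 2.
  have m0 : 0 < Num.min eps `|x0| by rewrite lt_min eps0.
  have e_gt0 : 0 < e by rewrite divr_gt0.
  have : e < Num.min eps `|x0| by rewrite ltr_pdivrMr// ltr_pMr// ltr1n.
  rewrite lt_min => /andP[e_eps e_x0].
  have [d d0 hd] := main _ e_gt0 e_x0.
  have vd : \forall q \near nb p, `|c - rpolar (w q.1) q.2| < d.
    by move/cvgrPdist_lt : vcvg; apply.
  near=> q.
  have Sq : S q by near: q; exact: withinT.
  have oq : forall (k : R) x, 0 <= k -> `|k - c| < d ->
      e <= `|x - x0| -> 0 < gap q k x by near: q.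
  have vq : `|c - rpolar (w q.1) q.2| < d by near: q.
  rewrite distrC (lt_trans _ e_eps)// ltNge; apply/negP => h.
  have [qT q0] := Sq.
  have := oq (rpolar (w q.1) q.2) _ (rpolar_ge0 (wG qT) _) _ h.
  rewrite distrC vq => /(_ isT).
  have [_ _ eq] := polar_point_touches (wG qT) q0.
  by rewrite /gap eq; lra.
move=> A hA.
have {}hA : \forall z \near (p.1, x0), S z -> A z by exact: hA.
have h : polar_map q @[q --> nb p] --> (p.1, x0).
  apply: (@cvg_pair _ _ _ (nb p) (nbhs p.1) (nbhs x0) _ _ _ fst (fun q
    => polar_point (w q.1) q.2)) => //.
  by apply: cvg_within_filter; exact: cvg_fst.
have {}h : \forall q \near nb p, S (polar_map q) ->
  A (polar_map q) by exact: h _ hA.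
suff : \forall q \near nb p, A (polar_map q) by [].
near=> q.
have hq : S (polar_map q) -> A (polar_map q) by near: q.
apply: hq; apply: polar_map_slab; near: q; exact: withinT.
Unshelve. all: by end_near. Qed.

End PolarFamily.

(** * Closure properties of C^1 functions along a set *)

Section C1Closure.
Context {R : realType} {n : nat}.
Local Notation P := (R * 'rV[R]_n)%type.
Variable S : set P.
Local Notation nb p := (within S (nbhs p)).
Implicit Types (p q : P) (F G : P -> R).

Lemma grad_on_eq F D E : (forall j p, D j p = E j p) ->
  grad_on S F D -> grad_on S F E.
Proof.
move=> DE; have -> // : E = D.
by apply/funext => j; apply/funext => p; rewrite DE.
Qed.

Lemma grad_on_ext F G D : {in S, F =1 G} -> grad_on S F D -> grad_on S G D.
Proof. by move=> FG FD p Sp; have [dF Dc] := FD p Sp; split => //;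
  exact: cdiff_ext dF. Qed.

Lemma grad_on_cst (a : R) : grad_on S (fun=> a) (fun _ _ => 0).
Proof. by move=> p _; split; [exact: cdiff_cst|move=> j; exact: cvg_cst]. Qed.

Lemma grad_onD F G D E : grad_on S F D -> grad_on S G E ->
  grad_on S (fun p => F p + G p) (fun j p => D j p + E j p).
Proof.
move=> FD GE p Sp; have [dF Dc] := FD p Sp; have [dG Ec] := GE p Sp.
by split; [exact: cdiffD|move=> j; exact: cvgD].
Qed.

Lemma grad_onM F G D E : grad_on S F D -> grad_on S G E ->
  grad_on S (fun p => F p * G p) (fun j p => F p * E j p + D j p * G p).
Proof.
move=> FD GE p Sp; have [dF Dc] := FD p Sp; have [dG Ec] := GE p Sp.
have Fc := cdiff_cvg dF; have Gc := cdiff_cvg dG.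
by split; [exact: cdiffM|move=> j; apply: cvgD; exact: cvgM].
Qed.

Definition C1on F := exists D, grad_on S F D.

Lemma C1onN F : C1on F -> C1on (fun p => - F p).
Proof.
move=> [D FD]; exists (fun j p => - D j p) => p Sp; have [dF Dc] := FD p Sp.
by split; [exact: cdiffN|move=> j; exact: cvgN].
Qed.

Lemma C1onM F G : C1on F -> C1on G -> C1on (fun p => F p * G p).
Proof. by move=> [D FD] [E GE]; eexists; exact: grad_onM FD GE. Qed.

Lemma C1onV F :
  (forall p, S p -> F p != 0) -> C1on F -> C1on (fun p => (F p)^-1).
Proof.
move=> F0 [D FD]; exists (fun j p => - D j p / F p ^+ 2) => p Sp.
have [dF Dc] := FD p Sp; split; first by apply: cdiffV => //; exact: F0.
move=> j; have Fc := cdiff_cvg dF; apply: cvgM; first exact: cvgN.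
apply: cvgV; first by rewrite expf_neq0// F0.
by rewrite expr2; under eq_fun do rewrite expr2; exact: cvgM.
Qed.

Lemma C1on_comp F (Z : P -> P) (E : 'I_n.+1 -> 'I_n.+1 -> P -> R) :
  (forall p, S p -> S (Z p)) -> (forall p, S p -> Z q @[q --> nb p]
    --> nb (Z p)) ->
  (forall l, grad_on S (co l \o Z) (E l)) -> C1on F -> C1on (F \o Z).
Proof.
move=> SZ Zc ZE [D FD]; exists (fun j p => \sum_l D l (Z p) * E l j p) => p Sp.
have [dF Dc] := FD _ (SZ _ Sp); split.
  by apply: cdiff_comp dF _ => [|l]; [exact: Zc|exact: (ZE l _ Sp).1].
move=> j; apply: cvg_sumr => l; apply: cvgM; last exact: (ZE l _ Sp).2.
exact: (cvg_comp Z (D l) (Zc _ Sp) (Dc l)).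
Qed.

End C1Closure.

(** * Derivatives of the polars of a family *)

Section PolarCalculus.
Context {R : realType} {n : nat} {T : R}.
Hypothesis T0 : 0 < T.
Local Notation V := 'rV[R]_n.
Local Notation P := (R * V)%type.
Local Notation S := (slab T : set P).
Local Notation nb p := (within S (nbhs p)).
Local Notation sp i := (lift ord0 i).
Implicit Types (t s : R) (x y : V) (p q : P).

Variables (w : R -> V -> R) (D : 'I_n.+1 -> P -> R)
  (D2 : 'I_n.+1 -> 'I_n.+1 -> P -> R).
Hypothesis wG : forall t, 0 <= t <= T -> gauge (w t).
Local Notation W := (fun p : P => w p.1 p.2).
Hypothesis dW : grad_on S W D.
Hypothesis dD : forall l, grad_on S (D l) (D2 l).
Hypothesis wH : forall p, S p -> forall h : V, h != 0 ->
  0 < \sum_i h 0 i * \sum_j h 0 j * D2 (sp i) (sp j) p.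

(* K (t, x) is the Legendre transform of w t at grad (w t) x and e maps (t, x)
   to (t, dual_point (w t) x); M is the transposed Jacobian matrix of e. *)
Let K p : R := \sum_i p.2 0 i * D (sp i) p - W p.
Let dK l p : R :=
  \sum_i (p.2 0 i * D2 (sp i) l p + (l == sp i)%:R * D (sp i) p) - D l p.
Let e j p : R := if unlift ord0 j is Some i then D (sp i) p / K p else p.1.
Let de j l p : R := if unlift ord0 j is Some i
  then D (sp i) p * (- dK l p / K p ^+ 2) +
    D2 (sp i) l p / K p else (l == ord0)%:R.
Let M p : 'M[R]_n.+1 := \matrix_(l, j) de j l p.

Lemma family_gradE p : S p -> grad (w p.1) p.2 = \row_i D (sp i) p.
Proof.
case: p => t x Sp; have [dp _] := dW Sp; case: Sp => /= tT x0.
by have [_ ->] := cdiff_differentiable tT x0 dp.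
Qed.

Lemma family_legendre p : S p -> K p = legendre (w p.1) p.2.
Proof.
move=> Sp; rewrite /legendre family_gradE// dotE; congr (_ - _).
by apply: eq_bigr => i _; rewrite mxE.
Qed.

Lemma family_K_gt0 p : S p -> 0 < K p.
Proof. by move=> Sp; rewrite family_legendre//; case: Sp => pT p0;
  apply: legendre_gt0 => //; exact: wG. Qed.

Lemma family_W_gt0 p : S p -> 0 < W p.
Proof. by case=> pT p0; apply: gauge_gt0 => //; exact: wG. Qed.

Lemma family_dual_point p i :
  S p -> dual_point (w p.1) p.2 0 i = D (sp i) p / K p.
Proof. by move=> Sp; rewrite /dual_point -family_legendre// family_gradE// !mxE
  mulrC. Qed.

Lemma cdiff_coord p i :
  cdiff S p (fun q : P => q.2 0 i) (fun l => (l == sp i)%:R).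
Proof.
have -> : (fun q : P => q.2 0 i) = co (sp i) by apply/funext => q; rewrite coS.
exact: cdiff_co.
Qed.

Lemma cdiff_time p : cdiff S p (fun q : P => q.1) (fun l => (l == ord0)%:R).
Proof.
have -> : (fun q : P => q.1) = co ord0 by apply/funext => q; rewrite co0.
exact: cdiff_co.
Qed.

Lemma cdiff_K p : S p -> cdiff S p K (dK ^~ p).
Proof.
move=> Sp; apply: cdiffB; last exact: (dW Sp).1.
apply: cdiff_sum => i; apply: cdiff_eq.
  apply: cdiffM; last exact: (dD (sp i) Sp).1.
  exact: cdiff_coord.
by [].
Qed.

Lemma cdiff_e p j : S p -> cdiff S p (e j) (fun l => de j l p).
Proof.
move=> Sp; rewrite /e /de; case: (unlift ord0 j) => [i|].
  apply: cdiffM; first exact: (dD (sp i) Sp).1.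
  apply: cdiffV; last exact: cdiff_K.
  by rewrite gt_eqF// family_K_gt0.
exact: cdiff_time.
Qed.

Section RowAlgebra.
Variables (p : P) (h : 'I_n.+1 -> R).
Let a i := \sum_l h l * D2 (sp i) l p.
Let m := \sum_l h l * dK l p.

Lemma directional_e0 : \sum_l h l * de ord0 l p = h ord0.
Proof.
rewrite /de unlift_none (bigD1 ord0)//= mulr1 big1 ?addr0// => l /negbTE->.
by rewrite mulr0.
Qed.

Lemma directional_eS i :
  \sum_l h l * de (sp i) l p = a i / K p - D (sp i) p * m / K p ^+ 2.
Proof.
rewrite /de liftK /a /m mulr_suml mulr_sumr mulr_suml -sumrB.
by apply: eq_bigr => l _; ring.
Qed.

(** In the derivative of K = <x, grad w> - w the terms pairing the space part of h with grad w
    cancel; of the first derivatives only w_t survives. *)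
Lemma directional_K : m = \sum_i p.2 0 i * a i - h ord0 * D ord0 p.
Proof.
rewrite /m /dK; under eq_bigr do rewrite big_split/= mulrBr mulrDr.
rewrite sumrB big_split/= [X in _ + X - _](_ : _ =
  \sum_i h (sp i) * D (sp i) p).
  rewrite (big_ord_recl _ (fun l => h l * D l p)).
  rewrite [X in X + _ - _](_ : _ = \sum_i p.2 0 i * a i); last first.
    under eq_bigr do rewrite mulr_sumr.
    rewrite exchange_big; apply: eq_bigr => i _ /=; rewrite /a mulr_sumr.
    by apply: eq_bigr => l _; ring.
  ring.
under eq_bigr do rewrite mulr_sumr.
rewrite exchange_big; apply: eq_bigr => i _ /=.
rewrite (bigD1 (sp i))//= eqxx mul1r big1 ?addr0// => l /negbTE->.
by rewrite mul0r mulr0.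
Qed.

End RowAlgebra.

Lemma family_dot p : \sum_i p.2 0 i * D (sp i) p = K p + W p.
Proof. by rewrite /K subrK. Qed.

(** A kernel vector has time component 0, and its image [a] under the Hessian is (m / K) grad w.
    Pairing with x gives m = (1 + W / K) m, so m = 0 as W / K > 0. Then the Hessian annihilates the
    space part, which vanishes by positive definiteness. *)
Lemma family_M_unit p : S p -> M p \in unitmx.
Proof.
move=> Sp; have K0 := family_K_gt0 Sp; have W0 := family_W_gt0 Sp.
rewrite -row_free_unit; apply: inj_row_free => v vM.
pose h l := v 0 l.
have hE j : \sum_l h l * de j l p = 0.
  have /rowP/(_ j) := vM; rewrite !mxE => E; rewrite -[RHS]E.
  by apply: eq_bigr => l _; rewrite mxE.
have h0 : h ord0 = 0 by rewrite -(directional_e0 p h) hE.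
pose m := \sum_l h l * dK l p.
pose a i := \sum_l h l * D2 (sp i) l p.
have aE i : a i = D (sp i) p / K p * m.
  have := hE (sp i); rewrite directional_eS -/(a i) -/m => /eqP;
    rewrite subr_eq0 => /eqP E.
  have -> : a i = a i / K p * K p by rewrite divfK// gt_eqF.
  by rewrite E; field; rewrite gt_eqF.
have m0 : m = 0.
  have := directional_K p h; rewrite -/m h0 mul0r subr0.
  under eq_bigr do rewrite -/(a _) aE mulrA mulrA.
  rewrite -mulr_suml -mulr_suml family_dot => /eqP.
  have -> : (K p + W p) / K p * m = m + W p / K p * m by field; rewrite gt_eqF.
  rewrite -subr_eq0 opprD addNKr oppr_eq0 mulf_eq0 gt_eqF ?divr_gt0//=.
  by move/eqP.
have a0 i : a i = 0 by rewrite aE m0 mulr0.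
pose h' : V := \row_i h (sp i).
have h'0 : h' = 0.
  apply/eqP/negPn/negP => /(wH Sp).
  rewrite big1 ?ltxx// => i _; rewrite (_ : \sum_j _ = a i) ?a0 ?mulr0//.
  rewrite -[RHS](a0 i) /a big_ord_recl h0 mul0r add0r.
  by apply: eq_bigr => j _; rewrite mxE.
apply/rowP => l; rewrite [RHS]mxE -/(h l).
case: (unliftP ord0 l) => [i ->|-> //].
by have /rowP/(_ i) := h'0; rewrite !mxE.
Qed.

Let Z := polar_map w.

Lemma family_Z_slab p : S p -> S (Z p).
Proof. exact: polar_map_slab. Qed.

Lemma family_Z_cvg p : S p -> Z q @[q --> nb p] --> nb (Z p).
Proof.
move=> Sp; have [] := @polar_map_cvg _ _ _ w wG _ p Sp => //.
by apply/C0_slabP => q Sq; exact: cdiff_cvg (dW Sq).1.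
Qed.

Lemma family_eZ q j : S q -> e j (Z q) = co j q.
Proof.
move=> Sq; case: (unliftP ord0 j) => [i ->|->].
  rewrite /e liftK coS -family_dual_point; last exact: family_Z_slab.
  by case: Sq => qT q0; rewrite dual_pointK//; exact: wG.
by rewrite /e unlift_none co0.
Qed.

(** The derivative of coordinate l of [Z] in direction j; the indices are swapped because [M] is a
    transposed Jacobian. *)
Let dX l j p := invmx (M (Z p)) j l.

Lemma cdiff_Z p l : S p -> cdiff S p (co l \o Z) (fun j => dX l j p).
Proof.
move=> Sp; apply: (cdiff_inverse (M := M (Z p)) Sp (family_Z_cvg Sp)).
- move=> j; apply: (cdiff_eq (cdiff_e j (family_Z_slab Sp))).
  by move=> k; rewrite mxE.
- exact/family_M_unit/family_Z_slab.
- by move=> q j Sq; exact: family_eZ.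
Qed.

Lemma dX_de p j k : S p -> \sum_l dX l j p * de k l (Z p) = (j == k)%:R.
Proof.
move=> Sp; have := mulVmx (family_M_unit (family_Z_slab Sp)).
move=> /matrixP/(_ j k); rewrite !mxE => <-.
by apply: eq_bigr => l _; rewrite mxE.
Qed.

Lemma de_cvg p j l : S p -> de j l q @[q --> nb p] --> de j l p.
Proof.
move=> Sp; have K0 := family_K_gt0 Sp.
have Kc := cdiff_cvg (cdiff_K Sp).
have Dc k : D k q @[q --> nb p] --> D k p by exact: cdiff_cvg (dD k Sp).1.
have D2c k k' : D2 k k' q @[q --> nb p] --> D2 k k' p by exact: (dD k Sp).2.
have dKc : dK l q @[q --> nb p] --> dK l p.
  apply: cvgB => //; apply: cvg_sumr => i; apply: cvgD.
    by apply: cvgM => //; exact: cdiff_cvg (cdiff_coord p i).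
  by apply: cvgM => //; exact: cvg_cst.
have Ki : (K q)^-1 @[q --> nb p] --> (K p)^-1 by apply: cvgV => //;
  rewrite gt_eqF.
rewrite /de; case: (unlift ord0 j) => [i|]; last exact: cvg_cst.
apply: cvgD; apply: cvgM => //.
apply: cvgM; first exact: cvgN.
apply: cvgV; first by rewrite expf_neq0// gt_eqF.
by rewrite expr2; under eq_fun do rewrite expr2; exact: cvgM.
Qed.

Lemma dX_cvg p l j : S p -> dX l j q @[q --> nb p] --> dX l j p.
Proof.
move=> Sp; apply: cvg_invmx; last exact/family_M_unit/family_Z_slab.
move=> k m; have -> : (fun q => M (Z q) k m) = de m k \o Z.
  by apply/funext => q; rewrite mxE.
rewrite mxE; exact: (cvg_comp Z (de m k) (family_Z_cvg Sp)
  (de_cvg (family_Z_slab Sp))).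
Qed.

Let pol p := rpolar (w p.1) p.2.
Let X i p := (Z p).2 0 i.
(** Envelope principle: these are the derivatives of (<x, y> - 1) / w(t, x) in y and t with x frozen
    at the touching point. *)
Let Dv j p := if unlift ord0 j is Some i then X i p / W (Z p)
  else - (pol p * D ord0 (Z p) / W (Z p)).
(** By the chain rule, [mu] and [A] hold the derivatives of K and of the space gradient of w along
    [Z]. *)
Let mu j p := \sum_l dX l j p * dK l (Z p).
Let A i j p := \sum_l dX l j p * D2 (sp i) l (Z p).

Lemma family_polarE p : S p -> pol p = (K (Z p))^-1.
Proof.
move=> Sp; have [pT p0] := Sp.
have wp := wG pT; have Sz := family_Z_slab Sp.
by rewrite /pol rpolar_legendre// family_legendre.
Qed.

Lemma family_dualE p i : S p -> p.2 0 i = D (sp i) (Z p) / K (Z p).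
Proof. by move=> Sp; rewrite -coS -family_eZ// /e liftK. Qed.

Lemma dX0 p j : S p -> dX ord0 j p = (j == ord0)%:R.
Proof. by move=> Sp; rewrite -(dX_de j ord0 Sp) directional_e0. Qed.

(** The product rule for D_i (Z p) = y_i K (Z p), which is e (Z p) = p with its denominator
    cleared. *)
Lemma dX_D2 p i j :
  S p -> A i j p = K (Z p) * (j == sp i)%:R + p.2 0 i * mu j p.
Proof.
move=> Sp; have K0 := family_K_gt0 (family_Z_slab Sp).
rewrite -(dX_de j (sp i) Sp) directional_eS -/(A i j p) -/(mu j p)
  family_dualE//.
by field; rewrite gt_eqF.
Qed.

(* Combine the derivatives in direction j of the identities e (Z p) = p and
   K = <x, grad w> - w, using <X, y> = 1 + W / K at X = Z p. *)
Lemma dX_dK_rec p j : S p ->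
  W (Z p) / K (Z p) * mu j p =
  (j == ord0)%:R * D ord0 (Z p) - K (Z p) * \sum_i X i p * (j == sp i)%:R.
Proof.
move=> Sp; have K0 := family_K_gt0 (family_Z_slab Sp).
have := directional_K (Z p) (fun l => dX l j p); rewrite -/(mu j p) dX0//.
have -> : \sum_i (Z p).2 0 i * (\sum_l dX l j p * D2 (sp i) l (Z p)) =
   K (Z p) * (\sum_i X i p * (j == sp i)%:R) +
     (K (Z p) + W (Z p)) / K (Z p) * mu j p.
  rewrite -family_dot mulr_sumr !mulr_suml -big_split; apply: eq_bigr => i _ /=.
  rewrite -/(A i j p) dX_D2// family_dualE// -/(X i p); ring.
have -> : (K (Z p) + W (Z p)) / K (Z p) * mu j p =
  mu j p + W (Z p) / K (Z p) * mu j p by field; rewrite gt_eqF.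
lra.
Qed.

Lemma dX_dK_time p : S p -> mu ord0 p = K (Z p) * D ord0 (Z p) / W (Z p).
Proof.
move=> Sp; have K0 := family_K_gt0 (family_Z_slab Sp).
have W0 := family_W_gt0 (family_Z_slab Sp).
have := dX_dK_rec ord0 Sp; rewrite eqxx mul1r big1 ?mulr0 ?subr0 => [h|i _].
  by rewrite -h; field; rewrite !gt_eqF.
by rewrite mulr0.
Qed.

Lemma dX_dK_space p i : S p -> mu (sp i) p = - (K (Z p) ^+ 2 * X i p / W (Z p)).
Proof.
move=> Sp; have K0 := family_K_gt0 (family_Z_slab Sp).
have W0 := family_W_gt0 (family_Z_slab Sp).
have := dX_dK_rec (sp i) Sp; rewrite mul0r sub0r (bigD1 i)//= eqxx mulr1 big1
  ?addr0 => [h|k ki].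
  have -> : mu (sp i) p = K (Z p) / W (Z p) * (W (Z p) / K (Z p) * mu (sp i) p).
    by field; rewrite !gt_eqF.
  by rewrite h; field; rewrite gt_eqF.
by rewrite (inj_eq lift_inj) eq_sym (negbTE ki) mulr0.
Qed.

(** Differentiate v = 1 / K(Z). The second derivatives of w enter only through [mu], whose values in
    closed form are free of them. *)
Lemma cdiff_polar p : S p -> cdiff S p pol (Dv ^~ p).
Proof.
move=> Sp; have Sz := family_Z_slab Sp.
have K0 := family_K_gt0 Sz; have W0 := family_W_gt0 Sz.
apply: (@cdiff_ext _ _ S p (fun q => (K (Z q))^-1)) => //.
  by move=> q; rewrite inE => Sq; rewrite family_polarE.
have h := cdiff_comp (family_Z_cvg Sp) (cdiff_K Sz) (fun l => cdiff_Z l Sp).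
apply: (cdiff_eq (cdiffV _ h)) => [|j]; first by rewrite /= gt_eqF.
have -> : \sum_l dK l (Z p) * dX l j p = mu j p.
  by apply: eq_bigr => l _; rewrite mulrC.
rewrite /Dv; case: (unliftP ord0 j) => [i ->|->] /=.
  by rewrite dX_dK_space//; field; rewrite !gt_eqF.
by rewrite dX_dK_time// family_polarE//; field; rewrite !gt_eqF.
Qed.

Lemma grad_on_Z l : grad_on S (co l \o Z) (dX l).
Proof. by move=> p Sp; split; [exact: cdiff_Z|move=> j; exact: dX_cvg]. Qed.

Lemma C1on_compZ F : C1on S F -> C1on S (F \o Z).
Proof.
exact: C1on_comp family_Z_slab family_Z_cvg grad_on_Z.
Qed.

Lemma polar_point_coE i : X i = co (sp i) \o Z.
Proof. by apply/funext => q; rewrite /= coS. Qed.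

Lemma grad_on_polar : grad_on S pol Dv.
Proof.
move=> p Sp; split; first exact: cdiff_polar.
have Sz := family_Z_slab Sp; have W0 := family_W_gt0 Sz.
have Wc := cvg_comp Z W (family_Z_cvg Sp) (cdiff_cvg (dW Sz).1).
have Dc l := cvg_comp Z (D l) (family_Z_cvg Sp) ((dW Sz).2 l).
have vc := cdiff_cvg (cdiff_polar Sp).
have Wi : (W (Z q))^-1 @[q --> nb p] --> (W (Z p))^-1.
  by apply: cvgV => //; rewrite gt_eqF.
move=> j; rewrite /Dv; case: (unlift ord0 j) => [i|].
  apply: cvgM => //; rewrite polar_point_coE; exact: cdiff_cvg (cdiff_Z _ Sp).
apply: cvgN; apply: cvgM => //; apply: cvgM; first exact: vc.
exact: Dc.
Qed.

(** The components of [Dv] are built from the touching point, v, w and w_t along [Z], each of which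
    is C^1. This is what makes the polars C^2. *)
Lemma C1on_grad_polar j : C1on S (Dv j).
Proof.
have CW : C1on S (fun p => (W (Z p))^-1).
  apply: C1onV => [p Sp|]; first by rewrite gt_eqF//
    (family_W_gt0 (family_Z_slab Sp)).
  by apply: (@C1on_compZ W); exists D.
rewrite /Dv; case: (unlift ord0 j) => [i|].
  by apply: C1onM => //; rewrite polar_point_coE; eexists; exact: grad_on_Z.
apply: C1onN; apply: C1onM => //; apply: C1onM; first by exists Dv;
  exact: grad_on_polar.
by apply: (@C1on_compZ (D ord0)); exists (D2 ord0).
Qed.

Lemma cdiff_unique p F d d' : S p -> cdiff S p F d -> cdiff S p F d' -> d =1 d'.
Proof.
move=> Sp; have -> : F = (fun q => F (q.1, q.2)) by apply/funext => -[].
move=> dF d'F j.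
rewrite (@cdiff_slab_partial _ _ _ T0 (fun t x => F (t, x)) _ _ Sp dF).
by rewrite (@cdiff_slab_partial _ _ _ T0 (fun t x => F (t, x)) _ _ Sp d'F).
Qed.

Let omega j p := \sum_l D l (Z p) * dX l j p.

Lemma cdiff_W_Z p : S p -> cdiff S p (fun q => W (Z q)) (omega ^~ p).
Proof.
move=> Sp.
exact: (cdiff_comp (family_Z_cvg Sp) (dW (family_Z_slab Sp)).1 (fun l
  => cdiff_Z l Sp)).
Qed.

Lemma cdiff_grad_polar p i : S p -> cdiff S p (Dv (sp i))
  (fun j => dX (sp i) j p / W (Z p) - X i p * omega j p / W (Z p) ^+ 2).
Proof.
move=> Sp; have W0 := family_W_gt0 (family_Z_slab Sp).
have -> : Dv (sp i) = (fun q => X i q * (W (Z q))^-1).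
  by apply/funext => q; rewrite /Dv liftK.
have dXi : cdiff S p (X i) (fun j => dX (sp i) j p) by rewrite polar_point_coE;
  exact: cdiff_Z.
apply: (cdiff_eq (cdiffM dXi (cdiffV _ (cdiff_W_Z Sp)))) => [|j].
  by rewrite gt_eqF.
by rewrite /=; field; rewrite gt_eqF.
Qed.

(** Let xi be the derivative of the touching point in direction h. The Hessian form of the polar at
    h equals the Hessian form of w at xi divided by K W, and xi != 0. *)
Lemma polar_hess_gt0 p (h : V) (D2v : 'I_n.+1 -> 'I_n.+1 -> R) :
  S p -> h != 0 ->
  (forall j, cdiff S p (Dv j) (D2v j)) ->
  0 < \sum_i h 0 i * \sum_j h 0 j * D2v (sp i) (sp j).
Proof.
move=> Sp h0 dv; have Sz := family_Z_slab Sp.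
have K0 := family_K_gt0 Sz; have W0 := family_W_gt0 Sz.
pose xi l := \sum_j h 0 j * dX l (sp j) p.
have xi0 : xi ord0 = 0.
  by rewrite /xi big1// => j _; rewrite dX0// mulr0.
have [hX hXE] : exists r, r = \sum_i h 0 i * X i p by eexists.
pose yx := \sum_i p.2 0 i * xi (sp i).
pose hx := \sum_i h 0 i * xi (sp i).
have omegaE : \sum_j h 0 j * omega (sp j) p = K (Z p) * yx.
  rewrite /omega; under eq_bigr do rewrite mulr_sumr.
  rewrite exchange_big big_ord_recl /= big1 ?add0r => [|j _]; last first.
    by rewrite dX0// !mulr0.
  rewrite /yx mulr_sumr; apply: eq_bigr => i _.
  rewrite family_dualE// /xi mulrA mulrC mulr_suml.
  have -> : K (Z p) * (D (sp i) (Z p) / K (Z p)) = D (sp i) (Z p) by field;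
    rewrite gt_eqF.
  by apply: eq_bigr => j _; ring.
have aE i : \sum_j xi (sp j) * D2 (sp i) (sp j) (Z p) =
    K (Z p) * h 0 i - p.2 0 i * (K (Z p) ^+ 2 * hX / W (Z p)).
  have -> : \sum_j xi (sp j) * D2 (sp i) (sp j) (Z p) =
    \sum_j h 0 j * A i (sp j) p.
    rewrite /A; under [RHS]eq_bigr do rewrite mulr_sumr.
    rewrite [RHS]exchange_big big_ord_recl /= [X in _ = X + _]big1 ?add0r
      => [|j _]; last first.
      by rewrite dX0// mul0r mulr0.
    apply: eq_bigr => j _; rewrite /xi mulr_suml.
    by apply: eq_bigr => k _; ring.
  under eq_bigr do rewrite dX_D2// dX_dK_space//.
  rewrite hXE mulr_sumr mulr_suml mulr_sumr.
  have -> : K (Z p) * h 0 i = \sum_j h 0 j * (K (Z p) * (sp j == sp i)%:R).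
    rewrite (bigD1 i)//= eqxx big1 ?addr0 => [|j ji];
      first by rewrite mulr1 mulrC.
    by rewrite (inj_eq lift_inj) (negbTE ji) !mulr0.
  by rewrite -sumrB; apply: eq_bigr => j _; ring.
(* Multiplying xi by the Jacobian of [e] gives back h, so xi = 0 would force h = 0. *)
have xiN0 : \row_i xi (sp i) != 0 :> V.
  apply: contra_neq h0 => x0; apply/rowP => i; rewrite mxE.
  have xz l : xi l = 0.
    case: (unliftP ord0 l) => [k ->|-> //].
    by have /rowP/(_ k) := x0; rewrite !mxE.
  have : \sum_l xi l * de (sp i) l (Z p) = h 0 i.
    rewrite /xi; under eq_bigr do rewrite mulr_suml.
    rewrite exchange_big /= (bigD1 i)//= [X in _ + X]big1 ?addr0 => [|j ji].
      rewrite -[RHS]mulr1 -[X in _ * X](_ : (sp i == sp i)%:R = 1);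
        last by rewrite eqxx.
      rewrite -(dX_de (sp i) (sp i) Sp) mulr_sumr.
      by apply: eq_bigr => l _; rewrite mulrA.
    transitivity (h 0 j * (sp j == sp i)%:R).
      rewrite -(dX_de (sp j) (sp i) Sp) mulr_sumr.
      by apply: eq_bigr => l _; rewrite mulrA.
    by rewrite (inj_eq lift_inj) (negbTE ji) mulr0.
  by move=> <-; rewrite big1// => l _; rewrite xz mul0r.
have := wH Sz xiN0.
have -> : \sum_i (\row_i xi (sp i)) 0 i * (\sum_j (\row_i xi (sp i)) 0 j *
    D2 (sp i) (sp j) (Z p)) = K (Z p) * hx - K (Z p) ^+ 2 * hX * yx / W (Z p).
  rewrite /hx /yx !mulr_sumr mulr_suml -sumrB; apply: eq_bigr => i _;
    rewrite mxE.
  under eq_bigr do rewrite mxE.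
  by rewrite aE; ring.
have -> : \sum_i h 0 i * (\sum_j h 0 j * D2v (sp i) (sp j)) =
    hx / W (Z p) - hX * (K (Z p) * yx) / W (Z p) ^+ 2.
  rewrite -omegaE /hx hXE !mulr_suml -sumrB; apply: eq_bigr => i _.
  have -> : \sum_j h 0 j * D2v (sp i) (sp j) =
      xi (sp i) / W (Z p) - X i p * (\sum_j h 0 j * omega (sp j) p) / W (Z p)
        ^+ 2.
    rewrite /xi mulr_suml mulr_sumr mulr_suml -sumrB; apply: eq_bigr => j _.
    by rewrite (cdiff_unique Sp (dv _) (cdiff_grad_polar i Sp)); ring.
  ring.
move=> h1.
have -> : hx / W (Z p) - hX * (K (Z p) * yx) / W (Z p) ^+ 2 =
  (K (Z p) * hx - K (Z p) ^+ 2 * hX * yx / W (Z p)) / (K (Z p) * W (Z p)).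
  by field; rewrite !gt_eqF.
by rewrite divr_gt0// mulr_gt0.
Qed.

(* With H the Hessian and g = grad (w_t / w) at Z p, the time derivative xd of
   the touching point solves xd H = - w g. *)
Lemma polar_second_time_derivative p d : S p -> cdiff S p (Dv ord0) d ->
  (forall i, D2 ord0 (sp i) (Z p) = D2 (sp i) ord0 (Z p)) ->
  d ord0 = pol p * W (Z p) *
    ((- D2 ord0 ord0 (Z p) / W (Z p) ^+ 2 +
      D ord0 (Z p) ^+ 2 *+ 2 / W (Z p) ^+ 3)
     + quad (invmx (\matrix_(l < n, i < n) D2 (sp i) (sp l) (Z p)))
        (\row_(i < n) ((D2 ord0 (sp i) (Z p) * W (Z p) -
          D ord0 (Z p) * D (sp i) (Z p))
                 / W (Z p) ^+ 2))).
Proof.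
move=> Sp dv sym; have Sz := family_Z_slab Sp.
have K0 := family_K_gt0 Sz; have W0 := family_W_gt0 Sz.
set H := \matrix_(l, i) _; set g := \row_i _.
have Hu : H \in unitmx.
  rewrite -row_free_unit; apply: inj_row_free => v vH.
  apply/eqP/negPn/negP => /(wH Sz); rewrite big1 ?ltxx// => i _.
  have /rowP/(_ i) := vH; rewrite !mxE => E.
  rewrite [X in _ * X](_ : _ = 0) ?mulr0// -[RHS]E.
  by apply: eq_bigr => l _; rewrite mxE.
pose xd : V := \row_l dX (sp l) ord0 p.
have xdH : xd *m H = - W (Z p) *: g.
  have WN : W (Z p) != 0 by rewrite gt_eqF.
  have KN : K (Z p) != 0 by rewrite gt_eqF.
  apply/rowP => i; rewrite !mxE.
  have E : D2 (sp i) ord0 (Z p) + \sum_k dX (sp k) ord0 p * D2 (sp i) (sp k)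
    (Z p)
      = D (sp i) (Z p) / K (Z p) * (K (Z p) * D ord0 (Z p) / W (Z p)).
    have := dX_D2 i ord0 Sp; rewrite /A big_ord_recl dX0// eqxx mul1r
      dX_dK_time// family_dualE// => ->.
    by rewrite mulr0 add0r.
  under eq_bigr do rewrite !mxE.
  move/eqP: E; rewrite eq_sym addrC -subr_eq => /eqP <-.
  by rewrite sym; field; rewrite KN WN.
have gE : g *m invmx H = - (W (Z p))^-1 *: xd.
  have -> : g = - (W (Z p))^-1 *: (xd *m H).
    by rewrite xdH scalerA mulrNN mulVf ?scale1r// gt_eqF.
  by rewrite -scalemxAl mulmxK.
pose a := \sum_i D2 ord0 (sp i) (Z p) * dX (sp i) ord0 p.
pose b := \sum_i D (sp i) (Z p) * dX (sp i) ord0 p.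
have dg : dot xd g = (a * W (Z p) - D ord0 (Z p) * b) / W (Z p) ^+ 2.
  rewrite dotE /a /b mulr_suml mulr_sumr -sumrB mulr_suml;
    apply: eq_bigr => i _.
  by rewrite !mxE; ring.
(* Since xd H = - w g, the form of the inverse Hessian at g is - <xd, g> / w. *)
rewrite /quad gE dotZl dg.
have dD0Z : cdiff S p (fun q => D ord0 (Z q)) (fun j
  => \sum_l D2 ord0 l (Z p) * dX l j p).
  exact: (cdiff_comp (family_Z_cvg Sp) (dD ord0 Sz).1 (fun l => cdiff_Z l Sp)).
have Dv0 : Dv ord0 = (fun q => - (pol q * D ord0 (Z q) * (W (Z q))^-1)).
  by apply/funext => q; rewrite /Dv unlift_none.
rewrite Dv0 in dv.
have WN : W (Z p) != 0 by rewrite gt_eqF.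
(* Differentiate v_t = - v w_t / w in time along the touching point; [a] and [b] collect the terms
   in its velocity [xd]. *)
have := cdiffN (cdiffM (cdiffM (cdiff_polar Sp) dD0Z)
  (cdiffV WN (cdiff_W_Z Sp))).
move=> /(cdiff_unique Sp dv) ->.
rewrite /omega !big_ord_recl dX0// eqxx mulr1 -/a -/b !mulr1 /Dv unlift_none.
by field.
Qed.

End PolarCalculus.

(** * From the slab definitions to explicit derivative data *)

Section Translation.
Context {R : realType} {n : nat} {T : R}.
Hypothesis T0 : 0 < T.
Local Notation V := 'rV[R]_n.
Local Notation P := (R * V)%type.
Local Notation S := (slab T : set P).
Local Notation nb p := (within S (nbhs p)).
Local Notation sp i := (lift ord0 i).
Implicit Types (t s : R) (x y : V) (p q : P) (u w : R -> V -> R).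

Lemma row_cvg {I : Type} (F : set_system I) {FF : Filter F} (f : I -> V) (l :
  V) :
  (forall i, f t 0 i @[t --> F] --> l 0 i) -> f @ F --> l.
Proof.
move=> fl; apply/cvgrPdist_le => e e0.
have h : \forall t \near F, forall i, `|l 0 i - f t 0 i| <= e.
  by apply: filter_forall => i; move/cvgrPdist_le : (fl i); apply.
near=> t; apply: normr_rowP; first exact: ltW.
by move=> i; rewrite !mxE; move: i; near: t.
Unshelve. all: by end_near. Qed.

Lemma grad_on_C1_off0 u D t : grad_on S (fun p => u p.1 p.2) D -> 0 <= t <= T ->
  C1_off0 (u t).
Proof.
move=> uD tT x x0.
have gE y : y != 0 -> grad (u t) y = \row_i D (sp i) (t, y).
  move=> y0; have [dy _] := uD (t, y) (conj tT y0).
  by have [_ ->] := cdiff_differentiable tT y0 dy.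
have [dx Dc] := uD (t, x) (conj tT x0).
split; first by have [] := cdiff_differentiable tT x0 dx.
have h : (\row_i D (sp i) (t, y)) @[y --> x] --> (\row_i D (sp i) (t, x) : V).
  apply: (@row_cvg _ (nbhs x)) => i; rewrite mxE; under eq_fun do rewrite mxE.
  exact: (cvg_comp _ (D (sp i)) (space_slice_cvg tT x0) (Dc (sp i))).
suff : grad (u t) y @[y --> x] --> grad (u t) x by [].
rewrite gE//; apply: cvg_trans h; apply: (@near_eq_cvg _ _ (nbhs x)).
near=> y; rewrite gE//; near: y; exact: near_neq0.
Unshelve. all: by end_near. Qed.

Definition C2_data u (D : 'I_n.+1 -> P -> R) (D2 : 'I_n.+1 -> 'I_n.+1 -> P ->
  R) :=
  grad_on S (fun p => u p.1 p.2) D /\ forall l, grad_on S (D l) (D2 l).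

Lemma C2_slab_data u : C2_slab T u -> exists D D2, C2_data u D D2.
Proof.
move=> [u1 ut ux]; exists (slab_partial (T := T) u).
exists (fun l => slab_partial (T := T) (fun t x
  => slab_partial (T := T) u l (t, x))).
split; first exact: C1_slab_grad_on.
move=> l; have h : C1_slab T (fun t x => slab_partial (T := T) u l (t, x)).
  case: (unliftP ord0 l) => [i ->|->].
    by under [X in C1_slab _ X]eq_fun do under eq_fun do rewrite slab_partialS;
      exact: ux.
  by under [X in C1_slab _ X]eq_fun do under eq_fun do rewrite slab_partial0.
apply: (grad_on_ext (F := fun p => slab_partial (T := T) u l (p.1, p.2))).
  by move=> p _; rewrite -surjective_pairing.
exact: C1_slab_grad_on h.
Qed.

Section Data.
Variables (u : R -> V -> R) (D : 'I_n.+1 -> P -> R)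
  (D2 : 'I_n.+1 -> 'I_n.+1 -> P -> R).
Hypothesis uD : C2_data u D D2.

Lemma data_dt t x : S (t, x) -> dt T u t x = D ord0 (t, x).
Proof. by move=> Sp; rewrite (grad_on_slab_partial T0 uD.1)// slab_partial0.
  Qed.

Lemma data_partial i t x : S (t, x) -> partial i (u t) x = D (sp i) (t, x).
Proof. by move=> Sp; rewrite (grad_on_slab_partial T0 uD.1)// slab_partialS.
  Qed.

Lemma data_grad_on_dt : grad_on S (fun p => dt T u p.1 p.2) (D2 ord0).
Proof.
apply: grad_on_ext (uD.2 ord0) => -[t x]; rewrite inE => Sp.
by rewrite data_dt.
Qed.

Lemma data_grad_on_partial i :
  grad_on S (fun p => partial i (u p.1) p.2) (D2 (sp i)).
Proof.
apply: grad_on_ext (uD.2 (sp i)) => -[t x]; rewrite inE => Sp.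
by rewrite data_partial.
Qed.

Lemma data_C2_slab : C2_slab T u.
Proof.
split; first exact: (grad_on_C1_slab T0 uD.1).
  exact: (grad_on_C1_slab T0 data_grad_on_dt).
by move=> i; exact: (grad_on_C1_slab T0 (u := fun t
  => partial i (u t)) (data_grad_on_partial i)).
Qed.

Lemma data_C2_off0 t : 0 <= t <= T -> C2_off0 (u t).
Proof.
move=> tT; split; first exact: grad_on_C1_off0 uD.1 tT.
by move=> i; exact: (grad_on_C1_off0 (u := fun t
  => partial i (u t)) (data_grad_on_partial i) tT).
Qed.

(** [hess] differentiates in j first and then in i, while [D2] lists the earlier derivative first;
    hence the swap. *)
Lemma data_hess t x i j :
  S (t, x) -> hess (u t) x i j = D2 (sp j) (sp i) (t, x).
Proof.
move=> Sp; rewrite mxE.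
by rewrite (grad_on_slab_partial T0 (u := fun t
  => partial j (u t)) (data_grad_on_partial j) _ Sp) slab_partialS.
Qed.

Lemma data_posdef t x : S (t, x) ->
  posdef (hess (u t) x) <-> forall h : V, h != 0 ->
    0 < \sum_i h 0 i * \sum_j h 0 j * D2 (sp i) (sp j) (t, x).
Proof.
move=> Sp.
have E h : quad (hess (u t) x) h = \sum_i h 0 i * \sum_j h 0 j * D2 (sp i)
  (sp j) (t, x).
  rewrite /quad dotE; apply: eq_bigr => i _; rewrite mxE mulrC; congr (_ * _).
  by apply: eq_bigr => j _; rewrite data_hess.
by split=> h v v0; have := h v v0; rewrite E.
Qed.

(** The equation contains the space gradient of w_t, whereas the motion of the touching point
    produces the time derivative of grad w. *)
Lemma data_schwarz i p : S p -> D2 ord0 (sp i) p = D2 (sp i) ord0 p.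
Proof.
move=> Sp; apply: (@mixed_partials _ _ _ T0 u (D ord0) (D (sp i)) i p
  (D2 ord0 ^~ p) (D2 (sp i) ^~ p) Sp).
- move=> t x [/= tT x0]; have [d _] := uD.1 (t, x) (conj tT x0).
  exact: (cdiff_slope tT x0 d).
- move=> t x Stx; have [/= tT x0] := Stx; have [d _] := uD.1 (t, x) Stx.
  have [df _] := cdiff_differentiable tT x0 d.
  by rewrite -data_partial//; apply/derivableP; exact: diff_derivable.
- exact: (uD.2 ord0 _ Sp).1.
- exact: (uD.2 (sp i) _ Sp).1.
Qed.

(* The left-hand side of the equation, with the quotients differentiated. *)
Definition pde_lhs p : R := - D2 ord0 ord0 p / u p.1 p.2 ^+ 2
  + D ord0 p ^+ 2 *+ 2 / u p.1 p.2 ^+ 3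
  + quad (invmx (\matrix_(l < n, i < n) D2 (sp i) (sp l) p))
     (\row_(i < n) ((D2 ord0 (sp i) p * u p.1 p.2 -
       D ord0 p * D (sp i) p) / u p.1 p.2 ^+ 2)).

Hypothesis u0 : forall p, S p -> u p.1 p.2 != 0.

Lemma data_pde : pde T u <-> forall p, S p -> pde_lhs p = 0.
Proof.
have E t x : S (t, x) ->
    dt T (dt T (fun s y => (u s y)^-1)) t x
    + quad (invmx (hess (u t) x)) (grad (fun y => dt T u t y / u t y) x) =
        pde_lhs (t, x).
  move=> Sp; have [/= tT x0] := Sp.
  have uN := u0 Sp.
  have dG p : S p -> cdiff S p (fun p => (u p.1 p.2)^-1) (fun j => -
    D j p / u p.1 p.2 ^+ 2).
    by move=> Sp'; apply: cdiffV; [exact: u0|exact: (uD.1 _ Sp').1].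
  have E1 : dt T (dt T (fun s y => (u s y)^-1)) t x =
      - D2 ord0 ord0 (t, x) / u t x ^+ 2 + D ord0 (t, x) ^+ 2 *+ 2 / u t x ^+ 3.
    have dtG : {in S, (fun p => - D ord0 p / u p.1 p.2 ^+ 2) =1
        (fun p => dt T (fun s y => (u s y)^-1) p.1 p.2)}.
      move=> p; rewrite inE => Sp'.
      by rewrite (cdiff_slab_partial T0 (u := fun s y
        => (u s y)^-1) Sp' (dG p Sp') ord0) slab_partial0.
    have h : cdiff S (t, x) (fun p => - D ord0 p *
      ((u p.1 p.2)^-1 * (u p.1 p.2)^-1))
       (fun j => - D ord0 (t, x) * ((u t x)^-1 * (- D j (t, x) / u t x ^+ 2) +
           (- D j (t, x) / u t x ^+ 2) * (u t x)^-1) +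
           - D2 ord0 j (t, x) * ((u t x)^-1 * (u t x)^-1)).
      apply: cdiffM; first by apply: cdiffN; exact: (uD.2 ord0 _ Sp).1.
      by apply: cdiffM; exact: dG.
    have h' : cdiff S (t, x) (fun p => dt T (fun s y => (u s y)^-1) p.1 p.2)
       (fun j => - D ord0 (t, x) * ((u t x)^-1 * (- D j (t, x) / u t x ^+ 2) +
           (- D j (t, x) / u t x ^+ 2) * (u t x)^-1) +
           - D2 ord0 j (t, x) * ((u t x)^-1 * (u t x)^-1)).
      apply: cdiff_ext h => // p pS; rewrite -dtG// expr2 invfM //.
    have := cdiff_slab_partial T0 Sp h' ord0; rewrite slab_partial0 => <-.
    by move: uN => /= uN; field.
  have E2 : hess (u t) x = \matrix_(l < n, i < n) D2 (sp i) (sp l) (t, x).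
    by apply/matrixP => i j; rewrite data_hess// mxE.
  have E3 : grad (fun y => dt T u t y / u t y) x = \row_(i < n)
      ((D2 ord0 (sp i) (t, x) * u t x - D ord0 (t, x) * D (sp i) (t, x)) / u t
        x ^+ 2).
    have h : cdiff S (t, x) (fun p => dt T u p.1 p.2 * (u p.1 p.2)^-1)
       (fun j => dt T u t x * (- D j (t, x) / u t x ^+ 2) +
         D2 ord0 j (t, x) * (u t x)^-1).
      by apply: cdiffM; [exact: (data_grad_on_dt Sp).1|exact: dG].
    have [_ ->] := cdiff_differentiable (u := fun t y
      => dt T u t y / u t y) tT x0 h.
    apply/rowP => i; rewrite !mxE data_dt//=.
    by move: uN => /= uN; field.
  by rewrite E1 E2 E3.
split=> h; first by move=> [t x] Sp; rewrite -E//; case: Sp => /=; exact: h.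
by move=> t x tT x0; rewrite E//; apply: h.
Qed.

End Data.

End Translation.

(** * The equation as affinity of the polars *)

Section SmoothFamily.
Context {R : realType} {n : nat} {T : R}.
Hypothesis T0 : 0 < T.
Local Notation V := 'rV[R]_n.
Local Notation P := (R * V)%type.
Local Notation S := (slab T : set P).
Local Notation sp i := (lift ord0 i).
Implicit Types (t s : R) (x y : V) (p q : P) (u w : R -> V -> R).

Definition smooth_family w : Prop :=
  [/\ forall t, 0 <= t <= T -> gauge (w t), C2_slab T w
    & forall t x, 0 <= t <= T -> x != 0 -> posdef (hess (w t) x)].

Lemma smooth_family_class w : smooth_family w <-> C2_slab T w /\
  forall t, 0 <= t <= T ->
    class_S2 (EFin \o w t) /\ nonlinear_at_infinity (EFin \o w t).
Proof.
split=> [[wG wC wH]|[wC wS]].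
  split => // t tT; have [D [D2 wD]] := C2_slab_data wC.
  have [S1 nl] := (gauge_class (w t)).1 (wG t tT); split => //; split => //.
    exact: data_C2_off0 wD _ tT.
  by move=> x x0; exact: wH.
split => // [t tT|t x tT x0]; have [[S1 _ H] nl] := wS t tT.
  by apply/gauge_class.
exact: H.
Qed.

Lemma smooth_family_data w : smooth_family w -> exists D D2,
  C2_data (T := T) w D D2 /\ forall p, S p -> forall h : V, h != 0 ->
    0 < \sum_i h 0 i * \sum_j h 0 j * D2 (sp i) (sp j) p.
Proof.
move=> [wG wC wH]; have [D [D2 wD]] := C2_slab_data wC.
exists D, D2; split => // -[t x] Sp; apply/(data_posdef T0 wD Sp).
by case: Sp => /= tT x0; exact: wH.
Qed.

Lemma data_smooth_family w D D2 : (forall t, 0 <= t <= T -> gauge (w t)) ->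
  C2_data (T := T) w D D2 -> (forall p, S p -> forall h : V, h != 0 ->
    0 < \sum_i h 0 i * \sum_j h 0 j * D2 (sp i) (sp j) p) -> smooth_family w.
Proof.
move=> wG wD wH; split => //; first exact: data_C2_slab wD.
by move=> t x tT x0; apply/(data_posdef T0 wD (conj tT x0 : S (t, x)));
  exact: wH.
Qed.

Lemma slope_affine (g : R -> R) (a b l s : R) : 0 <= s <= T ->
  (forall r, 0 <= r <= T -> g r = a + b * r) ->
  slope g s r @[r --> within `[0, T] s^'] --> l -> l = b.
Proof.
move=> sT gE gl; have PF := time_dnbhs_proper T0 sT.
have gb : slope g s r @[r --> within `[0, T] s^'] --> b.
  have h : b @[r --> within `[0, T] s^'] --> b by exact: cvg_cst.
  apply: cvg_trans h; apply: near_eq_cvg.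
  suff : \forall r \near s, r != s -> `[0, T]%classic r ->
    b = slope g s r by [].
  near=> r => rs; rewrite /= in_itv/= => rT.
  by rewrite /slope !gE//; field; rewrite subr_eq0.
exact: (cvg_unique _ gl gb).
Unshelve. all: by end_near. Qed.

Section Polar.
Variable w : R -> V -> R.
Hypothesis wF : smooth_family w.

Lemma smooth_family_polar_data D D2 : C2_data (T := T) w D D2 ->
  exists Dv D2v, [/\ C2_data (T := T) (fun t => rpolar (w t)) Dv D2v,
    forall p, S p -> forall h : V, h != 0 ->
      0 < \sum_i h 0 i * \sum_j h 0 j * D2v (sp i) (sp j) p
    & forall p, S p -> D2v ord0 ord0 p = rpolar (w p.1) p.2 *
        w (polar_map w p).1 (polar_map w p).2 * pde_lhs w D D2 (polar_map w p)].
Proof.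
move=> wD; have [wG wC wH0] := wF; have [dW dD] := wD.
have wH p : S p -> forall h : V, h != 0 ->
    0 < \sum_i h 0 i * \sum_j h 0 j * D2 (sp i) (sp j) p.
  by case: p => t x Sp; apply/(data_posdef T0 wD Sp); case: Sp => /=;
    exact: wH0.
have gv := grad_on_polar wG dW dD wH.
have Cv := C1on_grad_polar wG dW dD wH.
set Dv := (X in grad_on _ _ X) in gv.
have /choice[D2v hD2v] : forall j, exists D2v, grad_on S (Dv j) D2v by
  exact: Cv.
exists Dv, D2v; split => //.
- move=> p Sp h h0; apply: (polar_hess_gt0 T0 wG dW dD wH (D2v := fun j l
    => D2v j l p) Sp h0).
  by move=> j; exact: (hD2v j p Sp).1.
- move=> p Sp; have Sz := polar_map_slab wG Sp.
  apply: (polar_second_time_derivative T0 wG dW dD wH Sp (hD2v ord0 p Sp).1)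
    => i.
  exact: (data_schwarz T0 wD i Sz).
Qed.

Lemma smooth_family_polar : smooth_family (fun t => rpolar (w t)).
Proof.
have [D [D2 [wD _]]] := smooth_family_data wF.
have [Dv [D2v [vD vH _]]] := smooth_family_polar_data wD.
apply: (data_smooth_family _ vD vH) => t tT; have [wG _ _] := wF.
by apply: gauge_rpolar; [exact: wG|exact: (data_C2_off0 T0 vD tT).1].
Qed.

Lemma smooth_family_gt0 p : S p -> 0 < w p.1 p.2.
Proof. by case=> pT p0; apply: gauge_gt0 => //; have [wG _ _] := wF;
  exact: wG. Qed.

(** At fixed y the second time derivative of the polar vanishes. Two applications of the mean value
    theorem on [0, T] make the polar affine, and t = T determines the slope. *)
Lemma pde_polar_affine : pde T w -> forall t y, 0 <= t <= T ->
  rpolar (w t) y = (1 - t / T) * rpolar (w 0) y + t / T * rpolar (w T) y.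
Proof.
move=> wpde t y tT; have [D [D2 [wD _]]] := smooth_family_data wF.
have wN p : S p -> w p.1 p.2 != 0 by move=> Sp;
  rewrite gt_eqF// smooth_family_gt0.
have /(data_pde T0 wD wN) lhs0 := wpde.
have [Dv [D2v [[vD v2D] _ vtt]]] := smooth_family_polar_data wD.
have [wG _ _] := wF.
have [->|y0] := eqVneq y 0; first by rewrite !rpolar0 ?mulr0 ?addr0.
have h1 s : 0 <= s <= T -> slope (fun s => rpolar (w s) y) s r
  @[r --> within `[0, T] s^'] --> Dv ord0 (s, y).
  by move=> sT; exact: (cdiff_slope (u := fun t
    => rpolar (w t)) sT y0 (vD (s, y) (conj sT y0)).1).
have h2 s : 0 <= s <= T -> slope (fun s => Dv ord0 (s, y)) s r
  @[r --> within `[0, T] s^'] --> (0 : R).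
  move=> sT; have Ss : S (s, y) by split.
  have E0 : D2v ord0 ord0 (s, y) = 0.
    by rewrite vtt// lhs0 ?mulr0//; exact: polar_map_slab.
  have := (v2D ord0 (s, y) Ss).1.
  have E : Dv ord0 = (fun p => Dv ord0 (p.1, p.2)) by apply/funext => -[].
  rewrite {1}E => h.
  have := cdiff_slope (u := fun t x => Dv ord0 (t, x)) sT y0 h.
  by rewrite E0.
have T0T : 0 <= (0 : R) <= T by rewrite lexx ltW.
have TT : 0 <= T <= T by rewrite lexx ltW.
have const s : 0 <= s <= T -> Dv ord0 (s, y) = Dv ord0 (0, y).
  move=> sT; have [c [_ _ /eqP]] := MVT_within h2 T0T sT.
  by rewrite mul0r subr_eq0 => /eqP.
have aff s : 0 <= s <= T -> rpolar (w s) y = rpolar (w 0) y +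
  Dv ord0 (0, y) * s.
  move=> sT; have [c [cT _]] := MVT_within h1 T0T sT.
  by rewrite (const c cT) subr0 => <-; rewrite addrC subrK.
rewrite (aff t tT) (aff T TT).
by field; rewrite gt_eqF.
Qed.

(** Every (t, x) in the slab is the touching point of y = dual_point (w t) x. There v_tt = 0 is the
    left-hand side of the equation times the positive factor v w. *)
Lemma polar_affine_pde (a b : V -> R) : (forall t y, 0 <= t <= T ->
  rpolar (w t) y = (1 - t / T) * a y + t / T * b y) -> pde T w.
Proof.
move=> aff; have [D [D2 [wD _]]] := smooth_family_data wF.
have wN p : S p -> w p.1 p.2 != 0 by move=> Sp;
  rewrite gt_eqF// smooth_family_gt0.
have [Dv [D2v [[vD v2D] _ vtt]]] := smooth_family_polar_data wD.
have [wG _ _] := wF.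
apply/(data_pde T0 wD wN) => -[t x] Sz; have [/= tT x0] := Sz.
have wt := wG t tT.
pose y := dual_point (w t) x.
have y0 : y != 0 by exact: dual_point_neq0.
have Sp : S (t, y) by split.
have zE : polar_map w (t, y) = (t, x) by rewrite /polar_map /= polar_pointK.
have vlin s : 0 <= s <= T -> Dv ord0 (s, y) = (b y - a y) / T.
  move=> sT; apply: (slope_affine (g := fun s => rpolar (w s) y) (a := a y) sT).
    by move=> r rT; rewrite aff//; field; rewrite gt_eqF.
  exact: (cdiff_slope (u := fun t => rpolar (w t)) sT y0
    (vD (s, y) (conj sT y0)).1).
have : D2v ord0 ord0 (t, y) = 0.
  apply: (slope_affine (g := fun s => Dv ord0 (s, y)) (a :=
    (b y - a y) / T) tT).
    by move=> r rT; rewrite vlin// mul0r addr0.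
  have := (v2D ord0 (t, y) Sp).1.
  have E : Dv ord0 = (fun p => Dv ord0 (p.1, p.2)) by apply/funext => -[].
  rewrite {1}E => h.
  exact: (cdiff_slope (u := fun t x => Dv ord0 (t, x)) tT y0 h).
rewrite vtt// zE => /eqP; rewrite mulf_eq0 mulf_eq0.
rewrite (gt_eqF (rpolar_gt0 wt y0)) (gt_eqF (smooth_family_gt0 Sz)) /=.
by move/eqP.
Qed.

End Polar.

End SmoothFamily.

(** * Convex combinations of gauges *)

Section GaugeMix.
Context {R : realType} {n : nat}.
Local Notation V := 'rV[R]_n.

Lemma gauge_mix (f g : V -> R) (s : R) : 0 <= s <= 1 -> gauge f -> gauge g ->
  C1_off0 (fun x => (1 - s) * f x + s * g x) ->
  gauge (fun x => (1 - s) * f x + s * g x).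
Proof.
move=> /andP[s0 s1] fG gG dm; have s1' : 0 <= 1 - s by rewrite subr_ge0.
split => //.
- move=> x y r rI.
  have := ler_wpM2l s1' (gauge_convex fG x y rI).
  have := ler_wpM2l s0 (gauge_convex gG x y rI); lra.
- by move=> x; rewrite addr_ge0// mulr_ge0// gauge_ge0.
- by rewrite !gauge0// !mulr0 addr0.
- move=> x y xy h; have [s1E|s1N] := eqVneq s 1.
    apply: (gauge_strict gG xy) => r rI.
    by have := h r rI; rewrite s1E subrr !mul0r !add0r !mul1r.
  apply: (gauge_strict fG xy) => r rI; have hr := h r rI.
  apply/eqP; rewrite eq_le gauge_convex//=.
  have s1'' : 0 < 1 - s by rewrite subr_gt0 lt_neqAle s1N.
  rewrite -(ler_pM2l s1'').
  have := ler_wpM2l s0 (gauge_convex gG x y rI); lra.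
(* Along a ray the ratios f(t x) / t and g(t x) / t increase with t. If the combination lies between
   a t - b and a t, then (1 - s) sup f(r x) / r <= a - s g(t x) / t, so f lies between its own
   limiting slope times t and that line lowered by b / (1 - s). For s = 1 only g is left. *)
- move=> x a b x0 a0 b0 h; have [s1E|s1N] := eqVneq s 1.
    apply: (gauge_nonlinear gG x0 a0 b0) => t t0.
    by have := h t t0; rewrite s1E subrr mul0r add0r mul1r.
  have {s1'} s1' : 0 < 1 - s by rewrite subr_gt0 lt_neqAle s1N.
  have mono (k : V -> R) t r : gauge k -> 0 < t -> t <= r ->
    k (t *: x) / t <= k (r *: x) / r.
    move=> kG t0 tr; have r0 : 0 < r by exact: lt_le_trans tr.
    rewrite ler_pdivrMr//.
    have := @gauge_scale _ _ k kG (r *: x) (t / r).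
    rewrite scalerA divfK ?gt_eqF// divr_ge0 ?(ltW t0) ?(ltW r0)//=
      ler_pdivrMr// mul1r tr.
    by move=> /(_ isT)/le_trans; apply; rewrite le_eqVlt; apply/orP; left;
      apply/eqP; ring.
  pose A := [set f (t *: x) / t | t in [set t | 0 < t]].
  have key t r : 0 < t -> 0 < r -> (1 - s) * (f (r *: x) / r) <= a -
    s * (g (t *: x) / t).
    move=> t0 r0; pose m := Num.max t r.
    have m0 : 0 < m by rewrite lt_max t0.
    have h1 := ler_wpM2l (ltW s1') (mono f r m fG r0 _).
    have h2 := ler_wpM2l s0 (mono g t m gG t0 _).
    rewrite (le_trans (h1 _))// ?le_max ?lexx ?orbT// lerBrDr.
    rewrite (le_trans (lerD (lexx _) (h2 _)))// ?le_max ?lexx ?orbT//.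
    have [_ hm] := h m (ltW m0).
    by rewrite !mulrA -mulrDl ler_pdivrMr.
  have ubA : has_ubound A.
    exists (a / (1 - s)) => _ [t t0 <-]; rewrite ler_pdivlMr// mulrC.
    by rewrite (le_trans (key t t t0 t0))// gerBl mulr_ge0// divr_ge0
      ?gauge_ge0// ltW.
  have hA : has_sup A by split => //; exists (f (1 *: x) / 1); exists 1;
    [exact: ltr01|].
  have supA t : 0 < t -> f (t *: x) / t <= sup A.
    by move=> t0; apply: ub_le_sup => //; exists t.
  apply: (gauge_nonlinear fG (a := sup A) (b := b / (1 - s)) x0).
  + by apply: le_trans (supA 1 ltr01); rewrite divr_ge0// gauge_ge0.
  + by rewrite divr_gt0.
  + move=> t; rewrite le_eqVlt => /predU1P[<-|t0].
      rewrite scale0r gauge0// mulr0; split => //.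
      by rewrite sub0r oppr_le0 divr_ge0// ltW.
    split; last by rewrite -ler_pdivrMr// supA.
    have h1 : (1 - s) * sup A <= a - s * (g (t *: x) / t).
      rewrite mulrC -ler_pdivlMr//; apply: ge_sup; first by case: hA.
      by move=> _ [r r0 <-]; rewrite ler_pdivlMr// mulrC key.
    have h2 := ler_wpM2r (ltW t0) h1.
    have E : (a - s * (g (t *: x) / t)) * t = a * t - s * g (t *: x).
      by field; rewrite gt_eqF.
    rewrite E in h2.
    have [h3 _] := h t (ltW t0).
    rewrite -(ler_pM2l s1') mulrBr [(1 - s) * (b / _)]mulrC divfK ?gt_eqF//;
      lra.
Qed.

End GaugeMix.

(** * Families constant in time and their affine interpolation *)

Section StaticAndMixedFamilies.
Context {R : realType} {n : nat} {T : R}.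
Hypothesis T0 : 0 < T.
Local Notation V := 'rV[R]_n.
Local Notation P := (R * V)%type.
Local Notation S := (slab T : set P).
Local Notation nb p := (within S (nbhs p)).
Local Notation sp i := (lift ord0 i).
Implicit Types (t s : R) (x y : V) (p q : P) (f g : V -> R).

Definition static_grad f (j : 'I_n.+1) (p : P) : R :=
  if unlift ord0 j is Some i then partial i f p.2 else 0.

Lemma static_C0 f : (forall x, x != 0 -> {for x, continuous f}) ->
  C0_slab T (fun _ => f).
Proof.
move=> fc; apply/C0_slabP => p [_ p0].
by apply: (cvg_comp snd f _ (fc p.2 p0)); apply: cvg_within_filter;
  exact: cvg_snd.
Qed.

Lemma static_slope t (a : R) :
  slope (fun=> a) t s @[s --> within `[0, T] t^'] --> (0 : R).
Proof.
have -> : slope (fun=> a) t = fun=> 0 by apply/funext => s;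
  rewrite /slope subrr mul0r.
exact: cvg_cst.
Qed.

Lemma static_dt f t x : 0 <= t <= T -> dt T (fun _ => f) t x = 0.
Proof.
move=> tT; have PF := time_dnbhs_proper T0 tT.
exact: (cvg_lim _ (static_slope t (f x))).
Qed.

Lemma static_grad_on f :
  C1_off0 f -> grad_on S (fun p => f p.2) (static_grad f).
Proof.
move=> fC.
have pc i x : x != 0 -> {for x, continuous (partial i f)}.
  move=> x0; have [_ gc] := fC x x0.
  have h : (grad f y) 0 i @[y --> x] --> (grad f x) 0 i.
    have gc' : grad f y @[y --> x] --> grad f x by exact: gc.
    exact: (cvg_comp (grad f) (fun v : V => v 0 i) gc'
      (@coord_cvg R n i (grad f x))).
  suff : partial i f y @[y --> x] --> partial i f x by [].
  have <- : grad f x 0 i = partial i f x by rewrite mxE.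
  have <- // : (fun y => grad f y 0 i) = partial i f by apply/funext => y;
    rewrite mxE.
have C1 : C1_slab T (fun _ => f).
  split.
  - by apply: static_C0 => x /fC[/differentiable_continuous].
  - by move=> t x _; exact: cvgP (static_slope t (f x)).
  - apply: (@C0_slab_ext _ _ _ (fun _ _ => 0)).
      by move=> t x [tT _]; rewrite static_dt.
    by apply/C0_slabP => p _; exact: cvg_cst.
  - by move=> t x i [_ /fC[df _]]; exact: diff_derivable.
  - by move=> i; apply: static_C0 => x; exact: pc.
move=> p Sp; have [d Dc] := C1_slab_grad_on C1 Sp.
have E q j : S q -> slab_partial (T := T) (fun _ => f) j q = static_grad f j q.
  by move=> [qT _]; rewrite /slab_partial /static_grad;
    case: (unlift ord0 j) => //; rewrite static_dt.
split; first by apply: (cdiff_eq d) => j; rewrite E.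
move=> j; rewrite -E//; apply: cvg_trans (Dc j); apply: near_eq_cvg.
have Sq : \forall q \near nb p, S q by exact: withinT.
by near=> q; rewrite E//; near: q.
Unshelve. all: by end_near. Qed.

Lemma grad_on_time :
  grad_on S (fun p => p.1 / T) (fun j p => (j == ord0)%:R / T).
Proof.
move=> p _; split; last by move=> j; exact: cvg_cst.
apply: (cdiff_eq (cdiffM (@cdiff_time R n T p) (@cdiff_cst R n S p T^-1))) => j.
by rewrite mulr0 add0r.
Qed.

(** The last term comes from the time dependence of the weights. *)
Definition mix_grad (F G : P -> R) (D E : 'I_n.+1 -> P -> R) (j : 'I_n.+1) p :
  R :=
  (1 - p.1 / T) * D j p + p.1 / T * E j p + (j == ord0)%:R / T * (G p - F p).

Lemma grad_on_mix (F G : P -> R) D E : grad_on S F D -> grad_on S G E ->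
  grad_on S (fun p => (1 - p.1 / T) * F p + p.1 / T * G p) (mix_grad F G D E).
Proof.
move=> FD GE.
have -> : (fun p => (1 - p.1 / T) * F p + p.1 / T * G p) =
    (fun p => F p + p.1 / T * (G p + -1 * F p)) by apply/funext => p; ring.
have h := grad_onD FD (grad_onM grad_on_time
  (grad_onD GE (grad_onM (grad_on_cst (-1)) FD))).
by apply: grad_on_eq h => j p; rewrite /mix_grad; ring.
Qed.

Lemma static_data f : C2_off0 f -> C2_data (T := T) (fun _ => f) (static_grad f)
  (fun l => if unlift ord0 l is Some i then static_grad (partial i f) else fun
    _ _ => 0).
Proof.
move=> [f1 f2]; split; first exact: static_grad_on.
move=> l; rewrite {1}/static_grad; case: (unlift ord0 l) => [i|].
  exact: static_grad_on.
exact: grad_on_cst.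
Qed.

Lemma static_smooth f : gauge f -> C2_off0 f ->
  (forall x, x != 0 -> posdef (hess f x)) ->
    smooth_family (T := T) (fun _ => f).
Proof.
move=> fG f2 fH; split => //; first exact: (data_C2_slab T0 (static_data f2)).
by move=> t x _; exact: fH.
Qed.

Lemma mix_smooth f g : smooth_family (T := T) (fun _ => f) ->
  smooth_family (T := T) (fun _ => g) ->
  smooth_family (T := T) (fun t x => (1 - t / T) * f x + t / T * g x).
Proof.
move=> fF gF; have [D [D2 [[fD fD2] fH]]] := smooth_family_data T0 fF.
have [E [E2 [[gE gE2] gH]]] := smooth_family_data T0 gF.
have [fG _ _] := fF; have [gG _ _] := gF.
pose M := mix_grad (fun p => f p.2) (fun p => g p.2) D E.
(* [M l] is the mixture of [D l] and [E l] plus, for l = 0, the term (g - f) / T; the second summand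
   differentiates that term. *)
pose M2 l j p := mix_grad (D l) (E l) (D2 l) (E2 l) j p
  + (l == ord0)%:R / T * (E j p + -1 * D j p).
have MD : C2_data (T := T) (fun t x => (1 - t / T) * f x + t / T * g x) M M2.
  split; first exact: grad_on_mix.
  move=> l; apply: (grad_on_eq (D := fun j p
    => mix_grad (D l) (E l) (D2 l) (E2 l) j p
    + ((l == ord0)%:R / T * (E j p + (-1 * D j p + 0 * f p.2))
       + 0 * (g p.2 + -1 * f p.2)))).
    by move=> j p; rewrite /M2; ring.
  have -> : M l = (fun p => ((1 - p.1 / T) * D l p + p.1 / T * E l p)
      + (l == ord0)%:R / T * (g p.2 + -1 * f p.2)).
    by apply/funext => p; rewrite /M /mix_grad; ring.
  apply: grad_onD; first exact: grad_on_mix.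
  apply: grad_onM; first exact: grad_on_cst.
  by apply: grad_onD => //; apply: grad_onM => //; exact: grad_on_cst.
have frac t : 0 <= t <= T -> 0 <= t / T <= 1.
  by move=> /andP[t0 tT]; rewrite divr_ge0 ?(ltW T0)//= ler_pdivrMr// mul1r.
apply: (data_smooth_family T0 _ MD) => [t tT|p Sp h h0].
  apply: (@gauge_mix _ _ f g (t / T)); first exact: frac.
  - exact: fG tT.
  - exact: gG tT.
  - exact: (data_C2_off0 T0 MD tT).1.
have -> : \sum_i h 0 i * (\sum_j h 0 j * M2 (sp i) (sp j) p) =
  (1 - p.1 / T) * (\sum_i h 0 i * (\sum_j h 0 j * D2 (sp i) (sp j) p)) +
  p.1 / T * (\sum_i h 0 i * (\sum_j h 0 j * E2 (sp i) (sp j) p)).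
  rewrite !mulr_sumr -big_split; apply: eq_bigr => i _ /=.
  rewrite mulrCA [X in _ = _ + X]mulrCA -mulrDr; congr (_ * _).
  rewrite !mulr_sumr -big_split; apply: eq_bigr => j _ /=.
  by rewrite /M2 /mix_grad /= !mul0r; ring.
have /andP[s0 s1] := frac _ Sp.1.
have hf := fH p Sp h h0; have hg := gH p Sp h h0.
have [->|sN] := eqVneq (p.1 / T) 0; first by rewrite subr0 mul1r mul0r addr0.
rewrite ltr_wpDl//; first by rewrite mulr_ge0 ?subr_ge0// ltW.
by rewrite mulr_gt0// lt_neqAle eq_sym sN.
Qed.

Lemma smooth_static_of_class (f : V -> R) : class_S2 (EFin \o f) ->
  nonlinear_at_infinity (EFin \o f) -> smooth_family (T := T) (fun _ => f).
Proof.
move=> [S1 f2 fH] fnl; apply: static_smooth => //.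
by apply/gauge_class.
Qed.

End StaticAndMixedFamilies.

(** Scaling f by c scales the admissible constants by 1 / c and leaves the touching point where it
    is. *)
Lemma polar_scale (R : realType) (n : nat) (f : 'rV[R]_n -> R) (c : R) y :
  gauge f -> 0 < c ->
  polar (fun y => c%:E * (EFin \o f) y)%E y = (c^-1 * rpolar f y)%:E.
Proof.
move=> fG c0; have -> : (fun y => c%:E * (EFin \o f) y)%E =
  EFin \o (fun y => c * f y).
  by apply/funext => z; rewrite /= EFinM.
have [->|y0] := eqVneq y 0; first by rewrite polar_0 rpolar0 mulr0.
have ty := polar_point_touches fG y0; have [v0 h e] := ty.
have E z : c^-1 * rpolar f y * (c * f z) = rpolar f y * f z.
  by field; rewrite gt_eqF.
apply: polar_eq => [|z|].
- by rewrite mulr_ge0// ?invr_ge0 ltW.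
- by rewrite E.
exists (polar_point f y); last by rewrite E.
by rewrite mulr_gt0// gauge_gt0// polar_point_neq0.
Qed.

Theorem theorem7p1 (R : realType) (n : nat) (T : R)
    (u0 uT : 'rV[R]_n -> \bar R) :
  0 < T ->
  class_S2 u0 -> nonlinear_at_infinity u0 ->
  class_S2 uT -> nonlinear_at_infinity uT ->
  exists u : R -> 'rV[R]_n -> R,
    [/\ nonlinear_at_infinity_solution T u0 uT u,
        (forall w : R -> 'rV[R]_n -> R,
          nonlinear_at_infinity_solution T u0 uT w ->
          forall (t : R) (x : 'rV[R]_n), 0 <= t <= T -> w t x = u t x),
        (forall (t : R) (x : 'rV[R]_n), 0 <= t <= T ->
          (u t x)%:E =
          polar (fun y => (1 - t / T)%:E * polar u0 y
                          + (t / T)%:E * polar uT y)%E x)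
      & (forall (t : R) (x : 'rV[R]_n), 0 < t < T ->
          (u t x)%:E =
          box (fun y => (T / (T - t))%:E * u0 y)%E
              (fun y => (T / t)%:E * uT y)%E x)].
Proof.
move=> T0 S0 N0 ST NT.
have fineE (f : 'rV[R]_n -> \bar R) : class_S2 f -> exists g, f = EFin \o g.
  move=> [[_ ffin _ _] _ _]; exists (fine \o f).
  by apply/funext => x; rewrite /= fineK.
have [f fE] := fineE _ S0; have [g gE] := fineE _ ST; subst u0 uT.
have fF := smooth_static_of_class T0 S0 N0;
  have gF := smooth_static_of_class T0 ST NT.
have T0T : 0 <= (0 : R) <= T by rewrite lexx ltW.
have TT : 0 <= T <= T by rewrite lexx ltW.
have fG : gauge f by have [h _ _] := fF; exact: h T0T.
have gG : gauge g by have [h _ _] := gF; exact: h T0T.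
(* The interpolation takes place among the polars; the polar of this path is the solution. *)
pose v t y := (1 - t / T) * rpolar f y + t / T * rpolar g y.
have vF : smooth_family (T := T) v.
  apply: (mix_smooth T0); [exact: smooth_family_polar fF|exact:
    smooth_family_polar gF].
have [vG _ _] := vF.
have uF := smooth_family_polar T0 vF.
have uE t : 0 <= t <= T -> forall x, (rpolar (v t) x)%:E =
    polar (fun y => (1 - t / T)%:E * polar (EFin \o f) y
                    + (t / T)%:E * polar (EFin \o g) y)%E x.
  move=> tT x; rewrite -rpolarE; last exact: vG.
  congr (polar _ x); apply/funext => y.
  by rewrite !rpolarE// /= -!EFinM -EFinD.
have v0 : v 0 = rpolar f.
  by apply/funext => y; rewrite /v mul0r subr0 mul1r mul0r addr0.
have vT : v T = rpolar g.
  by apply/funext => y; rewrite /v divff ?gt_eqF// subrr mul0r mul1r add0r.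
exists (fun t => rpolar (v t)); split.
- have [uC uS] := (smooth_family_class T0 _).1 uF.
  split => //.
  + apply: (polar_affine_pde T0 uF (a := rpolar f) (b := rpolar g)) => t y tT.
    by rewrite rpolarK//; exact: vG.
  + by rewrite v0 rpolarK.
  + by rewrite vT rpolarK.
- move=> w [wC wS wpde w0 wT] t x tT.
  have wF : smooth_family (T := T) w by apply/(smooth_family_class T0).
  have [wG _ _] := wF.
  have w0E : w 0 = f by apply/funext => y; have := congr1 (@^~ y) w0 => -[].
  have wTE : w T = g by apply/funext => y; have := congr1 (@^~ y) wT => -[].
  (* A solution is recovered from its polar, which the equation forces to be the affine path between
     the polars of the end values. *)
  rewrite -[w t](rpolarK (wG t tT)); congr (rpolar _ x); apply/funext => y.
  by rewrite (pde_polar_affine T0 wF wpde y tT) w0E wTE.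
- by move=> t x tT; exact: uE.
- move=> t x /andP[t0 tT].
  have tI : 0 <= t <= T by rewrite !ltW.
  rewrite uE// /box; congr (polar _ x); apply/funext => y.
  have Tt : 0 < T - t by rewrite subr_gt0.
  (* The factor T / (T - t) divides the polar and so produces the weight 1 - t / T; likewise T / t
     produces t / T. *)
  rewrite !polar_scale ?divr_gt0// !rpolarE// -!EFinM.
  congr (_%:E + _%:E)%E; congr (_ * _).
    by field; rewrite !gt_eqF.
  by rewrite invf_div.
Qed.
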